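(* Let $X$ be a separable Banach space and $T\in L(X)$. Consider the following assertions: (1) $B_T$ is chaotic on $\ell^1(X,\mathbb{Z})$; (2) $T$ satisfies the Frequent Hypercyclicity Criterion; (3) $T$ satisfies the $\underline{D}$-Hypercyclicity Criterion; (4) $B_T$ is frequently hypercyclic on $\ell^1(X,\mathbb{Z})$; (5) $T$ is frequently hypercyclic on $X$. Then $$(1)\Leftrightarrow(2)\Rightarrow(3)\Leftrightarrow(4)\Rightarrow(5),$$ and the other implications are false in general; that is, for any two assertions $(i)$, $(j)$ in the list such that $(i)\Rightarrow(j)$ does not follow from the displayed chain, there exist a separable Banach space $X$ and $T\in L(X)$ satisfying $(i)$ but not $(j)$.
   Context: $L(X)$ denotes the bounded linear operators on $X$. $\ell^1(X,\mathbb{Z})$ is the Banach space of families $(x_k)_{k\in\mathbb{Z}}$ in $X$ with $\sum_k\|x_k\|<\infty$ ($\ell^1$-norm), and $B_T$ is the bounded operator $B_T(x_k)_{k\in\mathbb{Z}}=(Tx_{k+1})_{k\in\mathbb{Z}}$. The lower density of a set $A$ of non-negative integers is $\liminf_{N\to\infty}\frac{|A\cap[0,N]|}{N+1}$; $\underline{D}$ denotes the family of sets with positive lower density. An operator $S$ on a Banach space $Y$ is chaotic if it is hypercyclic (some $y\in Y$ has dense orbit $\{S^ny:n\ge 0\}$) and its set of periodic points (those $y$ with $S^dy=y$ for some $d\ge1$) is dense in $Y$; it is frequently hypercyclic if there exists $y\in Y$ such that for every non-empty open set $U\subset Y$ the set $\{n\ge 0:S^ny\in U\}$ belongs to $\underline{D}$.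 $T$ satisfies the Frequent Hypercyclicity Criterion if there are a dense subset $X_0$ of $X$ and a map $S:X_0\to X_0$ (not assumed linear or continuous) such that for all $x\in X_0$: $\sum_{n=1}^\infty\|T^nx\|<\infty$, $\sum_{n=1}^\infty\|S^nx\|<\infty$, and $TSx=x$. $T$ satisfies the $\underline{D}$-Hypercyclicity Criterion if there exist a dense subset $Y_0\subset X$, maps $S_n:Y_0\to X$, $n\ge0$, and (pairwise) disjoint sets $A_k\in\underline{D}$, $k\ge1$, such that for each $y\in Y_0$: (i) $\sum_{n\in A_k}\|S_ny\|$ converges uniformly in $k\ge1$; (ii) for any $k_0\ge1$ and any $\varepsilon>0$ there exists $k\ge k_0$ such that for any $n\in\bigcup_{l\ge1}A_l$ one has $\sum_{i\in A_k\setminus\{n\}}\|T^nS_iy\|\le\varepsilon$, and such that for any $\delta>0$ there exists $l_0\ge1$ such that for any $n\in\bigcup_{l\ge l_0}A_l$ one has $\sum_{i\in A_k\setminus\{n\}}\|T^nS_iy\|\le\delta$; (iii) $\sup_{n\in A_k}\|T^nS_ny-y\|\to0$ as $k\to\infty$. *)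

(* Defs.v *)
From HB Require Import structures.
From Stdlib Require Import Relation_Operators.
From mathcomp Require Import all_boot all_order all_algebra.
From mathcomp Require Import all_classical all_reals all_analysis.
From mathcomp Require Import complex.

Set Implicit Arguments.
Unset Strict Implicit.
Unset Printing Implicit Defensive.

Import Order.TTheory GRing.Theory Num.Theory.
Import numFieldNormedType.Exports.

Local Open Scope classical_set_scope.
Local Open Scope ring_scope.

(** Banach spaces may be real or complex.  In MathComp-Analysis the norm of a
    normed module over [K] takes its values in [K], so that for [K = R[i]] a
    norm is a nonnegative element of [R[i]]; [rnorm] below is the same norm
    with values in [R], which allows sums in [\bar R]. *)

Variant scalars := RealScalars | ComplexScalars.

Definition scalar_field (R : realType) (F : scalars) : numFieldType :=
  match F with RealScalars => R | ComplexScalars => R[i] end.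

Definition rpart (R : realType) (F : scalars) : scalar_field R F -> R :=
  match F with RealScalars => id | ComplexScalars => @complex.Re R end.

Definition of_real (R : realType) (F : scalars) : R -> scalar_field R F :=
  match F with RealScalars => id | ComplexScalars => real_complex R end.
Arguments of_real {R} F.

Section ScalarsTheory.
Variables (R : realType) (F : scalars).
Local Notation K := (scalar_field R F).

Lemma rpartD (a b : K) : rpart (a + b) = rpart a + rpart b.
Proof. by move: a b; case: F => //= -[a a'] [b b']. Qed.

Lemma rpart_ge0 (a : K) : 0 <= a -> 0 <= rpart a.
Proof. by move: a; case: F => //= -[a b]; rewrite lecE /= => /andP[]. Qed.

Lemma ler_rpart (a b : K) : a <= b -> rpart a <= rpart b.
Proof. by move: a b; case: F => //= -[a a'] [b b']; rewrite lecE /= => /andP[]. Qed.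

Lemma rpartK (a : K) : 0 <= a -> of_real F (rpart a) = a.
Proof.
by move: a; case: F => //= -[a b]; rewrite lecE /= => /andP[/eqP -> _].
Qed.

Lemma of_realK (a : R) : rpart (of_real F a) = a.
Proof. by case: F. Qed.

Lemma of_realD (a b : R) : of_real F (a + b) = of_real F a + of_real F b.
Proof. by case: F => //=; rewrite rmorphD. Qed.

Lemma of_realM (a b : R) : of_real F (a * b) = of_real F a * of_real F b.
Proof. by case: F => //=; rewrite rmorphM. Qed.

Lemma ler_of_real (a b : R) : (of_real F a <= of_real F b) = (a <= b).
Proof. by case: F => //=; rewrite lecR. Qed.

Lemma of_real0 : of_real F (0 : R) = 0.
Proof. by case: F. Qed.

Lemma rpartM_ge0 (a b : K) : 0 <= a -> 0 <= b ->
  rpart (a * b) = rpart a * rpart b.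
Proof.
by move=> a0 b0; rewrite -{1}(rpartK a0) -{1}(rpartK b0) -of_realM of_realK.
Qed.

Variable X : normedModType K.

Definition rnorm (x : X) : R := rpart `|x|.

Lemma rnormK (x : X) : of_real F (rnorm x) = `|x|.
Proof. exact: rpartK. Qed.

Lemma rnorm_ge0 (x : X) : 0 <= rnorm x.
Proof. exact: rpart_ge0. Qed.

Lemma rnorm0 : rnorm 0 = 0.
Proof. by rewrite /rnorm normr0 -of_real0 of_realK. Qed.

Lemma rnorm_eq0 (x : X) : rnorm x = 0 -> x = 0.
Proof. by move=> x0; apply/normr0_eq0; rewrite -rnormK x0 of_real0. Qed.

Lemma ler_rnormD (x y : X) : rnorm (x + y) <= rnorm x + rnorm y.
Proof. by rewrite -rpartD; apply/ler_rpart/ler_normD. Qed.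

Lemma rnormZ (a : K) (x : X) : rnorm (a *: x) = rpart `|a| * rnorm x.
Proof. by rewrite /rnorm normrZ rpartM_ge0. Qed.

End ScalarsTheory.

Section Ell1.
Variables (R : realType) (F : scalars).
Local Notation K := (scalar_field R F).
Variable X : normedModType K.

Definition esum_norm (x : int -> X) : \bar R :=
  (\esum_(k in [set: int]) (rnorm (x k))%:E)%E.

Definition ell1_pred : {pred int -> X} := fun x => (esum_norm x < +oo)%E.

Record ell1 := Ell1 { ell1_val :> int -> X; _ : ell1_val \in ell1_pred }.

HB.instance Definition _ := [isSub for ell1_val].
HB.instance Definition _ := [Choice of ell1 by <:].

Lemma esum_norm_ge0 x : (0 <= esum_norm x)%E.
Proof. by apply: esum_ge0 => k _; rewrite lee_fin rnorm_ge0. Qed.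

Lemma esum_normD (x y : int -> X) :
  (esum_norm (x + y)%R <= esum_norm x + esum_norm y)%E.
Proof.
rewrite /esum_norm -esumD; do ?[by move=> k _; rewrite lee_fin rnorm_ge0].
by apply: le_esum => k _; rewrite -EFinD lee_fin ler_rnormD.
Qed.

Lemma le_esum_norm (c : R) (h : int -> int) (x y : int -> X) :
  bijective h -> 0 <= c ->
  (forall k, rnorm (y k) <= c * rnorm (x (h k))) ->
  (esum_norm y <= c%:E * esum_norm x)%E.
Proof.
move=> bh c0 yx; rewrite /esum_norm.
rewrite [X in (_ <= _ * X)%E](reindex_esum setT setT h); last first.
  by rewrite setTT_bijective.
apply: ge_ereal_sup => _ [A [finA _] <-].
apply: (@le_trans _ _ (c%:E * \sum_(k \in A) (rnorm (x (h k)))%:E)%E).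
  rewrite ge0_mule_fsumr; last by move=> k; rewrite lee_fin rnorm_ge0.
  by apply: lee_fsum => // k _; rewrite -EFinM lee_fin.
apply: lee_wpmul2l; [by rewrite lee_fin|apply: ereal_sup_ubound].
by exists A.
Qed.

Lemma esum_normZ (a : K) (x : int -> X) :
  (esum_norm (a *: x)%R <= (rpart `|a|%R)%:E * esum_norm x)%E.
Proof.
apply: (@le_esum_norm _ id); first by exists id.
  exact: rpart_ge0.
by move=> k; rewrite -rnormZ.
Qed.

Lemma ell1_submod_closed : submod_closed ell1_pred.
Proof.
split=> [|a x y].
  rewrite /in_mem/= /ell1_pred /esum_norm esum1 ?ltry// => k _.
  by rewrite rnorm0.
rewrite /in_mem/= /ell1_pred => xfin yfin.
apply: le_lt_trans (esum_normD _ _) _.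
rewrite lte_add_pinfty//; apply: le_lt_trans (esum_normZ _ _) _.
by rewrite lte_mul_pinfty// ?lee_fin ?rpart_ge0.
Qed.

HB.instance Definition _ := GRing.isSubmodClosed.Build _ _ ell1_pred
  ell1_submod_closed.
HB.instance Definition _ := [SubChoice_isSubLmodule of ell1 by <:].

Definition ell1_norm (x : ell1) : K := of_real F (fine (esum_norm x)).

Lemma ell1_fin (x : ell1) : esum_norm x \is a fin_num.
Proof. by rewrite ge0_fin_numE ?esum_norm_ge0//; case: x. Qed.

Lemma ell1_normD (x y : ell1) : ell1_norm (x + y) <= ell1_norm x + ell1_norm y.
Proof.
rewrite /ell1_norm -of_realD ler_of_real -fineD ?ell1_fin//.
by rewrite fine_le ?fin_numD ?ell1_fin ?esum_normD.
Qed.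

Lemma ell1_normZ_le a (x : ell1) : ell1_norm (a *: x) <= `|a| * ell1_norm x.
Proof.
rewrite /ell1_norm -[`|a|]rpartK// -of_realM ler_of_real.
rewrite -[X in X * _]/(fine (rpart `|a|)%:E) -fineM ?ell1_fin//.
by rewrite fine_le ?fin_numM ?ell1_fin ?esum_normZ.
Qed.

Lemma ell1_normZ a (x : ell1) : ell1_norm (a *: x) = `|a| * ell1_norm x.
Proof.
apply/eqP; rewrite eq_le ell1_normZ_le/=.
have [->|a0] := eqVneq a 0.
  rewrite normr0 mul0r -of_real0 ler_of_real fine_ge0 ?esum_norm_ge0//.
rewrite -{1}[x](scalerK a0) -ler_pdivlMl ?normr_gt0// -normfV.
exact: ell1_normZ_le.
Qed.

Lemma ell1_norm0_eq0 (x : ell1) : ell1_norm x = 0 -> x = 0.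
Proof.
rewrite -of_real0 => /(congr1 (@rpart R F)); rewrite !of_realK => x0.
apply/val_inj/funext => k /=; apply/rnorm_eq0/eqP.
rewrite eq_le rnorm_ge0 andbT -x0 -lee_fin fineK ?ell1_fin//.
apply: ereal_sup_ubound; exists [set k] => //.
by rewrite fsbig_set1.
Qed.

HB.instance Definition _ := Lmodule_isNormed.Build K ell1
  ell1_normD ell1_normZ ell1_norm0_eq0.

End Ell1.

Section Operators.
Variables (R : realType) (F : scalars).
Local Notation K := (scalar_field R F).

Record bounded_operator (X : normedModType K) := BoundedOperator {
  operator :> {linear X -> X};
  operator_bounded : bounded_near operator (nbhs (0 : X)) }.

End Operators.

Notation "''L' ( X )" := (bounded_operator X)
  (at level 8, X at level 99, format "''L' ( X )").

Section BT.
Variables (R : realType) (F : scalars).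
Local Notation K := (scalar_field R F).
Variables (X : normedModType K) (T : 'L(X)).

Definition shift_fun (x : int -> X) : int -> X := fun k => T (x (k + 1)).

Lemma operator_rnorm : exists2 c : R, 0 <= c &
  forall x, rnorm (T x) <= c * rnorm x.
Proof.
have [M M0 TM] := pinfty_ex_gt0 ((linear_boundedP T).1 (operator_bounded T)).
exists (rpart M) => [|x]; first exact/rpart_ge0/ltW.
rewrite /rnorm -rpartM_ge0 ?(ltW M0)//; exact/ler_rpart/TM.
Qed.

Lemma shift_esum_norm : exists2 c : R, 0 <= c &
  forall x, (esum_norm (shift_fun x) <= c%:E * esum_norm x)%E.
Proof.
have [c c0 Tc] := operator_rnorm; exists c => // x.
apply: (@le_esum_norm _ _ _ _ (fun k => k + 1)) => // [|k].
  by exists (fun k => k - 1) => k; rewrite ?addrK ?subrK.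
exact: Tc.
Qed.

Lemma shift_ell1 (x : ell1 X) : shift_fun x \in @ell1_pred _ _ X.
Proof.
have [c c0 Tc] := shift_esum_norm; rewrite /in_mem/= /ell1_pred.
apply: le_lt_trans (Tc _) _; rewrite -ge0_fin_numE.
  by rewrite fin_numM ?ell1_fin.
by rewrite mule_ge0 ?esum_norm_ge0 ?lee_fin.
Qed.

Definition BT_fun (x : ell1 X) : ell1 X := Ell1 (shift_ell1 x).

Lemma BT_linear : linear BT_fun.
Proof.
move=> a x y; apply/val_inj/funext => k /=.
by rewrite /shift_fun/= linearP.
Qed.

HB.instance Definition _ := GRing.isLinear.Build K (ell1 X) (ell1 X) _ BT_fun
  BT_linear.

Lemma BT_bounded : bounded_near BT_fun (nbhs (0 : ell1 X)).
Proof.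
have [c c0 Tc] := shift_esum_norm.
apply/linear_boundedP; near=> M => x.
apply: (@le_trans _ _ (of_real F c * `|x|)).
  rewrite /Num.norm/= /ell1_norm -of_realM ler_of_real.
  rewrite -[X in X * _]/(fine c%:E) -fineM ?ell1_fin//.
  by rewrite fine_le ?fin_numM ?ell1_fin ?Tc.
rewrite ler_wpM2r//; near: M; apply: nbhs_pinfty_ge.
by rewrite ger0_real// -of_real0 ler_of_real.
Unshelve. all: by end_near. Qed.

Definition BT : 'L(ell1 X) := BoundedOperator BT_bounded.

End BT.

Section Dynamics.

Definition separable (Y : topologicalType) :=
  exists2 D : set Y, countable D & dense D.

Definition hypercyclic (Y : topologicalType) (S : Y -> Y) :=
  exists y, dense [set iter n S y | n in [set: nat]].

Definition periodic_points (Y : Type) (S : Y -> Y) : set Y :=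
  [set y | exists2 d, (0 < d)%N & iter d S y = y].

Definition chaotic (Y : topologicalType) (S : Y -> Y) :=
  hypercyclic S /\ dense (periodic_points S).

Definition lower_density (R : realType) (A : set nat) : \bar R :=
  limn_einf (fun N : nat =>
    (#|[pred i : 'I_N.+1 | nat_of_ord i \in A]|%:R / N.+1%:R)%:E).

Definition lower_dense (R : realType) : set (set nat) :=
  [set A | (0 < lower_density R A)%E].

Definition frequently_hypercyclic (R : realType) (Y : topologicalType)
    (S : Y -> Y) :=
  exists y, forall U : set Y, open U -> U !=set0 ->
    lower_dense R [set n | U (iter n S y)].

End Dynamics.

Section Criteria.
Variables (R : realType) (F : scalars).
Local Notation K := (scalar_field R F).
Variables (X : normedModType K) (T : X -> X).

(* Maps whose domain is a subset of [X] are total functions of which only the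
   values on that subset are used. *)

Definition frequent_hypercyclicity_criterion :=
  exists (X0 : set X) (S : X -> X),
    [/\ dense X0,
        set_fun X0 X0 S &
        forall x, X0 x ->
          [/\ (\sum_(1 <= n <oo) (rnorm (iter n T x))%:E < +oo)%E,
              (\sum_(1 <= n <oo) (rnorm (iter n S x))%:E < +oo)%E &
              T (S x) = x]].

(* The sets [A k] and the unions are indexed by [k >= 1]; [A 0] is not used. *)
Definition lower_dense_hypercyclicity_criterion :=
  exists (Y0 : set X) (S : nat -> X -> X) (A : nat -> set nat),
    [/\ dense Y0,
        forall k, (1 <= k)%N -> lower_dense R (A k),
        trivIset [set k | (1 <= k)%N] A &
        forall y, Y0 y ->
          [/\ exists s : nat -> R,
                {uniform [set k | (1 <= k)%N],
                  (fun (N k : nat) =>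
                     \sum_(0 <= n < N | n \in A k) rnorm (S n y)) @ \oo --> s},
              forall k0 (eps : R), (1 <= k0)%N -> 0 < eps ->
                exists2 k, (k0 <= k)%N &
                  (forall n, (\bigcup_(l in [set l | (1 <= l)%N]) A l) n ->
                    (\esum_(i in A k `\ n) (rnorm (iter n T (S i y)))%:E
                      <= eps%:E)%E) /\
                  (forall delta : R, 0 < delta ->
                    exists2 l0, (1 <= l0)%N &
                      forall n, (\bigcup_(l in [set l | (l0 <= l)%N]) A l) n ->
                        (\esum_(i in A k `\ n) (rnorm (iter n T (S i y)))%:E
                          <= delta%:E)%E) &
              (fun k => ereal_sup
                 [set (rnorm (iter n T (S n y) - y))%:E | n in A k])
                @ \oo --> 0%E]].

End Criteria.

Variant assertion :=
  | BT_chaotic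
  | T_FHC
  | T_lower_dense_HC
  | BT_frequently_hypercyclic
  | T_frequently_hypercyclic.

Definition holds (R : realType) (F : scalars)
    (X : normedModType (scalar_field R F)) (T : 'L(X)) (i : assertion) : Prop :=
  match i with
  | BT_chaotic => chaotic (BT T)
  | T_FHC => frequent_hypercyclicity_criterion T
  | T_lower_dense_HC => lower_dense_hypercyclicity_criterion T
  | BT_frequently_hypercyclic => frequently_hypercyclic R (BT T)
  | T_frequently_hypercyclic => frequently_hypercyclic R T
  end.

(* The implications (and both directions of the equivalences) of the chain
   [BT_chaotic <-> T_FHC -> T_lower_dense_HC <-> BT_frequently_hypercyclic
    -> T_frequently_hypercyclic]. *)
Variant arrow : assertion -> assertion -> Prop :=
  | arrow12 : arrow BT_chaotic T_FHC
  | arrow21 : arrow T_FHC BT_chaotic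
  | arrow23 : arrow T_FHC T_lower_dense_HC
  | arrow34 : arrow T_lower_dense_HC BT_frequently_hypercyclic
  | arrow43 : arrow BT_frequently_hypercyclic T_lower_dense_HC
  | arrow45 : arrow BT_frequently_hypercyclic T_frequently_hypercyclic.

Definition follows : assertion -> assertion -> Prop :=
  clos_refl_trans assertion arrow.

(* Main.v *)
Require Import Defs.
From HB Require Import structures.
From Stdlib Require Import Relation_Operators.
From mathcomp Require Import all_boot all_order all_algebra finmap.
From mathcomp Require Import all_classical all_reals all_analysis.
From mathcomp Require Import complex zify lra ring.

Set Implicit Arguments.
Unset Strict Implicit.
Unset Printing Implicit Defensive.

Import Order.TTheory GRing.Theory Num.Theory.
Import numFieldNormedType.Exports.

Local Open Scope classical_set_scope.
Local Open Scope ring_scope.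


(* (3) => (5): a sum of the vectors [S_i y_j], [i] in [A (k_j)], is frequently
   hypercyclic when [k_j] grows fast. The criterion passes from [T] to [B_T]
   because vectors [sum_j e_j (x) T^(q_j) x] are dense when [T] is hypercyclic;
   this gives (3) => (4). Conversely, if [u] is frequently hypercyclic for
   [B_T], the times at which its orbit is close to large multiples of
   [sum_(j < k) e_(-j) (x) y_j] are automatically separated, and suitable
   multiples of the coordinates of [u] serve as preimages [S_n y_j].
   (1) <=> (2): a point of period [N] of [B_T] is a two-sided orbit of [T]
   spaced by [N], and its coordinates have summable backward orbits.
   (3) does not imply (2): in an infinitely branching weighted tree every node
   has small preimages of every order, but a whole backward orbit has to pass
   through infinitely many levels without losing mass. (5) does not imply (3):
   a weighted shift with [|T^n| = n + 1] on null sequences is frequently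
   hypercyclic, while preimages of order [n] have norm at least [c / n]. *)

(** * Finite sums and lower density *)

(** Part (ii) of the criterion provides an index k for one vector at a time, and the indices found
    for two vectors need not agree. Hence the criterion cannot be carried to [B_T] by treating the
    coordinates of a finite sequence separately. Taking all coordinates in the orbit of one vector x
    removes the difficulty: every estimate for such a tensor is the estimate for x, up to a constant
    that does not depend on the time. In the tree, the weights along a complete branch from one root
    to the next have product 1. A preimage shrinks while it climbs a path, but regains its whole
    size at the next root; this is why good preimages of each single order exist although a summable
    backward orbit must vanish at the initial root. For the shift the supremum norm is decisive.
    Blocks of size comparable to 1 / n, placed along a set of positive lower density, still form a
    null sequence, although their norms are not summable. *)

Section FiniteSums.
Context {R : realType}.

(** Bounding all sums over duplicate-free finite lists keeps absolute sums inside [R] and lets them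
    be moved along injections and partitions without convergence arguments. *)
Definition sum_le (I : choiceType) (D : set I) (f : I -> R) (c : R) :=
  forall s : seq I, uniq s -> (forall i, i \in s -> D i) ->
    \sum_(i <- s) f i <= c.

Variable I : choiceType.
Implicit Types (D : set I) (f g : I -> R) (s : seq I).

Lemma sum_leP D f c : (\esum_(i in D) (f i)%:E <= c%:E)%E <-> sum_le D f c.
Proof.
split=> [h s us sD|h].
  rewrite -lee_fin -sumEFin; apply: le_trans h.
  apply: ereal_sup_ubound; exists [set` s].
    by split; [exact: finite_seq|move=> i /= /sD].
  by rewrite -fsbig_seq.
apply: ge_ereal_sup => _ [A [finA AD] <-].
rewrite fsbig_finite//= sumEFin lee_fin; apply: h; first exact: fset_uniq.
by move=> i; rewrite in_fset_set// inE => /AD.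
Qed.

Lemma sum_le_ge0 D f c : sum_le D f c -> 0 <= c.
Proof. by move=> /(_ [::] isT); rewrite big_nil; apply. Qed.

Lemma sum_le_sub D D' f c : D' `<=` D -> sum_le D f c -> sum_le D' f c.
Proof. by move=> DD h s us sD; apply: h => // i /sD /DD. Qed.

Lemma sum_le_ler D f c c' : c <= c' -> sum_le D f c -> sum_le D f c'.
Proof. by move=> cc h s us sD; apply: le_trans cc; exact: h. Qed.

Lemma sum_le_le D f g c : (forall i, D i -> f i <= g i) ->
  sum_le D g c -> sum_le D f c.
Proof.
move=> fg h s us sD; apply: le_trans (h s us sD).
by rewrite big_seq [leRHS]big_seq; apply: ler_sum => i /sD/fg.
Qed.

Lemma sum_leD D f g a b : sum_le D f a -> sum_le D g b ->
  sum_le D (fun i => f i + g i) (a + b).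
Proof.
by move=> ha hb s us sD; rewrite big_split lerD// ?ha// ?hb.
Qed.

Lemma sum_leZ D f c k : 0 <= k -> sum_le D f c ->
  sum_le D (fun i => k * f i) (k * c).
Proof. by move=> k0 h s us sD; rewrite -mulr_sumr ler_wpM2l// h. Qed.

Lemma sum_le1 D f c i : D i -> sum_le D f c -> f i <= c.
Proof.
move=> Di /(_ [:: i] isT); rewrite big_seq1; apply=> j.
by rewrite inE => /eqP->.
Qed.

Lemma sum_le0 D : sum_le D (fun=> 0) 0.
Proof. by move=> s _ _; rewrite big1. Qed.

Lemma sum_leU D D' f a b : (forall i, 0 <= f i) ->
  sum_le D f a -> sum_le D' f b -> sum_le (D `|` D') f (a + b).
Proof.
move=> f0 ha hb s us sD.
rewrite (bigID (fun i => `[<D i>]))/= lerD//.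
  rewrite -big_filter ha ?filter_uniq// => i.
  by rewrite mem_filter => /andP[/asboolP].
rewrite -big_filter hb ?filter_uniq// => i.
by rewrite mem_filter => /andP[/asboolPn nD /sD []].
Qed.

Lemma sum_le_seq s f : (forall i, 0 <= f i) ->
  sum_le [set` s] f (\sum_(i <- undup s) f i).
Proof.
move=> f0 t ut ts.
have <- : \sum_(i <- undup s | i \in t) f i = \sum_(i <- t) f i.
  rewrite -big_filter; apply: perm_big; apply: uniq_perm => //.
    by rewrite filter_uniq// undup_uniq.
  move=> i; rewrite mem_filter mem_undup andb_idr//; exact: ts.
by rewrite [leRHS](bigID (mem t))/= lerDl sumr_ge0.
Qed.

(** A finite list whose sum is within e of the supremum of all finite sums leaves at most e for
    everything outside it. *)
Lemma sum_le_tail D f c e : (forall i, 0 <= f i) -> sum_le D f c -> 0 < e ->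
  exists s, sum_le (D `\` [set` s]) f e.
Proof.
move=> f0 h e0.
pose B := [set x : R | exists s, [/\ uniq s, forall i, i \in s -> D i &
  x = \sum_(i <- s) f i]].
have supB : has_sup B.
  split; first by exists 0; exists [::]; split=> //; rewrite big_nil.
  by exists c => _ [s [us sD ->]]; exact: h.
have [_ [s [us sD ->]] hs] := sup_adherent e0 supB.
exists s => t ut tD.
have : \sum_(i <- s ++ t) f i <= sup B.
  apply: ub_le_sup; first exact: supB.2.
  exists (s ++ t); split=> //.
    rewrite cat_uniq us ut andbT/=; apply/hasPn => i /tD[_ /= si].
    by apply/negP.
  by move=> i; rewrite mem_cat => /orP[/sD//|/tD[]].
rewrite big_cat/=; lra.
Qed.

Lemma sum_le_inj (J : choiceType) (h : J -> I) (E : set J) D f c :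
  (forall i j, E i -> E j -> h i = h j -> i = j) ->
  (forall i, E i -> D (h i)) ->
  sum_le D f c -> sum_le E (fun j => f (h j)) c.
Proof.
move=> hinj hD hf s us sE; rewrite -(big_map h xpredT).
apply: hf => [|i /mapP[j /sE/hD ? ->//]].
by rewrite map_inj_in_uniq// => i j /sE Ei /sE Ej; exact: hinj.
Qed.

End FiniteSums.

Lemma sum_le_tailn {R : realType} (D : set nat) (f : nat -> R) c e :
  (forall i, 0 <= f i) -> sum_le D f c -> 0 < e ->
  exists N, sum_le [set n | D n /\ (N <= n)%N] f e.
Proof.
move=> f0 h e0; have [s hs] := sum_le_tail f0 h e0.
exists (\max_(i <- s) i).+1; apply: sum_le_sub hs => n [Dn Nn]; split=> //= ns.
by move: Nn; rewrite ltnNge leq_bigmax_seq.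
Qed.

Lemma sum_le_iota {R : realType} (f : nat -> R) c m n :
  sum_le setT f c -> \sum_(m <= i < n) f i <= c.
Proof. by move=> h; apply: h => //; exact: iota_uniq. Qed.

Lemma sum_le_series {R : realType} (f : nat -> R) c :
  (forall i, 0 <= f i) -> (forall n, \sum_(0 <= i < n) f i <= c) ->
  sum_le setT f c.
Proof.
move=> f0 h s us _.
have [n sn] : exists n, forall i, i \in s -> (i < n)%N.
  by exists (\max_(i <- s) i).+1 => i si; rewrite ltnS leq_bigmax_seq.
apply: le_trans (h n); rewrite /index_iota subn0.
have <- : \sum_(i <- iota 0 n | i \in s) f i = \sum_(i <- s) f i.
  rewrite -big_filter; apply: perm_big; apply: uniq_perm => //.
    by rewrite filter_uniq// iota_uniq.
  by move=> i; rewrite mem_filter mem_iota/= add0n andb_idr//; exact: sn.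
by rewrite [leRHS](bigID (mem s))/= lerDl sumr_ge0.
Qed.

Lemma sum_le_geometric {R : realType} (n : nat) :
  sum_le setT (fun k : nat => 2 ^- (k + n) : R) (2 * 2 ^- n).
Proof.
apply: sum_le_series => [i|m]; first by rewrite invr_ge0 exprn_ge0.
have -> : \sum_(0 <= i < m) (2 ^- (i + n) : R) = 2 * 2 ^- n - 2 * 2 ^- (m + n).
  elim: m => [|m IH]; first by rewrite big_nil add0n subrr.
  rewrite big_nat_recr//= IH addSn exprS invfM mulVKf ?pnatr_eq0//.
  ring.
by rewrite gerBl mulr_ge0// invr_ge0 exprn_ge0.
Qed.

Section LowerDensity.
Context {R : realType}.
Implicit Type A : set nat.

Local Notation count A N := (#|[pred i : 'I_N.+1 | nat_of_ord i \in A]|).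

Lemma lower_denseP A : lower_dense R A <->
  exists2 d : R, 0 < d & exists N0, forall N, (N0 <= N)%N ->
    d * N.+1%:R <= (count A N)%:R.
Proof.
rewrite /lower_dense/= /lower_density limn_einf_lim.
set u := (fun N => _).
have hl : limn (einfs u) = ereal_sup (range (einfs u)).
  by apply/cvg_lim => //; apply: ereal_nondecreasing_cvgn; exact: nondecreasing_einfs.
rewrite hl; split.
  move=> /ereal_sup_gt[_ [n _ <-] n0].
  have uN N : (n <= N)%N -> (einfs u n <= u N)%E.
    by move=> nN; apply: ereal_inf_lbound; exists N.
  have fn : einfs u n \is a fin_num.
    rewrite fin_numE gt_eqF ?(lt_trans _ n0) ?ltNy0//=.
    by rewrite lt_eqF//; apply: le_lt_trans (uN n (leqnn n)) _; rewrite ltry.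
  exists (fine (einfs u n)); first by rewrite -lte_fin fineK.
  exists n => N nN; rewrite -ler_pdivlMr ?ltr0n//.
  by rewrite -lee_fin fineK//; exact: uN.
move=> [d d0 [N0 h]].
apply: (@lt_le_trans _ _ d%:E); first by rewrite lte_fin.
apply: le_trans (ereal_sup_ubound _); last by exists N0.
apply: le_ereal_inf_tmp => _ [N /= N0N <-].
by rewrite lee_fin ler_pdivlMr ?ltr0n// h.
Qed.

Lemma lower_dense_sub A B : A `<=` B -> lower_dense R A -> lower_dense R B.
Proof.
move=> AB /lower_denseP[d d0 [N0 h]]; apply/lower_denseP; exists d => //.
exists N0 => N /h /le_trans; apply; rewrite ler_nat subset_leq_card//.
by apply/fintype.subsetP => i; rewrite !inE => /AB.
Qed.

(** The N / C first values of h are distinct and at most N; the factor 2 in the density absorbs the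
    rounding of N / C once N >= C. *)
Lemma lower_dense_inj A (h : nat -> nat) C : injective h ->
  (forall m, h m <= C * m.+1)%N -> (forall m, A (h m)) -> lower_dense R A.
Proof.
move=> hinj hC hA.
have C0 : (0 < C)%N.
  by rewrite lt0n; apply: contraTneq isT => C0; have := hC 0; have := hC 1;
     rewrite C0 !mul0n !leqn0 => /eqP e1 /eqP e0;
     have := hinj 0 1 (etrans e0 (esym e1)).
apply/lower_denseP; exists (2 * C%:R)^-1.
  by rewrite invr_gt0 mulr_gt0// ltr0n.
exists C => N CN.
have hN (m : 'I_(N %/ C)) : (h m < N.+1)%N.
  rewrite ltnS; apply: leq_trans (hC m) _; rewrite mulnC.
  by rewrite -leq_divRL//.
have : (N %/ C <= count A N)%N.
  rewrite -[X in (X <= _)%N]card_ord.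
  rewrite -(@card_imset _ _ (fun m => Ordinal (hN m))); last first.
    by move=> i j /(congr1 val)/= /hinj/val_inj.
  apply: subset_leq_card; apply/fintype.subsetP => _ /imsetP[m _ ->].
  by rewrite inE; exact: hA.
rewrite -(ler_nat R); apply: le_trans.
rewrite mulrC ler_pdivrMr ?mulr_gt0 ?ltr0n// -!natrM ler_nat.
have := divn_eq N C; have := ltn_pmod N C0.
have : (0 < N %/ C)%N by rewrite divn_gt0.
nia.
Qed.

(** At least d (N + 1) elements of A are at most N, and each weighs at least 1 / (N + 1), so tails
    of the harmonic sum over A stay bounded below. *)
Lemma lower_dense_harmonic A c : lower_dense R A ->
  ~ sum_le A (fun n => n.+1%:R^-1 : R) c.
Proof.
move=> /lower_denseP[d d0 [N0 h]] hs.
have d40 : 0 < d / 4 by lra.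
have f0 (i : nat) : 0 <= i.+1%:R^-1 :> R by [].
have [N1 h1] := sum_le_tailn f0 hs d40.
(* Discarding the elements below N1 costs less than (d / 4) (N + 1) of them; what remains still
   contributes more than the tail bound d / 4. *)
pose N := (N0 + Num.truncn (4 * N1%:R / d)).+1.
have N1N : 4 * N1%:R < d * N.+1%:R.
  rewrite [ltRHS]mulrC -ltr_pdivrMr//; apply: lt_le_trans (truncnS_gt _) _.
  by rewrite ler_nat ltnS; apply: leq_trans (leq_addl _ _) (leqnSn _).
have N0N : (N0 <= N)%N by apply: leq_trans (leq_addr _ _) (leqnSn _).
have hN := h _ N0N.
pose s := [seq nat_of_ord i | i <- enum [pred i : 'I_N.+1 | (nat_of_ord i \in A) && (N1 <= i)%N]].
have us : uniq s by rewrite map_inj_uniq ?enum_uniq//; exact: val_inj.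
have := h1 s us.
have sP i : i \in s -> A i /\ (N1 <= i < N.+1)%N.
  move=> /mapP[j]; rewrite mem_enum inE => /andP[/set_mem Aj N1j] ->.
  by rewrite N1j ltn_ord.
have sD i : i \in s -> [set n | A n /\ (N1 <= n)%N] i.
  by move=> /sP[Ai /andP[]].
move=> /(_ sD); apply/negP; rewrite -ltNge.
have : \sum_(i <- s) (N.+1%:R^-1 : R) <= \sum_(i <- s) i.+1%:R^-1.
  rewrite big_seq [leRHS]big_seq; apply: ler_sum => i /sP[_ /andP[_ iN]].
  by rewrite lef_pV2 ?posrE ?ltr0n// ler_nat.
apply: lt_le_trans; rewrite big_const_seq count_predT iter_addr_0.
rewrite size_map -cardE -[ltRHS]mulr_natl ltr_pdivlMr ?ltr0n//.
have : (count A N <= N1 + #|[pred i : 'I_N.+1 | (nat_of_ord i \in A) && (N1 <= i)%N]|)%N.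
  rewrite -(cardID [pred i : 'I_N.+1 | (i < N1)%N]) leq_add//.
    have [N1'|N1'] := leqP N1 N.+1; last first.
      by apply: leq_trans (max_card _) _; rewrite card_ord ltnW.
    rewrite -[X in (_ <= X)%N]card_ord.
    rewrite -(@card_imset _ _ (widen_ord N1')); last first.
      by move=> i j /(congr1 val) /= /val_inj.
    apply: subset_leq_card; apply/fintype.subsetP => i; rewrite !inE => /andP[_ iN1].
    by apply/imsetP; exists (Ordinal iN1) => //; exact: val_inj.
  apply: subset_leq_card; apply/fintype.subsetP => i; rewrite !inE.
  by rewrite -leqNgt => /andP[-> ->].
rewrite -(ler_nat R) natrD => h2.
have := le_trans hN h2; have := ler0n R N1; move: N1N.
set p : R := #|_|%:R; set X := d * _; have -> : d / 4 * N.+1%:R = X / 4 by rewrite /X; field.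
lra.
Qed.

End LowerDensity.

(** * Disjoint sets of positive lower density with prescribed gaps *)

Section SeparatedSets.

(** The ruler sequence 1, 2, 1, 3, 1, 2, 1, 4, ...: the value k has frequency 2^-k, and yet the
    partial sums grow linearly. *)
Definition ruler (j : nat) : nat := (logn 2 j.+1).+1.

(** Intervals of half-length [ruler j] are laid side by side from 0, and [sep_pos j] is the centre
    of the j-th one. Two centres are therefore at least the sum of their half-lengths apart. *)
Definition sep_pos (j : nat) : nat :=
  (2 * (\sum_(i < j) ruler i) + ruler j)%N.

Definition sep_set (k : nat) : set nat :=
  [set n | exists2 j, ruler j = k & sep_pos j = n].

Lemma sep_pos_gap i j : (i < j)%N ->
  (sep_pos i + ruler i + ruler j <= sep_pos j)%N.
Proof.
rewrite /sep_pos; elim: j => // j IH; rewrite ltnS leq_eqVlt => /predU1P[->|/IH].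
  by rewrite big_ord_recr/=; set s := \sum_(_ < _) _; lia.
rewrite big_ord_recr/=; set s := \sum_(_ < j) _; set t := \sum_(_ < i) _; lia.
Qed.

Lemma sep_pos_inj : injective sep_pos.
Proof.
move=> i j; case: (ltngtP i j) => // /sep_pos_gap; rewrite /ruler; lia.
Qed.

Lemma sum_ruler j : (\sum_(i < j) ruler i <= 2 * j)%N.
Proof.
have -> : (\sum_(i < j) ruler i = j + logn 2 j`!)%N.
  elim: j => [|j IH]; first by rewrite big_ord0.
  by rewrite big_ord_recr/= IH factS lognM ?fact_gt0// /ruler; lia.
rewrite mul2n -addnn leq_add2l logn_fact//.
(* Legendre's sum for the valuation of j! telescopes: twice [j %/ 2 ^ m.+1] is at most [j %/ 2 ^ m],
   so the last term may be counted twice. *)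
suff H m : (\sum_(1 <= k < m.+1) j %/ 2 ^ k + j %/ 2 ^ m <= j)%N.
  exact: leq_trans (leq_addr _ _) (H j).
elim: m => [|m IH]; first by rewrite big_nil expn0 divn1.
rewrite big_nat_recr//=; apply: leq_trans IH.
rewrite -addnA leq_add2l addnn -mul2n expnSr divnMA mulnC.
exact: leq_trunc_div.
Qed.

Lemma sep_pos_le j : (sep_pos j <= 5 * j.+1)%N.
Proof.
rewrite /sep_pos; have := sum_ruler j.
have : (ruler j <= j.+1)%N by rewrite /ruler; exact: ltn_logl.
lia.
Qed.

Lemma sep_set_gap k l i n : sep_set k i -> sep_set l n -> i != n ->
  (i + k + l <= n)%N || (n + k + l <= i)%N.
Proof.
move=> [a <- <-] [b <- <-].
by case: (ltngtP a b) => [/sep_pos_gap|/sep_pos_gap|->]; rewrite ?eqxx//; lia.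
Qed.

Lemma sep_set_disj k l n : sep_set k n -> sep_set l n -> k = l.
Proof. by move=> [a <- <-] [b <- /sep_pos_inj->]. Qed.

Lemma sep_set_lower_dense (R : realType) k : (1 <= k)%N ->
  lower_dense R (sep_set k).
Proof.
case: k => // k _.
(* With k lowered by one, the indices j of ruler value k + 1 are those for which j + 1 is 2^k times
   an odd number. *)
pose h m := (2 ^ k * m.*2.+1).-1.
have hS m : (h m).+1 = (2 ^ k * m.*2.+1)%N.
  by rewrite prednK// muln_gt0 expn_gt0.
apply: (@lower_dense_inj R _ (sep_pos \o h) (10 * 2 ^ k)).
- move=> i j /= /sep_pos_inj /(congr1 succn); rewrite !hS => /eqP.
  rewrite eqn_mul2l expn_eq0/= eqSS => /eqP; lia.
- move=> m /=; apply: leq_trans (sep_pos_le _) _; rewrite hS.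
  have : (0 < 2 ^ k)%N by rewrite expn_gt0.
  nia.
- move=> m; exists (h m) => //; rewrite /ruler hS lognM ?expn_gt0//.
  rewrite pfactorK// [logn 2 m.*2.+1]lognE/= dvdn2 /= odd_double addn0.
  by [].
Qed.

End SeparatedSets.

(** * Normed modules with real-valued norms *)

Section HalfPowers.
Context {R : realType}.

Lemma half_pow_gt0 n : 0 < 2 ^- n :> R.
Proof. by rewrite invr_gt0 exprn_gt0. Qed.

Lemma half_pow_le m n : (m <= n)%N -> 2 ^- n <= 2 ^- m :> R.
Proof.
by move=> mn; rewrite lef_pV2 ?posrE ?exprn_gt0// ler_eXn2l// ltr1n.
Qed.

Lemma exists_half_pow (e : R) : 0 < e -> exists n, 2 ^- n <= e.
Proof.
move=> e0; exists (Num.truncn e^-1); rewrite -[leRHS]invrK lef_pV2 ?posrE ?invr_gt0 ?exprn_gt0//.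
apply: ltW; apply: lt_le_trans (truncnS_gt _) _.
by rewrite -natrX ler_nat; exact: ltn_expl.
Qed.

End HalfPowers.
Arguments half_pow_gt0 R n : clear implicits.
Arguments half_pow_le R {m n}.

(** Composing with this valuation turns an enumeration into one that repeats every entry infinitely
    often, so each target can be met with arbitrarily high precision. *)
Lemma logn2_onto j N : exists2 m, (N <= m)%N & logn 2 m.+1 = j.
Proof.
have j0 : (0 < 2 ^ j)%N by rewrite expn_gt0.
exists (2 ^ j * N.*2.+1).-1.
  by rewrite -ltnS prednK ?muln_gt0 ?expn_gt0//; nia.
rewrite prednK ?muln_gt0 ?expn_gt0// lognM// pfactorK//.
by rewrite [logn 2 N.*2.+1]lognE/= dvdn2 /= odd_double addn0.
Qed.

Section RealNorm.
Context {R : realType} {F : scalars}.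
Local Notation K := (scalar_field R F).

Lemma ltr_of_real (a b : R) : (of_real F a < of_real F b) = (a < b).
Proof.
by rewrite !lt_neqAle ler_of_real (can_eq (@of_realK R F)).
Qed.

Context {X : normedModType K}.
Implicit Types (x y z : X) (u v : nat -> X).

Lemma rnormN x : rnorm (- x) = rnorm x.
Proof. by rewrite /rnorm normrN. Qed.

Lemma rnormB x y : rnorm (x - y) = rnorm (y - x).
Proof. by rewrite -rnormN opprB. Qed.

Lemma rnorm_triangle y x z : rnorm (x - z) <= rnorm (x - y) + rnorm (y - z).
Proof. by rewrite -{1}(subrK y x) -addrA ler_rnormD. Qed.

Lemma ler_rnormB x y : rnorm (x - y) <= rnorm x + rnorm y.
Proof. by rewrite -[rnorm y]rnormN ler_rnormD. Qed.

Lemma ler_rnorm_dist x y : rnorm x - rnorm y <= rnorm (x - y).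
Proof. by rewrite lerBlDr -{1}(subrK y x) ler_rnormD. Qed.

Lemma ler_rnorm_sum (I : Type) (s : seq I) (P : pred I) (f : I -> X) :
  rnorm (\sum_(i <- s | P i) f i) <= \sum_(i <- s | P i) rnorm (f i).
Proof.
elim/big_rec2: _ => [|i a b _ h]; first by rewrite rnorm0.
by apply: le_trans (ler_rnormD _ _) _; rewrite lerD2l.
Qed.

Lemma rnorm_gt0 x : x != 0 -> 0 < rnorm x.
Proof.
move=> x0; rewrite lt_neqAle rnorm_ge0 andbT eq_sym; apply: contra x0.
by move=> /eqP/rnorm_eq0->.
Qed.

Lemma nbhs_rnormP x (U : set X) : nbhs x U <->
  exists2 e : R, 0 < e & forall y, rnorm (x - y) < e -> U y.
Proof.
split=> [/nbhs_normP[e /= e0 h]|[e e0 h]].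
  exists (rpart e) => [|y xy]; first by rewrite -(ltr_of_real) of_real0 rpartK// ltW.
  by apply: h => /=; rewrite -rnormK -(rpartK (ltW e0)) ltr_of_real.
apply/nbhs_normP; exists (of_real F e) => /=; first by rewrite -of_real0 ltr_of_real.
by move=> y /=; rewrite -rnormK ltr_of_real; exact: h.
Qed.

Lemma open_rnorm_ball x (e : R) : open [set y | rnorm (x - y) < e].
Proof.
rewrite openE => y /= xy; rewrite /interior; apply/nbhs_rnormP.
exists (e - rnorm (x - y)); first by rewrite subr_gt0.
by move=> z /= yz; apply: le_lt_trans (rnorm_triangle y _ _) _; rewrite -ltrBrDl.
Qed.

Lemma denseP (D : set X) : dense D <->
  forall x (e : R), 0 < e -> exists2 y, D y & rnorm (x - y) < e.
Proof.
split=> [h x e e0|h U [x Ux] oU].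
  have [|y [xy Dy]] := h _ _ (open_rnorm_ball x e); last by exists y.
  by exists x => /=; rewrite subrr rnorm0.
have /nbhs_rnormP[e e0 eU] := open_nbhs_nbhs (conj oU Ux).
by have [y Dy /eU Uy] := h x e e0; exists y.
Qed.

Lemma frequently_hypercyclicP (S : X -> X) : frequently_hypercyclic R S <->
  exists u : X, forall x (e : R), 0 < e ->
    lower_dense R [set n | rnorm (x - iter n S u) < e].
Proof.
split=> -[u hu]; exists u.
  move=> x e e0; apply: (hu [set y | rnorm (x - y) < e]).
    exact: open_rnorm_ball.
  by exists x => /=; rewrite subrr rnorm0.
move=> U oU [x Ux].
have /nbhs_rnormP[e e0 eU] := open_nbhs_nbhs (conj oU Ux).
by apply: lower_dense_sub (hu x e e0) => n /=; exact: eU.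
Qed.

Definition rlim u x :=
  forall e : R, 0 < e -> exists N, forall n, (N <= n)%N -> rnorm (x - u n) <= e.

Lemma rlim_le u x y (c : R) : rlim u x ->
  (exists N, forall n, (N <= n)%N -> rnorm (u n - y) <= c) ->
  rnorm (x - y) <= c.
Proof.
move=> ux [N h]; apply/ler_addgt0Pr => e /ux[M hM].
apply: le_trans (rnorm_triangle (u (maxn M N)) _ _) _.
by rewrite addrC lerD ?h ?hM ?leq_maxl ?leq_maxr.
Qed.

Lemma rlim_unique u x y : rlim u x -> rlim u y -> x = y.
Proof.
move=> ux uy; apply/eqP; rewrite -subr_eq0; apply/eqP/rnorm_eq0/eqP.
rewrite eq_le rnorm_ge0 andbT; apply/ler_addgt0Pr => e e0; rewrite add0r.
apply: rlim_le ux _; have [N hN] := uy e e0.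
by exists N => n /hN; rewrite rnormB.
Qed.

Lemma rlimD u v x y : rlim u x -> rlim v y -> rlim (fun n => u n + v n) (x + y).
Proof.
move=> ux vy e e0; have e20 : 0 < e / 2 by lra.
have [N hN] := ux _ e20; have [M hM] := vy _ e20.
exists (maxn N M) => n; rewrite geq_max => /andP[/hN h1 /hM h2].
rewrite opprD addrACA; apply: le_trans (ler_rnormD _ _) _; lra.
Qed.

(** From N = n + 1 on, a partial sum differs from its term [g n] by finitely many other terms. This
    is how a sum is compared with the one term that matters at time n. *)
Lemma rlim_isolate (g : nat -> X) x n (c : R) :
  rlim (fun N => \sum_(0 <= i < N) g i) x ->
  sum_le [set i | i <> n] (fun i => rnorm (g i)) c -> rnorm (x - g n) <= c.
Proof.
move=> gx h; apply: rlim_le gx _; exists n.+1 => N nN.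
rewrite (bigD1_seq n) ?mem_index_iota ?iota_uniq//= addrAC subrr add0r.
apply: le_trans (ler_rnorm_sum _ _ _) _; rewrite -big_filter.
apply: h; first by rewrite filter_uniq// iota_uniq.
by move=> i; rewrite mem_filter => /andP[/eqP].
Qed.

Lemma rlim_sum_le (g : nat -> X) x (c : R) :
  rlim (fun N => \sum_(0 <= i < N) g i) x ->
  sum_le setT (fun i => rnorm (g i)) c -> rnorm x <= c.
Proof.
move=> gx h; rewrite -[x]subr0; apply: rlim_le gx _; exists 0%N => N _.
by rewrite subr0; apply: le_trans (ler_rnorm_sum _ _ _) _; exact: sum_le_iota.
Qed.

Lemma bounded_near0_rnorm (f : {linear X -> X}) (c : R) :
  (forall x, rnorm (f x) <= c * rnorm x) -> bounded_near f (nbhs (0 : X)).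
Proof.
move=> h; have c0 : 0 <= `|c| by [].
apply/linear_boundedP; near=> M => x.
apply: (@le_trans _ _ (of_real F `|c| * `|x|)).
  rewrite -!rnormK -of_realM ler_of_real; apply: le_trans (h x) _.
  by rewrite ler_wpM2r ?rnorm_ge0// ler_norm.
rewrite ler_wpM2r//; near: M; apply: nbhs_pinfty_ge.
by rewrite ger0_real// -of_real0 ler_of_real.
Unshelve. all: by end_near. Qed.

End RealNorm.

Section Complete.
Context {R : realType} {F : scalars}.
Local Notation K := (scalar_field R F).

Definition rcauchy (X : normedModType K) (u : nat -> X) :=
  forall e : R, 0 < e ->
    exists N, forall n, (N <= n)%N -> rnorm (u N - u n) <= e.

Lemma rcauchy_rlim (X : completeNormedModType K) (u : nat -> X) :
  rcauchy u -> exists x, rlim u x.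
Proof.
move=> cu.
have /cauchy_cvg/cvg_ex[x ux] : cauchy (u @ \oo).
  apply/cauchyP => e e0.
  have e20 : 0 < rpart e / 2.
    by rewrite divr_gt0// -(@ltr_of_real R F) of_real0 rpartK// ltW.
  have [N hN] := cu _ e20; exists (u N); exists N => // n /= /hN h.
  rewrite -ball_normE /ball_/= -rnormK -[ltRHS]rpartK ?(ltW e0)//.
  by rewrite ltr_of_real (le_lt_trans h)// ltr_pdivrMr// ltr_pMr ?ltr1n//
     -(@ltr_of_real R F) of_real0 rpartK// ltW.
exists x => e e0.
have /ux[N _ h] : nbhs x [set y | rnorm (x - y) < e].
  by apply/nbhs_rnormP; exists e.
by exists N => n /h /ltW.
Qed.

(** A Cauchy filter contains balls of radius 2^-n for every n; their centres form a Cauchy sequence,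
    and its limit is the limit of the filter. *)
Lemma rlim_complete (X : normedModType K) :
  (forall u : nat -> X, rcauchy u -> exists x, rlim u x) ->
  forall G : set_system X, ProperFilter G -> cauchy G -> cvg G.
Proof.
move=> h G PG /cauchyP cG.
have ch n : exists x : X, G [set y | rnorm (x - y) < 2 ^- n].
  have e0 : 0 < of_real F (2 ^- n : R).
    by rewrite -of_real0 ltr_of_real invr_gt0 exprn_gt0.
  have [x b] := cG _ e0; exists x; apply: filterS b => y /=.
  by rewrite -ball_normE /ball_/= -rnormK ltr_of_real.
have [u uG] := choice ch.
have uu m n : rnorm (u m - u n) <= 2 ^- m + 2 ^- n.
  have [y [/= /ltW h1 /ltW h2]] := filter_ex (filterI (uG m) (uG n)).
  apply: le_trans (rnorm_triangle y _ _) _.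
  by rewrite lerD// rnormB.
have [x ux] : exists x, rlim u x.
  apply: h => e e0; have e20 : 0 < e / 2 by lra.
  have [N hN] := exists_half_pow e20; exists N => n Nn.
  apply: le_trans (uu _ _) _; have := half_pow_le R Nn; lra.
apply/cvg_ex; exists x => U /nbhs_rnormP[e e0 eU].
have e30 : 0 < e / 3 by lra.
have [M hM] := exists_half_pow e30; have [N hN] := ux _ e30.
apply: filterS (uG (maxn M N)) => y /= hy; apply: eU.
apply: le_lt_trans (rnorm_triangle (u (maxn M N)) _ _) _.
have := hN _ (leq_maxr M N); have := half_pow_le R (leq_maxl M N); lra.
Qed.

End Complete.

Section Operator.
Context {R : realType} {F : scalars} {X : normedModType (scalar_field R F)}.
Variable T : 'L(X).

Lemma operator_rnorm_ge1 : exists2 c : R, 1 <= c &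
  forall x, rnorm (T x) <= c * rnorm x.
Proof.
have [c _ h] := operator_rnorm T; exists (Num.max 1 c).
  by rewrite le_max lexx.
move=> x; apply: le_trans (h x) _; rewrite ler_wpM2r ?rnorm_ge0//.
by rewrite le_max lexx orbT.
Qed.

Lemma iter_rnorm (c : R) : 0 <= c -> (forall x, rnorm (T x) <= c * rnorm x) ->
  forall n x, rnorm (iter n T x) <= c ^+ n * rnorm x.
Proof.
move=> c0 h; elim=> [|n IH] x /=; first by rewrite expr0 mul1r.
by apply: le_trans (h _) _; rewrite exprS -mulrA ler_wpM2l.
Qed.

Lemma iter_rnorm_ex n : exists2 c : R, 0 <= c &
  forall x, rnorm (iter n T x) <= c * rnorm x.
Proof.
have [c c0 h] := operator_rnorm T; exists (c ^+ n); first exact: exprn_ge0.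
exact: iter_rnorm.
Qed.

Lemma iter_operator_linear n a x y : iter n T (a *: x + y) = a *: iter n T x + iter n T y.
Proof. by elim: n => //= n ->; rewrite linearP. Qed.

Lemma iter_operatorD n x y : iter n T (x + y) = iter n T x + iter n T y.
Proof. by rewrite -[x in LHS]scale1r iter_operator_linear scale1r. Qed.

Lemma iter_operator0 n : iter n T 0 = 0.
Proof. by elim: n => //= n ->; rewrite linear0. Qed.

Lemma iter_operatorZ n a x : iter n T (a *: x) = a *: iter n T x.
Proof. by rewrite -[a *: x]addr0 iter_operator_linear iter_operator0 addr0. Qed.

Lemma iter_operatorB n x y : iter n T (x - y) = iter n T x - iter n T y.
Proof. by rewrite addrC -scaleN1r iter_operator_linear scaleN1r addrC. Qed.

Lemma iter_operator_sum n (I : Type) (s : seq I) (P : pred I) (f : I -> X) :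
  iter n T (\sum_(i <- s | P i) f i) = \sum_(i <- s | P i) iter n T (f i).
Proof. by elim/big_rec2: _ => [|i a b _ <-]; rewrite ?iter_operator0 ?iter_operatorD. Qed.

Lemma rlim_iter n (u : nat -> X) x :
  rlim u x -> rlim (fun i => iter n T (u i)) (iter n T x).
Proof.
have [c c0 h] := iter_rnorm_ex n.
move=> ux e e0; have c1 : 0 < c + 1 by lra.
have [N hN] := ux _ (divr_gt0 e0 c1); exists N => m /hN hm.
rewrite -iter_operatorB; apply: le_trans (h _) _.
apply: (@le_trans _ _ ((c + 1) * rnorm (x - u m))).
  by rewrite ler_wpM2r ?rnorm_ge0//; lra.
by rewrite mulrC -ler_pdivlMr.
Qed.

End Operator.

Section Separable.
Context {R : realType} {F : scalars} {X : normedModType (scalar_field R F)}.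

(** A countable dense set need not lie in D, so each of its points is replaced by approximants from
    D at distance 2^-n, indexed by coded pairs. *)
Lemma separable_dense_seq (D : set X) : separable X -> dense D ->
  exists y : nat -> X, (forall j, D (y j)) /\ forall x (e : R), 0 < e -> exists j, rnorm (x - y j) < e.
Proof.
move=> [E cE /denseP dE] /denseP dD.
have [d0 Dd0 _] := dD 0 1 ltr01.
have [z zE] : exists z : nat -> X, E `<=` range z.
  have /pfcard_geP[E0|[g]] := cE.
    by exists (fun=> 0); rewrite E0.
  by exists g => x /(@surj _ _ _ _ g)[n _ <-]; exists n.
have ch (p : nat * nat) : exists y, D y /\ rnorm (z p.1 - y) < 2 ^- p.2.
  have [y Dy h] := dD (z p.1) (2 ^- p.2) (half_pow_gt0 R _).
  by exists y.
have [y yP] := choice ch.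
pose dec j : nat * nat := odflt (0%N, 0%N) (choice.unpickle j).
exists (fun j => y (dec j)); split=> [j|x e e0].
  by case: (yP (dec j)).
have e20 : 0 < e / 2 by lra.
have [_ /zE[m _ <-] hm] := dE x _ e20.
have [n hn] := exists_half_pow e20.
exists (choice.pickle (m, n)); rewrite /dec choice.pickleK /=.
apply: le_lt_trans (rnorm_triangle (z m) _ _) _.
have [_ /=] := yP (m, n); lra.
Qed.

Lemma separable_seq (y : nat -> X) :
  (forall x (e : R), 0 < e -> exists j, rnorm (x - y j) < e) -> separable X.
Proof.
move=> h; exists (range y); first exact: card_image_le.
by apply/denseP => x e /(h x)[j]; exists (y j).
Qed.

Lemma frequently_hypercyclic_hypercyclic (S : X -> X) :
  frequently_hypercyclic R S -> hypercyclic S.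
Proof.
move=> [u hu]; exists u => U U0 oU; have := hu U oU U0.
move=> /lower_denseP[d d0 [N /(_ N (leqnn N))]].
apply: contraPP => /nonemptyPn uU; apply/negP; rewrite -ltNge.
rewrite eq_card0 ?mulr_gt0// => i; rewrite !inE; apply/asboolPn => Ui.
by have : (U `&` [set iter n S u | n in setT]) (iter i S u) by [split=> //; exists i]; rewrite uU.
Qed.

End Separable.

(** * The two criteria *)

Section CriteriaReformulated.
Context {R : realType} {F : scalars}.

Lemma nneseries_sum_le (f : nat -> R) : (forall n, 0 <= f n) ->
  ((\sum_(1 <= n <oo) (f n)%:E < +oo)%E <-> exists c, sum_le setT f c).
Proof.
move=> f0; have f0E n : (0 <= (f n)%:E)%E by rewrite lee_fin.
split=> [fin|[c fc]].
  pose t := fine (\sum_(1 <= n <oo) (f n)%:E)%E.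
  have hn n : \sum_(1 <= i < n) f i <= t.
    rewrite -lee_fin -sumEFin fineK; first exact: nneseries_lim_ge.
    by rewrite ge0_fin_numE//; apply: nneseries_ge0.
  (* The series starts at 1, whereas [sum_le setT] also counts the term of index 0. *)
  exists (f 0%N + t); apply: sum_le_series => // -[|n].
    by rewrite big_nil addr_ge0// fine_ge0//; apply: nneseries_ge0.
  by rewrite big_ltn// lerD2l.
apply: le_lt_trans (ltry c); apply: lime_le.
  exact: is_cvg_nneseries.
by apply: nearW => n; rewrite sumEFin lee_fin sum_le_iota.
Qed.

Lemma uniform_sumP (D : set nat) (A : nat -> set nat) (f : nat -> R) :
  (forall n, 0 <= f n) ->
  (exists s : nat -> R, {uniform D,
     (fun N k : nat => \sum_(0 <= n < N | n \in A k) f n) @ \oo --> s}) <->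
  (forall e : R, 0 < e -> exists N, forall k, D k ->
     sum_le [set n | A k n /\ (N <= n)%N] f e).
Proof.
move=> f0; pose p k N := \sum_(0 <= n < N | n \in A k) f n.
have pS k N M : (N <= M)%N -> p k M = p k N + \sum_(N <= n < M | n \in A k) f n.
  by move=> NM; rewrite /p (big_cat_nat (leq0n N) NM).
split=> [[s hs] e e0|h].
  have e20 : 0 < e / 2 by lra.
  have : nbhs (s : {uniform` D -> R}) [set h | forall k, D k -> `|s k - h k| < e / 2].
    apply/uniform_nbhs; exists [set xy | ball xy.1 (e / 2) xy.2]; split=> //.
    exact: (entourage_ball _ (PosNum e20)).
  move=> /hs[N _ hN]; exists N => k Dk t ut tP.
  have [M tM] : exists M, forall i, i \in t -> (i < M)%N.
    by exists (\max_(i <- t) i).+1 => i ti; rewrite ltnS leq_bigmax_seq.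
  have NM : (N <= maxn N M)%N by rewrite leq_maxl.
  have := hN _ (leqnn N) k Dk; have := hN _ NM k Dk.
  rewrite -![\sum_(_ <= _ < _ | _) _]/(p _ _) (pS _ _ _ NM).
  set q := \sum_(_ <= _ < _ | _) _ => h1 h2.
  have : \sum_(i <- t) f i <= q.
    rewrite /q -[leRHS]big_filter.
    have -> : \sum_(i <- t) f i = \sum_(i <- [seq n <- index_iota N (maxn N M) | n \in A k] | i \in t) f i.
      rewrite -[RHS]big_filter; apply: perm_big; apply: uniq_perm => //.
        by rewrite !filter_uniq// iota_uniq.
      move=> i; rewrite !mem_filter mem_index_iota; apply/esym/andb_idr => ti.
      have [Ai Ni] := tP i ti.
      by rewrite (mem_set Ai) Ni leq_max tM ?orbT.
    by rewrite [leRHS](bigID (mem t))/= lerDl sumr_ge0.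
  move=> tq; move: h1 h2; rewrite !ltr_norml => /andP[h1 _] /andP[_ h2]; lra.
have hp e : 0 < e -> exists N, forall k M, D k -> (N <= M)%N ->
    p k N <= p k M <= p k N + e.
  move=> /h[N hN]; exists N => k M Dk NM; rewrite (pS _ _ _ NM) lerDl lerD2l.
  rewrite sumr_ge0//= -big_filter; apply: (hN k Dk).
    by rewrite filter_uniq// iota_uniq.
  by move=> i; rewrite mem_filter mem_index_iota => /andP[/set_mem ? /andP[]].
have pmono k N M : (N <= M)%N -> p k N <= p k M.
  by move=> NM; rewrite (pS _ _ _ NM) lerDl sumr_ge0.
(* With nonnegative terms the only possible limit is the supremum of the partial sums, so uniformly
   small tails already give uniform convergence. *)
exists (fun k => sup (range (p k))) => P /uniform_nbhs[E [+ EP]].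
rewrite -entourage_from_ballE => -[e /= e0 eE].
have e20 : 0 < e / 2 by lra.
have [N hN] := hp _ e20; exists N => // n /= Nn; apply: EP => k Dk; apply: eE => /=.
rewrite -[\sum_(_ <= _ < _ | _) _]/(p _ _) /ball/= ltr_norml.
have ubp : ubound (range (p k)) (p k N + e / 2).
  move=> _ [M _ <-]; have /andP[_ + ] := hN k (maxn N M) Dk (leq_maxl _ _).
  by apply: le_trans; rewrite pmono// leq_maxr.
have h1 : p k n <= sup (range (p k)).
  by apply: ub_le_sup; [exists (p k N + e / 2)|exists n].
have h2 : sup (range (p k)) <= p k N + e / 2.
  by apply: ge_sup => //; exists (p k 0%N); exists 0%N.
have h3 := pmono k _ _ Nn; apply/andP; split; lra.
Qed.

Lemma cvg_sup_rnormP (A : nat -> set nat) (f : nat -> R) :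
  (forall n, 0 <= f n) -> (forall k, (1 <= k)%N -> A k !=set0) ->
  ((fun k => ereal_sup [set (f n)%:E | n in A k]) @ \oo --> 0%E <->
   forall e : R, 0 < e -> exists k0, forall k n, (k0 <= k)%N -> A k n -> f n <= e).
Proof.
move=> f0 A0; split=> [h e e0|h].
  have /h[N _ hN] : nbhs (0%E : \bar R) [set x | (x < e%:E)%E].
    by apply: open_nbhs_nbhs; split; [exact: open_ereal_lt_ereal|rewrite /= lte_fin].
  exists N => k n /hN /= hk An; rewrite -lee_fin ltW//; apply: le_lt_trans hk.
  by apply: ereal_sup_ubound; exists n.
have hle e : 0 < e -> exists k0, forall k, (k0 <= k)%N ->
    (0 <= ereal_sup [set (f n)%:E | n in A k] <= e%:E)%E.
  (* The successor guarantees k >= 1, where [A k] is nonempty; over an empty set the supremum would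
     be minus infinity. *)
  move=> /h[k0 hk]; exists k0.+1 => k k0k.
  have [n An] := A0 k (leq_trans (ltn0Sn _) k0k).
  apply/andP; split.
    apply: (@le_trans _ _ (f n)%:E); first by rewrite lee_fin.
    by apply: ereal_sup_ubound; exists n.
  by apply: ge_ereal_sup => _ [m Am <-]; rewrite lee_fin (hk k)// ltnW.
apply/fine_cvgP; split.
  have [k0 hk] := hle 1 ltr01; exists k0 => // k /= /hk/andP[h0 h1].
  by rewrite ge0_fin_numE// (le_lt_trans h1)// ltry.
apply/cvgr0Pnorm_le => e /hle[k0 hk]; exists k0 => // k /= /hk/andP[h0 h1].
rewrite ger0_norm ?fine_ge0// -lee_fin fineK//.
by rewrite ge0_fin_numE// (le_lt_trans h1)// ltry.
Qed.

Context {X : normedModType (scalar_field R F)}.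
Variable T : X -> X.

Definition absolutely_summable (g : nat -> X) :=
  exists c, sum_le setT (fun n => rnorm (g n)) c.

Lemma frequent_criterionP : frequent_hypercyclicity_criterion T <->
  exists (X0 : set X) (S : X -> X), [/\ dense X0, set_fun X0 X0 S &
    forall x, X0 x -> [/\ absolutely_summable (fun n => iter n T x),
      absolutely_summable (fun n => iter n S x) & T (S x) = x]].
Proof.
by split=> -[X0 [S [dX0 SX0 h]]]; exists X0, S; split=> // x /h[h1 h2 h3];
  split=> //; apply/nneseries_sum_le => // n; exact: rnorm_ge0.
Qed.

Lemma lower_dense_nonempty (A : set nat) : lower_dense R A -> A !=set0.
Proof.
move=> /lower_denseP[d d0 [N /(_ N (leqnn N))]].
apply: contraPP => /nonemptyPn ->; apply/negP; rewrite -ltNge.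
by rewrite eq_card0 ?mulr_gt0// => i; rewrite !inE; apply/asboolPn => -[].
Qed.

Record criterion_data (Y0 : set X) (S : nat -> X -> X) (A : nat -> set nat) : Prop := {
  crit_dense : dense Y0;
  crit_lower_dense : forall k, (1 <= k)%N -> lower_dense R (A k);
  crit_disjoint : forall k l n, (1 <= k)%N -> (1 <= l)%N -> A k n -> A l n -> k = l;
  crit_tail : forall y, Y0 y -> forall e : R, 0 < e -> exists N, forall k, (1 <= k)%N ->
    sum_le [set n | A k n /\ (N <= n)%N] (fun n => rnorm (S n y)) e;
  crit_cross : forall y, Y0 y -> forall k0 (e : R), (1 <= k0)%N -> 0 < e ->
    exists2 k, (k0 <= k)%N &
      (forall l n, (1 <= l)%N -> A l n ->
        sum_le [set i | A k i /\ i <> n] (fun i => rnorm (iter n T (S i y))) e) /\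
      (forall d : R, 0 < d -> exists2 l0, (1 <= l0)%N &
        forall l n, (l0 <= l)%N -> A l n ->
        sum_le [set i | A k i /\ i <> n] (fun i => rnorm (iter n T (S i y))) d);
  crit_diag : forall y, Y0 y -> forall e : R, 0 < e -> exists k0, forall k n,
    (k0 <= k)%N -> A k n -> rnorm (iter n T (S n y) - y) <= e }.

Lemma lower_dense_criterionP : lower_dense_hypercyclicity_criterion T <->
  exists Y0 S A, criterion_data Y0 S A.
Proof.
split=> -[Y0 [S [A]]].
  move=> [dY0 dA tA h]; exists Y0, S, A; split=> //.
  - by move=> k l n k1 l1 Ak Al; apply: tA => //; exists n.
  - move=> y /h[/uniform_sumP + _ _]; apply=> // n; exact: rnorm_ge0.
  - move=> y /h[_ + _] k0 e k01 e0 => /(_ k0 e k01 e0)[k k0k [h1 h2]].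
    exists k => //; split=> [l n l1 Aln|d /h2[l0 l01 h3]].
      by apply/sum_leP; apply: h1; exists l.
    by exists l0 => // l n ll Aln; apply/sum_leP; apply: h3; exists l.
  - move=> y /h[_ _ /cvg_sup_rnormP]; apply=> [n|k /dA]; first exact: rnorm_ge0.
    exact: lower_dense_nonempty.
move=> [dY0 dA tA hi hii hiii]; exists Y0, S, A; split=> //.
  by move=> k l k1 l1 [n [Ak Al]]; exact: tA Ak Al.
move=> y Yy; split.
- by apply/uniform_sumP => [n|]; [exact: rnorm_ge0|exact: hi].
- move=> k0 e k01 e0; have [k k0k [h1 h2]] := hii y Yy k0 e k01 e0.
  exists k => //; split=> [n [l l1 Aln]|d /h2[l0 l01 h3]].
    by apply/sum_leP; exact: (h1 l).
  by exists l0 => // n [l ll Aln]; apply/sum_leP; exact: (h3 l).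
- apply/(@cvg_sup_rnormP A (fun n => rnorm (iter n T (S n y) - y))).
  + by move=> n; exact: rnorm_ge0.
  + by move=> k /dA; exact: lower_dense_nonempty.
  + exact: hiii.
Qed.

End CriteriaReformulated.

(** * From summable preimages to the criterion *)

Section BackwardSummable.
Context {R : realType} {F : scalars} {X : normedModType (scalar_field R F)}.
Variable T : 'L(X).

(* The preimages [s n] of [y] of different orders need not form one backward
   orbit; only the bound on their images has to be uniform. *)
Definition backward_summable (y : X) :=
  absolutely_summable (fun n => iter n T y) /\
  exists (s : nat -> X) (b : nat -> R), [/\ exists c, sum_le setT b c,
    forall n, 0 <= b n, forall n, iter n T (s n) = y &
    forall n i, (n <= i)%N -> rnorm (iter n T (s i)) <= b (i - n)%N].

(** Preimages of [T^q w] of order n >= q are those of w of order n - q, and for n < q forward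
    iterates of w serve. When i - n < q the vector to bound is a forward iterate of w, of norm at
    most c; this explains the q constant entries at the start of the new bound. *)
Lemma backward_summable_preimage q w :
  backward_summable w -> backward_summable (iter q T w).
Proof.
move=> [[c hc] [s [b [[cb hb] b0 sw sb]]]].
have g0 (n : nat) : 0 <= rnorm (iter n T w) by exact: rnorm_ge0.
split.
  exists c; have := @sum_le_inj R nat nat (fun n => n + q)%N setT setT (fun n => rnorm (iter n T w)) c.
  move=> H; apply: (sum_le_le _ (H _ _ hc)) => //.
    by move=> n _; rewrite iterD.
  by move=> i j _ _ /addIn.
exists (fun n => if (n < q)%N then iter (q - n) T w else s (n - q)%N).
exists (fun d => if (d < q)%N then c else b (d - q)%N); split.
- exists (q%:R * c + cb).
  have c0 := sum_le_ge0 hc.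
  apply: (@sum_le_sub _ _ ([set d | (d < q)%N] `|` [set d | (q <= d)%N])).
    by move=> d _ /=; case: (ltnP d q); [left|right].
  apply: sum_leU => [d||].
  + by case: ifP.
  + move=> t ut tq; rewrite (eq_big_seq (fun=> c)); last by move=> d /tq /= ->.
    rewrite big_const_seq count_predT iter_addr_0 -[leLHS]mulr_natl ler_wpM2r// ler_nat.
    rewrite -(size_iota 0 q); apply: uniq_leq_size => // d /tq /=.
    by rewrite mem_iota.
  + have := @sum_le_inj R nat nat (fun d => d - q)%N [set d | (q <= d)%N] setT b cb.
    move=> H; apply: (sum_le_le _ (H _ _ hb)) => //.
      by move=> d /=; rewrite leqNgt => /negbTE->.
    by move=> i j /= qi qj /(congr1 (fun k => k + q)%N); rewrite !subnK.
- by move=> d; case: ifP => // _; exact: sum_le_ge0 hc.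
- move=> n; case: ltnP => nq; first by rewrite -iterD subnKC// ltnW.
  by rewrite -{1}(subnKC nq) iterD sw.
- move=> n i ni; case: (ltnP i q) => iq.
    have -> : (i - n < q)%N by lia.
    by rewrite /= -iterD; exact: (@sum_le1 _ _ setT _ _ (n + (q - i))%N I hc).
  case: ltnP => diq; last first.
    have -> : (i - n - q = i - q - n)%N by lia.
    by apply: sb; lia.
  have e : (n - (i - q) + (i - q) = n)%N by lia.
  rewrite -{1}e iterD sw.
  exact: (@sum_le1 _ _ setT _ _ (n - (i - q))%N I hc).
Qed.

Lemma backward_summable_linear a y z :
  backward_summable y -> backward_summable z -> backward_summable (a *: y + z).
Proof.
move=> [[c1 h1] [s1 [b1 [[d1 k1] b10 e1 f1]]]] [[c2 h2] [s2 [b2 [[d2 k2] b20 e2 f2]]]].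
have a0 : 0 <= rpart `|a| by apply: rpart_ge0.
have le_lin n u v : rnorm (iter n T (a *: u + v)) <=
    rpart `|a| * rnorm (iter n T u) + rnorm (iter n T v).
  by rewrite iter_operator_linear; apply: le_trans (ler_rnormD _ _) _; rewrite rnormZ.
split.
  exists (rpart `|a| * c1 + c2).
  by apply: (sum_le_le _ (sum_leD (sum_leZ a0 h1) h2)) => n _; exact: le_lin.
exists (fun n => a *: s1 n + s2 n), (fun n => rpart `|a| * b1 n + b2 n); split.
- by exists (rpart `|a| * d1 + d2); exact: sum_leD (sum_leZ a0 k1) k2.
- by move=> n; rewrite addr_ge0// mulr_ge0.
- by move=> n; rewrite iter_operator_linear e1 e2.
- move=> n i ni; apply: le_trans (le_lin _ _ _) _.
  by rewrite lerD// ?f2// ler_wpM2l// f1.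
Qed.

Lemma backward_summable0 : backward_summable 0.
Proof.
split; first by exists 0; apply: (sum_le_le _ (@sum_le0 R nat _)) => n _; rewrite iter_operator0 rnorm0.
exists (fun=> 0), (fun=> 0); split=> //.
- by exists 0; exact: sum_le0.
- by move=> n; rewrite iter_operator0.
- by move=> n i _; rewrite iter_operator0 rnorm0.
Qed.

(** On [sep_set] two distinct times i in the k-th set and n in the l-th differ by at least k + l. If
    i > n the term is controlled by the tail of b, and if i < n it is the forward iterate
    [T^(n - i) y]. Both are small as soon as k or l is large, which yields both halves of (ii); the
    diagonal error is zero. *)
Lemma backward_summable_criterion :
  dense backward_summable -> lower_dense_hypercyclicity_criterion T.
Proof.
move=> dG.
have ch y : exists sb : (nat -> X) * (nat -> R), backward_summable y ->
    [/\ exists c, sum_le setT sb.2 c,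
    forall n, 0 <= sb.2 n, forall n, iter n T (sb.1 n) = y &
    forall n i, (n <= i)%N -> rnorm (iter n T (sb.1 i)) <= sb.2 (i - n)%N].
  case: (pselect (backward_summable y)) => [[_ [s [b h]]]|ny]; first by exists (s, b).
  by exists (fun=> 0, fun=> 0).
have [f fP] := choice ch.
apply/lower_dense_criterionP; exists backward_summable, (fun n y => (f y).1 n), sep_set.
have cross y : backward_summable y -> forall e : R, 0 < e -> exists M, forall k l n,
    (M <= k + l)%N -> sep_set l n ->
    sum_le [set i | sep_set k i /\ i <> n] (fun i => rnorm (iter n T ((f y).1 i))) e.
  move=> gy e e0; have [[cb hb] b0 sy sb] := fP y gy; have [[c hc] _] := gy.
  have e20 : 0 < e / 2 by lra.
  have [M1 h1] := sum_le_tailn b0 hb e20.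
  have [M2 h2] := sum_le_tailn (fun n => rnorm_ge0 (iter n T y)) hc e20.
  exists (maxn M1 M2) => k l n; rewrite geq_max => /andP[M1k M2k] ln.
  rewrite (splitr e).
  apply: (@sum_le_sub _ _ ([set i | (n + M1 <= i)%N] `|` [set i | (i + M2 <= n)%N])).
    move=> i [ki /eqP in_]; have := sep_set_gap ki ln in_.
    by move=> /orP[h|h]; [right|left] => /=; lia.
  apply: sum_leU => [i||]; first exact: rnorm_ge0.
    have := @sum_le_inj R nat nat (fun i => i - n)%N [set i | (n + M1 <= i)%N] _ _ _ _ _ h1.
    move=> H; apply: (sum_le_le _ (H _ _)) => //=.
    + by move=> i ni; apply: sb; lia.
    + by move=> i j; lia.
    + by move=> i ni; split=> //; lia.
  have := @sum_le_inj R nat nat (fun i => n - i)%N [set i | (i + M2 <= n)%N] _ _ _ _ _ h2.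
  move=> H; apply: (sum_le_le _ (H _ _)) => //=.
  + move=> i ni; rewrite -{1}(@subnK i n); last lia.
    by rewrite iterD sy.
  + by move=> i j; lia.
  + by move=> i ni; split=> //; lia.
split=> //.
- by move=> k k1; exact: sep_set_lower_dense.
- by move=> k l n _ _; exact: sep_set_disj.
- move=> y gy e e0; have [[cb hb] b0 sy sb] := fP y gy.
  have [N hN] := sum_le_tailn b0 hb e0; exists N => k k1.
  apply: (@sum_le_sub _ _ [set n | setT n /\ (N <= n)%N]); first by move=> n [].
  by apply: (sum_le_le _ hN) => n _; have := sb 0%N n (leq0n n); rewrite subn0.
- move=> y gy k0 e k01 e0; have [M hM] := cross y gy e e0.
  exists (maxn k0 M); first exact: leq_maxl.
  split=> [l n _ Al|d d0]; first by apply: (hM _ l) => //; lia.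
  have [M' hM'] := cross y gy d d0; exists M'.+1 => // l n ll Al.
  by apply: (hM' _ l) => //; lia.
- move=> y gy e e0; exists 0%N => k n _ _; have [_ _ sy _] := fP y gy.
  by rewrite sy subrr rnorm0 ltW.
Qed.

Lemma frequent_criterion_lower_dense :
  frequent_hypercyclicity_criterion T -> lower_dense_hypercyclicity_criterion T.
Proof.
move=> /frequent_criterionP[X0 [S [dX0 SX0 h]]].
apply: backward_summable_criterion; apply/denseP => x e e0.
have [y X0y xy] := (denseP X0).1 dX0 x e e0; exists y => //.
have [h1 [c h2] h3] := h y X0y; split=> //.
have SX n : X0 (iter n S y) by elim: n => //= n IH; exact: SX0.
have TS n i : iter n T (iter (n + i) S y) = iter i S y.
  elim: n => // n IH; rewrite iterSr /= [T _](_ : _ = iter (n + i) S y)//.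
  by have [_ _] := h _ (SX (n + i)%N).
exists (fun n => iter n S y), (fun n => rnorm (iter n S y)); split.
- by exists c.
- by move=> n; exact: rnorm_ge0.
- by move=> n; have := TS n 0%N; rewrite addn0.
- by move=> n i ni; rewrite -{1}(subnKC ni) TS.
Qed.

End BackwardSummable.

(** Course-of-values choice: the j-th value is selected knowing the list of all previous ones, so
    its requirements may refer to them. *)
Lemma strong_choice (Q : nat -> seq nat -> nat -> Prop) :
  (forall j s, exists k, Q j s k) -> exists K, forall j, Q j (mkseq K j) (K j).
Proof.
move=> h; have [f fP] := choice (fun p : nat * seq nat => h p.1 p.2).
pose ks := fix ks j := if j is j'.+1 then rcons (ks j') (f (j', ks j')) else [::].
exists (fun j => f (j, ks j)) => j.
suff -> : mkseq (fun j => f (j, ks j)) j = ks j by exact: (fP (j, ks j)).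
by elim: j => // j IH; rewrite mkseqS IH.
Qed.

Lemma bounded_choice (P : nat -> nat -> Prop) m :
  (forall i j j', (j <= j')%N -> P i j -> P i j') ->
  (forall i, (i < m)%N -> exists j, P i j) ->
  exists B, forall i, (i < m)%N -> P i B.
Proof.
move=> mono h; elim: m h => [|m IH] h; first by exists 0%N.
have [B hB] := IH (fun i im => h i (ltnW im)); have [j hj] := h m (leqnn _).
exists (maxn B j) => i; rewrite ltnS leq_eqVlt => /predU1P[->|/hB].
  by apply: mono hj; rewrite leq_maxr.
by apply: mono; rewrite leq_maxl.
Qed.

Lemma sum_le_partition {R : realType} (I : choiceType) (f : I -> R)
    (lab : I -> nat) (D : set I) (a : nat -> R) c :
  (forall j, sum_le [set i | D i /\ lab i = j] f (a j)) ->
  sum_le setT a c -> sum_le D f c.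
Proof.
move=> h ha s us sD.
have [J sJ] : exists J, forall i, i \in s -> (lab i < J)%N.
  by exists (\max_(i <- s) lab i).+1 => i si; rewrite ltnS leq_bigmax_seq.
apply: le_trans (sum_le_iota 0 J ha).
have -> : \sum_(i <- s) f i = \sum_(0 <= j < J) \sum_(i <- s | lab i == j) f i.
  rewrite [RHS](eq_bigr (fun j => \sum_(i <- s) if lab i == j then f i else 0)); last first.
    by move=> j _; exact: big_mkcond.
  rewrite exchange_big/=; apply: eq_big_seq => i /sJ iJ.
  rewrite -[RHS]big_mkcond/= (eq_bigl (pred1 (lab i))); last by move=> j; rewrite /= eq_sym.
  by rewrite big_nat1_eq iJ.
apply: ler_sum => j _; rewrite -big_filter; apply: h; first by rewrite filter_uniq.
by move=> i; rewrite mem_filter => /andP[/eqP ? /sD].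
Qed.

Lemma sum_le_supp {R : realType} (I : choiceType) (f : I -> R) (D E : set I) c :
  (forall i, E i -> ~ D i -> f i = 0) -> sum_le (E `&` D) f c -> sum_le E f c.
Proof.
move=> f0 h s us sE; rewrite (bigID (fun i => `[<D i>]))/= [X in _ + X]big_seq_cond.
rewrite [X in _ + X]big1 => [|i /andP[/sE Ei /asboolPn nD]]; last exact: f0.
rewrite addr0 -big_filter; apply: h; first by rewrite filter_uniq.
by move=> i; rewrite mem_filter => /andP[/asboolP ? /sE].
Qed.

(** Each n < N belongs to at most one of the sets, so only finitely many of them meet the first N
    integers. *)
Lemma disjoint_far (A : nat -> set nat) N :
  (forall k l n, (1 <= k)%N -> (1 <= l)%N -> A k n -> A l n -> k = l) ->
  exists k0, forall k n, (k0 <= k)%N -> A k n -> (N <= n)%N.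
Proof.
move=> dA; have [B hB] : exists B, forall n, (n < N)%N -> forall k, (B <= k)%N -> ~ A k n.
  apply: bounded_choice => [n j j' jj' h k /(leq_trans jj')|n _]; first exact: h.
  case: (pselect (exists k, (1 <= k)%N /\ A k n)) => [[k [k1 Ak]]|nk].
    exists k.+1 => l kl Al; have := dA k l n k1 _ Ak Al.
    by move=> /(_ (leq_trans k1 (ltnW kl))) e; move: kl; rewrite e ltnn.
  by exists 1%N => k k1 Ak; apply: nk; exists k.
by exists B => k n Bk Ak; rewrite leqNgt; apply/negP => /hB /(_ k Bk).
Qed.

(** * A frequently hypercyclic vector from the criterion *)

Section CriterionOrbit.
Context {R : realType} {F : scalars} {X : completeNormedModType (scalar_field R F)}.
Lemma absolutely_summable_rlim (g : nat -> X) (c : R) :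
  sum_le setT (fun n => rnorm (g n)) c ->
  exists u, rlim (fun N => \sum_(0 <= i < N) g i) u.
Proof.
move=> sg; apply: rcauchy_rlim => e e0.
have [N hN] := sum_le_tailn (fun n => rnorm_ge0 (g n)) sg e0.
exists N => n Nn; rewrite rnormB (big_cat_nat (leq0n N) Nn)/= addrAC subrr add0r.
apply: le_trans (ler_rnorm_sum _ _ _) _; apply: hN; first exact: iota_uniq.
by move=> i; rewrite mem_index_iota => /andP[].
Qed.

Variable T : 'L(X).

(* The frequently hypercyclic vector is the sum of [S_i y_j] over all [j] and
   all [i] in [A (K j)], where [K] grows so fast that at a time [n] in
   [A (K j)] the terms of the other blocks are negligible. *)
Lemma criterion_frequently_hypercyclic : separable X ->
  lower_dense_hypercyclicity_criterion T -> frequently_hypercyclic R T.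
Proof.
move=> sepX /lower_dense_criterionP[Y0 [S [A [dY0 lA dA tailA crossA diagA]]]].
have [y0 [Yy0 dy0]] := separable_dense_seq sepX dY0.
(* Every [y0 i] recurs for infinitely many j, so the precision 2^-j attached to the j-th block is
   available for each target. *)
pose y j := y0 (logn 2 j.+1).
have Yy j : Y0 (y j) by exact: Yy0.
pose cross j k n d := sum_le [set i | A k i /\ i <> n]
  (fun i => rnorm (iter n T (S i (y j)))) d.
pose Q0 j k := [/\ (1 <= k)%N,
  sum_le (A k) (fun n => rnorm (S n (y j))) (2 ^- j),
  forall l n, (1 <= l)%N -> A l n -> cross j k n (2 ^- (j + j)),
  forall d : R, 0 < d -> exists l0, forall l n, (l0 <= l)%N -> A l n -> cross j k n d &
  forall n, A k n -> rnorm (iter n T (S n (y j)) - y j) <= 2 ^- j].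
have exQ0 j k0 : exists2 k, (k0 <= k)%N & Q0 j k.
  have [N hN] := tailA _ (Yy j) _ (half_pow_gt0 R j).
  have [k1 hk1] := disjoint_far N dA.
  have [k2 hk2] := diagA _ (Yy j) _ (half_pow_gt0 R j).
  have [k kk [h1 h2]] := crossA _ (Yy j) (maxn k0 (maxn k1 k2)).+1 _ isT (half_pow_gt0 R (j + j)).
  have kk0 : (k0 <= k)%N by lia.
  have kk1 : (k1 <= k)%N by lia.
  have kk2 : (k2 <= k)%N by lia.
  exists k => //; have k01 : (1 <= k)%N by lia.
  split=> //.
  - by apply: sum_le_sub (hN k k01) => n An; split=> //; exact: hk1 An.
  - by move=> d /h2[l0 _ hl]; exists l0.
  - by move=> n; exact: hk2.
have [K KP] : exists K, forall j, [/\ Q0 j (K j), forall i, (i < j)%N -> (K i < K j)%N &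
    forall i, (i < j)%N -> Q0 i (K i) ->
      forall l n, (K j <= l)%N -> A l n -> cross i (K i) n (2 ^- (i + j))].
  have [K hK] : exists K, forall j, [/\ Q0 j (K j),
      forall i, (i < j)%N -> (nth 0%N (mkseq K j) i < K j)%N &
      forall i, (i < j)%N -> Q0 i (nth 0%N (mkseq K j) i) ->
      forall l n, (K j <= l)%N -> A l n -> cross i (nth 0%N (mkseq K j) i) n (2 ^- (i + j))].
    (* The list s is arbitrary at this point, so demands on its entries are made only under [Q0];
       the values finally chosen satisfy it. *)
    apply: (@strong_choice (fun j s k => [/\ Q0 j k,
      forall i, (i < j)%N -> (nth 0%N s i < k)%N &
      forall i, (i < j)%N -> Q0 i (nth 0%N s i) ->
      forall l n, (k <= l)%N -> A l n -> cross i (nth 0%N s i) n (2 ^- (i + j))])) => j s.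
    have [B1 hB1] : exists B, forall i, (i < j)%N -> (nth 0%N s i < B)%N.
      apply: bounded_choice => [i a b ab h|i _]; first exact: leq_trans h ab.
      by exists (nth 0%N s i).+1.
    have [B2 hB2] : exists B, forall i, (i < j)%N -> Q0 i (nth 0%N s i) ->
        forall l n, (B <= l)%N -> A l n -> cross i (nth 0%N s i) n (2 ^- (i + j)).
      apply: bounded_choice => [i a b ab h q l n bl|i _].
        exact: h q _ _ (leq_trans ab bl).
      case: (pselect (Q0 i (nth 0%N s i))) => [q|nq]; last by exists 0%N.
      by have [_ _ _ /(_ _ (half_pow_gt0 R (i + j)))[l0 hl] _] := q; exists l0.
    have [k kB qk] := exQ0 j (maxn B1 B2); exists k; split=> //.
      by move=> i /hB1 h; apply: (leq_trans h); lia.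
    by move=> i ij qi l n kl; apply: hB2 => //; lia.
  exists K => j; have [q h1 h2] := hK j; split=> // i ij.
    by have := h1 i ij; rewrite nth_mkseq.
  by have := h2 i ij; rewrite nth_mkseq.
have K1 j : (1 <= K j)%N by have [[]] := KP j.
have Kinj i j : K i = K j -> i = j.
  move=> e; case: (ltngtP i j) => // ij.
    by have [_ /(_ i ij)] := KP j; rewrite e ltnn.
  by have [_ /(_ j ij)] := KP i; rewrite e ltnn.
(* For i < j the bound comes from the growth of K, for i >= j from [Q0]. Summed over i, all other
   terms disturb a visit of block j by at most 2 * 2^-j; together with the diagonal error 2^-j this
   is the constant 3 below. *)
have crossK i j n : A (K j) n -> cross i (K i) n (2 ^- (i + j)).
  move=> An; have [qi _ _] := KP i; case: (ltnP i j) => ij.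
    by have [_ _ /(_ i ij qi)] := KP j; apply; last exact: An.
  have [_ _ h _ _] := qi; apply: sum_le_ler (h (K j) n (K1 j) An).
  by apply: half_pow_le; rewrite leq_add2l.
have exlab n : exists i, (exists j, A (K j) n) -> A (K i) n.
  case: (pselect (exists j, A (K j) n)) => [[j ?]|?]; first by exists j.
  by exists 0%N.
have [lab labP] := choice exlab.
have labE j n : A (K j) n -> lab n = j.
  move=> An; apply/Kinj; apply: (dA _ _ n) => //.
  by apply: labP; exists j.
pose g n := if `[<exists j, A (K j) n>] then S n (y (lab n)) else 0.
have gE j n : A (K j) n -> g n = S n (y j).
  move=> An; rewrite /g (labE j n An) ifT//; apply/asboolP; by exists j.
have g0 n : ~ (exists j, A (K j) n) -> g n = 0.
  by move=> h; rewrite /g ifF//; apply/asboolPn.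
have labA j n : (exists j', A (K j') n) -> lab n = j -> A (K j) n.
  by move=> /labP + <-.
have sg : sum_le setT (fun n => rnorm (g n)) 2.
  have sumg : sum_le setT (fun j : nat => 2 ^- j : R) 2.
    by apply: sum_le_ler (sum_le_le _ (sum_le_geometric 0)) => [|j _];
      rewrite ?expr0 ?invr1 ?mulr1// addn0.
  apply: (@sum_le_supp _ _ _ [set n | exists j, A (K j) n]) => [n _ /g0->|].
    by rewrite rnorm0.
  apply: (@sum_le_partition _ _ _ lab) sumg => j; rewrite setTI.
  apply: (@sum_le_sub _ _ (A (K j))) => [n [h1 h2]|]; first exact: labA.
  have [[_ h _ _ _] _ _] := KP j.
  by apply: (sum_le_le _ h) => n /gE->.
have [u uP] := absolutely_summable_rlim sg.
have orb j n : A (K j) n -> rnorm (iter n T u - y j) <= 3 * 2 ^- j.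
  move=> An; apply: le_trans (rnorm_triangle (iter n T (g n)) _ _) _.
  have h1 : rnorm (iter n T (g n) - y j) <= 2 ^- j.
    by have [[_ _ _ _ h] _ _] := KP j; rewrite (gE _ _ An); exact: h.
  have h2 : rnorm (iter n T u - iter n T (g n)) <= 2 * 2 ^- j.
    have lu := rlim_iter T n uP.
    apply: (@rlim_isolate _ _ _ (fun i => iter n T (g i))).
      by move=> e /lu[N hN]; exists N => m /hN; rewrite iter_operator_sum.
    apply: (@sum_le_supp _ _ _ [set m | exists j, A (K j) m]) => [m _ /g0->|].
      by rewrite iter_operator0 rnorm0.
    apply: (@sum_le_partition _ _ _ lab) (sum_le_geometric j) => i.
    apply: (@sum_le_sub _ _ [set m | A (K i) m /\ m <> n]).
      by move=> m [[h1' h2'] h3']; split=> //; exact: labA.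
    by apply: (sum_le_le _ (crossK i j n An)) => m [/gE->].
  lra.
apply/frequently_hypercyclicP; exists u => x e e0.
have e20 : 0 < e / 2 by lra.
(* 3 * 2^-j <= 3 e / 7 stays below the remaining e / 2. *)
have e60 : 0 < e / 7 by lra.
have [i hi] := dy0 x _ e20; have [N hN] := exists_half_pow e60.
have [j Nj ji] := logn2_onto i N.
apply: lower_dense_sub (lA _ (K1 j)) => n /orb /= h.
apply: le_lt_trans (rnorm_triangle (y j) _ _) _.
rewrite [rnorm (y j - _)]rnormB; move: hi h; rewrite /y ji.
have := half_pow_le R Nj; lra.
Qed.

End CriterionOrbit.

(** * The space of summable two-sided sequences *)

Section Ell1Theory.
Context {R : realType} {F : scalars}.
Local Notation K := (scalar_field R F).

Section Normed.
Context {X : normedModType K}.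
Implicit Types (x y : ell1 X).

Lemma ell1_rnormE x : (rnorm x)%:E = esum_norm x.
Proof.
by rewrite /rnorm {1}/Num.norm/= /ell1_norm of_realK fineK ?ell1_fin.
Qed.

Lemma ell1_rnorm_leP x (c : R) :
  rnorm x <= c <-> sum_le setT (fun k : int => rnorm (x k)) c.
Proof. by rewrite -lee_fin ell1_rnormE; exact: sum_leP. Qed.

Lemma ell1_sum_le x : sum_le setT (fun k : int => rnorm (x k)) (rnorm x).
Proof. exact/ell1_rnorm_leP. Qed.

Lemma ell1_coord_le x k : rnorm (x k) <= rnorm x.
Proof. exact: (sum_le1 (i := k) _ (ell1_sum_le x)). Qed.

Lemma ell1_mk (f : int -> X) (c : R) :
  sum_le setT (fun k => rnorm (f k)) c ->
  {x : ell1 X | ell1_val x = f & rnorm x <= c}.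
Proof.
move=> /[dup] fc /sum_leP h.
have hf : f \in @ell1_pred _ _ X.
  by rewrite /in_mem/= /ell1_pred; apply: le_lt_trans h _; exact: ltry.
by exists (Ell1 hf) => //; apply/ell1_rnorm_leP.
Qed.

Lemma ell1_ext x y : (forall k, x k = y k) -> x = y.
Proof. by move=> h; apply/val_inj/funext. Qed.

Lemma ell1D x y k : (x + y) k = x k + y k. Proof. by []. Qed.
Lemma ell1B x y k : (x - y) k = x k - y k. Proof. by []. Qed.
Lemma ell1Z a x k : (a *: x) k = a *: x k. Proof. by []. Qed.

Lemma ell1_sum (I : Type) (s : seq I) (P : pred I) (f : I -> ell1 X) k :
  (\sum_(i <- s | P i) f i) k = \sum_(i <- s | P i) f i k.
Proof. by elim/big_rec2: _ => // i a b _ <-. Qed.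

Lemma single_sum_le (k : int) (v : X) :
  sum_le setT (fun l => rnorm (if l == k then v else 0)) (rnorm v).
Proof.
move=> s us _; have [ks|ks] := boolP (k \in s).
  rewrite (bigD1_seq k)//= eqxx big1 ?addr0// => l /negbTE->.
  exact: rnorm0.
rewrite big_seq big1 ?rnorm_ge0// => l ls; case: eqP => [lk|_]; last exact: rnorm0.
by rewrite -lk ls in ks.
Qed.

Definition ell1_single k v : ell1 X := s2val (ell1_mk (single_sum_le k v)).

Lemma ell1_singleE k v l : ell1_single k v l = if l == k then v else 0.
Proof. by rewrite /ell1_single; case: ell1_mk => x /= ->. Qed.

Lemma ell1_single_le k v : rnorm (ell1_single k v) <= rnorm v.
Proof. by rewrite /ell1_single; case: ell1_mk. Qed.

Lemma ell1_singleB k v w :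
  ell1_single k (v - w) = ell1_single k v - ell1_single k w.
Proof.
apply: ell1_ext => l; rewrite ell1B !ell1_singleE.
by case: eqP; rewrite ?subr0.
Qed.

Lemma ell1_single_out k v l : l != k -> ell1_single k v l = 0.
Proof. by rewrite ell1_singleE => /negbTE->. Qed.

Lemma ell1_single_in k v : ell1_single k v k = v.
Proof. by rewrite ell1_singleE eqxx. Qed.

Lemma ell1_sum_single (s : seq int) (y : int -> X) l : uniq s ->
  (\sum_(k <- s) ell1_single k (y k)) l = if l \in s then y l else 0.
Proof.
move=> us; rewrite ell1_sum; case: ifPn => ls.
  rewrite (bigD1_seq l)//= ell1_single_in big1 ?addr0// => k kl.
  by rewrite ell1_single_out// eq_sym.
rewrite big_seq big1// => k ks; rewrite ell1_single_out//.
by apply: contraNneq ls => ->.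
Qed.

Lemma ell1_dense_finite (D : set X) x (e : R) : dense D -> 0 < e ->
  exists (s : seq int) (y : int -> X), [/\ uniq s, forall k, D (y k) &
    rnorm (x - \sum_(k <- s) ell1_single k (y k)) < e].
Proof.
move=> /denseP dD e0; have e30 : 0 < e / 3 by lra.
have [s' hs'] := sum_le_tail (fun k => rnorm_ge0 (x k)) (ell1_sum_le x) e30.
pose s := undup s'.
have n0 : 0 < (size s).+1%:R :> R by [].
(* The error e / 3 is shared among the coordinates in s; the successor keeps the denominator
   positive when s is empty. *)
have ch k : exists y : X, D y /\ rnorm (x k - y) < e / 3 / (size s).+1%:R.
  by have [y Dy h] := dD (x k) _ (divr_gt0 e30 n0); exists y.
have [y yP] := choice ch.
exists s, y; split; [exact: undup_uniq|by move=> k; have [] := yP k|].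
apply: (@le_lt_trans _ _ (e / 3 + e / 3)); last lra.
apply/ell1_rnorm_leP.
apply: (@sum_le_sub _ _ ([set` s] `|` (setT `\` [set` s']))).
  move=> k _ /=; have [ks|ks] := boolP (k \in s'); first by left; rewrite mem_undup.
  by right; split=> //; apply/negP.
apply: sum_leU => [k||]; first exact: rnorm_ge0.
  move=> t ut ts.
  apply: (@le_trans _ _ (\sum_(k <- t) e / 3 / (size s).+1%:R)).
    rewrite big_seq [leRHS]big_seq; apply: ler_sum => k /ts ks.
    have {}ks : k \in s by [].
    rewrite ell1B ell1_sum_single ?undup_uniq// ks ltW//.
    by have [] := yP k.
  rewrite big_const_seq count_predT iter_addr_0 -[leLHS]mulr_natr.
  rewrite -(mulrA (e / 3)) ler_piMr ?ltW// [_^-1 * _]mulrC.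
  rewrite ltr_pdivrMr// mul1r ltr_nat ltnS.
  exact: uniq_leq_size.
apply: (sum_le_le _ hs') => k [_ ks0].
have ks : k \notin s' by apply/negP.
by rewrite ell1B ell1_sum_single ?undup_uniq// mem_undup (negbTE ks) subr0.
Qed.

Lemma ell1_separable : separable X -> separable (ell1 X).
Proof.
move=> sX.
have dT : dense [set: X].
  by apply/denseP => x e e0; exists x => //; rewrite subrr rnorm0.
have [d [_ hd]] := separable_dense_seq sX dT.
pose f (n : nat) : ell1 X := \sum_(p <- (odflt [::] (choice.unpickle n) : seq (int * nat)))
  ell1_single p.1 (d p.2).
apply: (@separable_seq _ _ _ f) => x e e0.
have dd : dense (range d).
  by apply/denseP => z e' /(hd z)[j]; exists (d j).
have [s [y [us yd h]]] := ell1_dense_finite x dd e0.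
have ch k : exists j, d j = y k by have [j _] := yd k; exists j.
have [j jP] := choice ch.
exists (choice.pickle [seq (k, j k) | k <- s]).
rewrite /f choice.pickleK /= big_map (eq_bigr (fun k => ell1_single k (y k)))//.
by move=> k _; rewrite /= jP.
Qed.

End Normed.

Section Complete.
Context {X : completeNormedModType K}.

Lemma ell1_rcauchy_rlim (u : nat -> ell1 X) : rcauchy u -> exists x, rlim u x.
Proof.
move=> cu.
have ch k : exists v, rlim (fun n => u n k) v.
  apply: rcauchy_rlim => e /cu[N hN]; exists N => n /hN.
  by apply: le_trans; rewrite -ell1B; exact: ell1_coord_le.
have [x xP] := choice ch.
have lims (s : seq int) (e : R) : 0 < e ->
    exists N, forall n, (N <= n)%N -> \sum_(k <- s) rnorm (u n k - x k) <= e.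
  elim: s e => [|k s IH] e e0; first by exists 0%N => n _; rewrite big_nil ltW.
  have e20 : 0 < e / 2 by lra.
  have [N hN] := IH _ e20; have [M hM] := xP k _ e20.
  exists (maxn N M) => n; rewrite geq_max => /andP[/hN h1 /hM h2].
  by rewrite big_cons (splitr e) lerD// rnormB.
(* A Fatou argument: on each finite set of coordinates the bound for [u N - u n] passes to the
   coordinatewise limit. *)
have close e N : (forall n, (N <= n)%N -> rnorm (u N - u n) <= e) ->
    sum_le setT (fun k => rnorm (u N k - x k)) e.
  move=> hN s us _; apply/ler_addgt0Pr => d d0.
  have [M hM] := lims s d d0; pose n := maxn N M.
  apply: (@le_trans _ _ (\sum_(k <- s) (rnorm ((u N - u n) k) + rnorm (u n k - x k)))).
    by apply: ler_sum => k _; rewrite ell1B; exact: rnorm_triangle.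
  rewrite big_split lerD ?hM ?leq_maxr//.
  by have /ell1_rnorm_leP := hN n (leq_maxl _ _); apply.
have [N0 h0] := cu 1 ltr01.
have xsum : sum_le setT (fun k => rnorm (x k)) (rnorm (u N0) + 1).
  apply: (sum_le_le _ (sum_leD (ell1_sum_le (u N0)) (close _ _ h0))) => k _.
  by rewrite -{1}(subKr (u N0 k) (x k)); exact: ler_rnormB.
have [z zx _] := ell1_mk xsum.
exists z => e e0; have e20 : 0 < e / 2 by lra.
have [N hN] := cu _ e20; exists N => n /hN hn.
apply: le_trans (rnorm_triangle (u N) _ _) _; rewrite (splitr e) lerD//.
rewrite rnormB; apply/ell1_rnorm_leP.
by apply: (sum_le_le _ (close _ _ hN)) => k _; rewrite ell1B zx.
Qed.

HB.instance Definition _ := Uniform_isComplete.Build (ell1 X)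
  (rlim_complete ell1_rcauchy_rlim).

End Complete.

Section Shift.
Context {X : normedModType K}.
Variable T : 'L(X).

Lemma BT_iterE n (x : ell1 X) (k : int) :
  iter n (BT T) x k = iter n T (x (k + n%:Z)).
Proof.
elim: n k => [|n IH] k; first by rewrite addr0.
rewrite iterS /= [LHS]/(T _) IH; congr (T (iter n T (x _))).
by rewrite -addrA -[1]/(1%:Z) -PoszD add1n.
Qed.

End Shift.

End Ell1Theory.

(** * Passing the criterion from [T] to [B_T] *)

Section CriterionBT.
Context {R : realType} {F : scalars}.
Local Notation K := (scalar_field R F).

Section Tensor.
Context {X : normedModType K}.
Variable T : 'L(X).

Lemma BT_iter_single n k v :
  iter n (BT T) (ell1_single k v) = ell1_single (k - n%:Z) (iter n T v).
Proof.
apply: ell1_ext => l; rewrite BT_iterE !ell1_singleE.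
by rewrite eq_sym -subr_eq eq_sym; case: eqP; rewrite ?iter_operator0.
Qed.

(** The offset d records translations: n steps of [BT T] lower d by n and apply [T^n] to w, leaving
    the shape (s, q) unchanged. *)
Definition orbit_tensor (s : seq int) (q : int -> nat) (d : int) (w : X) : ell1 X :=
  \sum_(k <- s) ell1_single (k + d) (iter (q k) T w).

Lemma orbit_tensor_le s q : exists2 C : R, 0 < C &
  forall d w, rnorm (orbit_tensor s q d w) <= C * rnorm w.
Proof.
have [c c1 hc] := operator_rnorm_ge1 T; have c0 : 0 <= c by lra.
(* The summand 1 makes the constant positive even for an empty list, so that tolerances can be
   divided by it. *)
exists (1 + \sum_(k <- s) c ^+ q k).
  by rewrite ltr_pwDl// sumr_ge0// => k _; rewrite exprn_ge0.
move=> d w; apply: le_trans (ler_rnorm_sum _ _ _) _.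
apply: (@le_trans _ _ ((\sum_(k <- s) c ^+ q k) * rnorm w)).
  rewrite mulr_suml; apply: ler_sum => k _.
  by apply: le_trans (ell1_single_le _ _) _; exact: iter_rnorm.
by rewrite ler_wpM2r ?rnorm_ge0// lerDr.
Qed.

Lemma BT_iter_orbit_tensor n s q d w :
  iter n (BT T) (orbit_tensor s q d w) =
  orbit_tensor s q (d - n%:Z) (iter n T w).
Proof.
rewrite iter_operator_sum; apply: eq_bigr => k _; rewrite BT_iter_single addrA.
by congr ell1_single; rewrite -!iterD addnC.
Qed.

Lemma orbit_tensorB s q d v w :
  orbit_tensor s q d (v - w) = orbit_tensor s q d v - orbit_tensor s q d w.
Proof.
by rewrite -sumrB; apply: eq_bigr => k _; rewrite iter_operatorB ell1_singleB.
Qed.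

(** Finitely many coordinates are first approximated by points [T^(q k) u] of one dense orbit; then
    u alone is replaced by a nearby x of [Y0], which corrects all coordinates at once. *)
Lemma orbit_tensor_dense u (Y0 : set X) :
  dense [set iter n T u | n in setT] -> dense Y0 ->
  dense [set z | exists p : X * seq int * (int -> nat),
    Y0 p.1.1 /\ z = orbit_tensor p.1.2 p.2 0 p.1.1].
Proof.
move=> du /denseP dY; apply/denseP => z e e0; have e20 : 0 < e / 2 by lra.
have [s [y [us yu hz]]] := ell1_dense_finite z du e20.
have ch k : exists q, iter q T u = y k by have [q _] := yu k; exists q.
have [q qP] := choice ch.
have [C C0 hC] := orbit_tensor_le s q.
have [x Yx ux] := dY u _ (divr_gt0 e20 C0).
exists (orbit_tensor s q 0 x); first by exists (x, s, q).
have E : \sum_(k <- s) ell1_single k (y k) = orbit_tensor s q 0 u.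
  by apply: eq_bigr => k _; rewrite addr0 qP.
rewrite E in hz; apply: le_lt_trans (rnorm_triangle (orbit_tensor s q 0 u) _ _) _.
rewrite -orbit_tensorB; have := hC 0 (u - x).
have : C * rnorm (u - x) < e / 2 by rewrite mulrC -ltr_pdivlMr.
lra.
Qed.

End Tensor.

Lemma sum_le_scale (I : choiceType) (D : set I) (f g : I -> R) (C e : R) :
  0 < C -> (forall i, D i -> f i <= C * g i) -> sum_le D g (e / C) -> sum_le D f e.
Proof.
move=> C0 fg h; have -> : e = C * (e / C) by rewrite mulrC divfK// gt_eqF.
by apply: (sum_le_le _ (sum_leZ (ltW C0) h)).
Qed.

Lemma lower_dense_criterion_BT (X : completeNormedModType K) (T : 'L(X)) :
  separable X -> lower_dense_hypercyclicity_criterion T ->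
  lower_dense_hypercyclicity_criterion (BT T).
Proof.
move=> sX cT.
have [u du] := frequently_hypercyclic_hypercyclic
  (criterion_frequently_hypercyclic sX cT).
have /lower_dense_criterionP[Y0 [S [A [dY0 lA dA tailA crossA diagA]]]] := cT.
pose Y := [set z : ell1 X | exists p : X * seq int * (int -> nat),
    Y0 p.1.1 /\ z = orbit_tensor T p.1.2 p.2 0 p.1.1].
have ch (z : ell1 X) : exists p : X * seq int * (int -> nat), Y z ->
    Y0 p.1.1 /\ z = orbit_tensor T p.1.2 p.2 0 p.1.1.
  case: (pselect (Y z)) => [[p hp]|nz]; first by exists p.
  by exists (0, [::], fun=> 0%N).
have [f fP] := choice ch.
(* The offset n is undone by n steps of [BT T], so the images compare with z exactly as [T^n S_n x]
   compares with x. *)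
pose S' n z := orbit_tensor T (f z).1.2 (f z).2 n%:Z (S n (f z).1.1).
apply/lower_dense_criterionP; exists Y, S', A.
have main z : Y z -> Y0 (f z).1.1 /\ exists2 C : R, 0 < C &
    (forall n i, rnorm (iter n (BT T) (S' i z)) <= C * rnorm (iter n T (S i (f z).1.1))) /\
    (forall n, rnorm (iter n (BT T) (S' n z) - z) <=
       C * rnorm (iter n T (S n (f z).1.1) - (f z).1.1)).
  move=> /fP[Yx zE]; split=> //.
  have [C C0 hC] := orbit_tensor_le T (f z).1.2 (f z).2; exists C => //.
  split=> [n i|n]; first by rewrite BT_iter_orbit_tensor.
  by rewrite {2}zE BT_iter_orbit_tensor subrr -orbit_tensorB.
split=> //.
- exact: orbit_tensor_dense du dY0.
- move=> z /main[Yx [C C0 [h1 h2]]] e e0.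
  have [N hN] := tailA _ Yx _ (divr_gt0 e0 C0); exists N => k k1.
  by apply: sum_le_scale C0 _ (hN k k1) => n _; exact: (h1 0%N).
- move=> z /main[Yx [C C0 [h1 h2]]] k0 e k01 e0.
  have [k k0k [c1 c2]] := crossA _ Yx _ _ k01 (divr_gt0 e0 C0).
  exists k => //; split=> [l n l1 Al|d d0].
    by apply: sum_le_scale C0 _ (c1 l n l1 Al) => i _; exact: h1.
  have [l0 l01 hl] := c2 _ (divr_gt0 d0 C0); exists l0 => // l n ll Al.
  by apply: sum_le_scale C0 _ (hl l n ll Al) => i _; exact: h1.
- move=> z /main[Yx [C C0 [h1 h2]]] e e0.
  have [k0 hk] := diagA _ Yx _ (divr_gt0 e0 C0); exists k0 => k n kk Ak.
  by apply: le_trans (h2 n) _; rewrite mulrC -ler_pdivlMr// (hk k).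
Qed.

Lemma lower_dense_criterion_BT_frequently_hypercyclic
    (X : completeNormedModType K) (T : 'L(X)) :
  separable X -> lower_dense_hypercyclicity_criterion T ->
  frequently_hypercyclic R (BT T).
Proof.
move=> sX cT.
exact: (@criterion_frequently_hypercyclic _ _ (ell1 X) (BT T)
  (ell1_separable sX) (lower_dense_criterion_BT sX cT)).
Qed.

End CriterionBT.

(** * Extracting the criterion from an orbit of [B_T] *)

Section BTToCriterion.
Context {R : realType} {F : scalars}.
Local Notation K := (scalar_field R F).

Lemma of_real1 : of_real F 1 = 1 :> K.
Proof. by case: F. Qed.

Context {X : normedModType K}.
Variable T : 'L(X).

Lemma rnorm_of_realZ (a : R) (x : X) : 0 <= a ->
  rnorm (of_real F a *: x) = a * rnorm x.
Proof.
move=> a0; rewrite rnormZ ger0_norm ?of_realK//.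
by rewrite -of_real0 ler_of_real.
Qed.

Section Targets.
Variables (u : ell1 X) (y : nat -> X) (c kappa : R).
Hypotheses (c2 : (2 : R) <= c) (Tc : forall x, rnorm (T x) <= c * rnorm x).
Hypotheses (kappa1 : 1 <= kappa) (kappa4 : (4 : R) <= kappa * rnorm (y 0%N)).

(* [B_T] multiplies norms by at most [c], so the growth of [target_scale] keeps
   the visits to [target k] and [target l] at distance at least [k + l]. *)
Definition target_scale (k : nat) : R := kappa * k%:R * c ^+ k.
Local Notation lam := target_scale.

Definition target k : ell1 X :=
  \sum_(0 <= j < k) ell1_single (- j%:Z) (of_real F (lam k) *: y j).

Definition visit k : set nat :=
  [set n | rnorm (target k - iter n (BT T) u) < c ^- k].

Let cpos : 0 < c. Proof. exact: lt_le_trans c2. Qed.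
Let c1 : 1 <= c. Proof. by apply: le_trans c2; rewrite ler1n. Qed.
Let ck1 k : 1 <= c ^+ k. Proof. exact: exprn_ege1. Qed.
Let ck0 k : 0 < c ^+ k. Proof. exact: exprn_gt0. Qed.

Let ck_half k : c ^- k <= 2 ^- k.
Proof. by rewrite lef_pV2 ?posrE ?exprn_gt0// lerXn2r// nnegrE ltW. Qed.

Let ckV1 k : c ^- k <= 1.
Proof. by rewrite invf_le1. Qed.

Let lam_ge k : (1 <= k)%N -> k%:R <= lam k.
Proof.
move=> k1; have -> : lam k = k%:R * (kappa * c ^+ k) by rewrite /target_scale; ring.
by rewrite ler_peMr// mulr_ege1.
Qed.

Let lam1 k : (1 <= k)%N -> 1 <= lam k.
Proof. by move=> k1; apply: le_trans (lam_ge k1); rewrite ler1n. Qed.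

Lemma target_in k j : (j < k)%N -> target k (- j%:Z) = of_real F (lam k) *: y j.
Proof.
move=> jk; rewrite ell1_sum (bigD1_seq j) ?mem_index_iota ?iota_uniq//=.
rewrite ell1_single_in big1 ?addr0// => i ij; rewrite ell1_single_out//.
by rewrite eqr_opp eq_sym.
Qed.

Lemma target_out k (l : int) : (0 < l) || (l <= - k%:Z) -> target k l = 0.
Proof.
move=> h; rewrite ell1_sum big_seq big1// => j; rewrite mem_index_iota => /andP[_ jk].
by rewrite ell1_single_out//; apply/eqP => e; move: h; rewrite e; lia.
Qed.

Let visit_coord k n (l : int) : visit k n ->
  rnorm (target k l - iter n (BT T) u l) < c ^- k.
Proof. by move=> h; apply: le_lt_trans h; rewrite -ell1B ell1_coord_le. Qed.

Let visit0 k n : (1 <= k)%N -> visit k n ->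
  `| rnorm (iter n (BT T) u 0) - lam k * rnorm (y 0%N) | <= 1.
Proof.
move=> k1 /(visit_coord 0).
have -> : target k 0 = of_real F (lam k) *: y 0%N by rewrite -(target_in k1).
move=> /ltW /le_trans /(_ (ckV1 k)) h.
rewrite -rnorm_of_realZ; last by apply: le_trans (lam1 k1).
rewrite ler_norml; apply/andP; split.
  by have := le_trans (ler_rnorm_dist _ _) h; lra.
by rewrite rnormB in h; exact: le_trans (ler_rnorm_dist _ _) h.
Qed.

Let lam4 k : (1 <= k)%N -> 4 * c ^+ k <= lam k * rnorm (y 0%N).
Proof.
move=> k1; rewrite /target_scale.
have k1' : 1 <= k%:R :> R by rewrite ler1n.
have -> : kappa * k%:R * c ^+ k * rnorm (y 0%N) = k%:R * c ^+ k * (kappa * rnorm (y 0%N)) by ring.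
rewrite mulrC; apply: ler_pM => //; first exact: ltW.
by rewrite ler_peMl// ltW.
Qed.

(** At time n the coordinate i - n > 0 of the orbit is below [c ^- l], because [target l] vanishes
    there. After i - n further steps it has become coordinate 0, of norm at most [c ^+ (i - n - l)].
    For i - n < k + l this is at most [c ^+ k], whereas a visit to [target k] requires at least
    [4 * c ^+ k - 1]. *)
Lemma visit_gap k l i n : (1 <= k)%N -> visit k i -> visit l n ->
  (n < i)%N -> (n + k + l <= i)%N.
Proof.
move=> k1 ki ln ni; rewrite leqNgt; apply/negP => ikl.
have := visit0 k1 ki; rewrite ler_norml => /andP[+ _].
have := lam4 k1.
have : rnorm (iter i (BT T) u 0) <= c ^+ k.
  rewrite -(subnK (ltnW ni)) iterD BT_iterE add0r.
  apply: le_trans (iter_rnorm (ltW cpos) Tc _ _) _.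
  have := visit_coord (i - n)%:Z ln; rewrite target_out; last by lia.
  rewrite sub0r rnormN => /ltW h.
  apply: le_trans (ler_wpM2l (ltW (exprn_gt0 _ cpos)) h) _.
  by rewrite ler_pdivrMr// -exprD ler_weXn2l//; lia.
by have := ck1 k; lra.
Qed.

(** Coordinate 0 identifies the target: the norms prescribed there for different k differ by at
    least 4, and a visit tolerates an error of 1. *)
Lemma visit_disjoint k l n : (1 <= k)%N -> (1 <= l)%N ->
  visit k n -> visit l n -> k = l.
Proof.
wlog kl : k l / (k < l)%N => [h k1 l1 kn ln|k1 l1 kn ln].
  case: (ltngtP k l) => // kl; first exact: h kl k1 l1 kn ln.
  by apply/esym; exact: h kl l1 k1 ln kn.
exfalso; have := visit0 k1 kn; have := visit0 l1 ln.
rewrite !ler_norml => /andP[h1 _] /andP[_ h2].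
have : lam k * rnorm (y 0%N) + 4 <= lam l * rnorm (y 0%N).
  have E a : lam a * rnorm (y 0%N) = a%:R * c ^+ a * (kappa * rnorm (y 0%N)).
    by rewrite /target_scale; ring.
  have h3 : k%:R * c ^+ k + 1 <= l%:R * c ^+ l.
    have hc : c ^+ k <= c ^+ l by rewrite ler_weXn2l// ltnW.
    have hk : k%:R + 1 <= l%:R :> R by rewrite natr1 ler_nat.
    have k0 : 0 <= k%:R :> R by [].
    have := ck1 l; nra.
  rewrite !E -lerBrDl -mulrBl; apply: le_trans kappa4 _; rewrite ler_peMl//.
    exact: le_trans kappa4.
  by rewrite lerBrDl.
lra.
Qed.

Lemma visit_criterion : (forall x (e : R), 0 < e -> exists j, rnorm (x - y j) < e) ->
  (forall k, lower_dense R (visit k)) -> lower_dense_hypercyclicity_criterion T.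
Proof.
move=> yd lA.
have chj v : exists j, range y v -> y j = v.
  by case: (pselect (range y v)) => [[j _ <-]|?]; [exists j|exists 0%N].
have [J JP] := choice chj.
have chk n : exists k, (exists k', (1 <= k')%N /\ visit k' n) -> (1 <= k)%N /\ visit k n.
  by case: (pselect (exists k', (1 <= k')%N /\ visit k' n)) => [[k ?]|?]; [exists k|exists 0%N].
have [lab labP] := choice chk.
have labE k n : (1 <= k)%N -> visit k n -> lab n = k.
  move=> k1 kn; have [l1 ln] := labP n (ex_intro _ k (conj k1 kn)).
  exact: visit_disjoint l1 k1 ln kn.
(* [T^n] carries the coordinate n - J v of u to the coordinate - J v of the n-th orbit point, which
   at a visit to [target k] is close to [lam k] times v. If k <= J v the target is zero at that
   coordinate, hence the default 0. *)
pose S n v : X := if (J v < lab n)%N then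
  of_real F (lam (lab n))^-1 *: u (n%:Z - (J v)%:Z) else 0.
have SE k n v : (1 <= k)%N -> visit k n -> (J v < k)%N ->
    S n v = of_real F (lam k)^-1 *: u (n%:Z - (J v)%:Z).
  by move=> k1 kn vk; rewrite /S (labE k)// vk.
have lamV k : (1 <= k)%N -> 0 <= (lam k)^-1 <= 1.
  move=> /lam1 h; have h0 : 0 < lam k by lra.
  by rewrite invr_ge0 ltW//= invf_le1.
(* By the gap, i - J v - n is positive or at most - l for every other visit i, so [target l]
   vanishes there. The vectors summed are, up to the factor [(lam k)^-1], distinct coordinates of
   [iter n (BT T) u - target l], whose norm is below [c ^- l]. *)
have cross k l v n : (1 <= k)%N -> (1 <= l)%N -> visit l n -> (J v < k)%N ->
    sum_le [set i | visit k i /\ i <> n] (fun i => rnorm (iter n T (S i v)))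
      ((lam k)^-1 * c ^- l).
  move=> k1 l1 ln vk; have /andP[k0 _] := lamV k k1.
  have h := sum_leZ k0 ((ell1_rnorm_leP _ _).1 (ltW ln)).
  have hinj := @sum_le_inj R _ _ (fun i : nat => i%:Z - (J v)%:Z - n%:Z)
    [set i | visit k i /\ i <> n] _ _ _ _ _ h.
  apply: (sum_le_le _ (hinj _ _)) => //.
    move=> i [ki /eqP in_]; rewrite (SE k)// iter_operatorZ rnorm_of_realZ//.
    rewrite ler_wpM2l// ell1B target_out; last first.
      case: (ltngtP n i) => [ni|ni|e]; last by rewrite e eqxx in in_.
        by have := visit_gap k1 ki ln ni; lia.
      by have := visit_gap l1 ln ki ni; lia.
    by rewrite sub0r rnormN BT_iterE subrK.
  by move=> i j _ _; lia.
apply/lower_dense_criterionP; exists (range y), S, visit; split.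
- by apply/denseP => x e /(yd x)[j]; exists (y j).
- by move=> k _.
- by move=> k l n k1 l1; exact: visit_disjoint.
- move=> v _ e e0.
  have hinj := @sum_le_inj R _ _ (fun i : nat => i%:Z - (J v)%:Z) setT _ _ _ _ _ (ell1_sum_le u).
  have hs : sum_le setT (fun n : nat => rnorm (u (n%:Z - (J v)%:Z))) (rnorm u).
    by apply: hinj => // i j _ _; lia.
  have [N hN] := sum_le_tailn (fun n => rnorm_ge0 _) hs e0.
  exists N => k k1; apply: (@sum_le_sub _ _ [set n | setT n /\ visit k n /\ (N <= n)%N]) => [n []//|].
  apply: (@sum_le_le _ _ _ _ (fun n : nat => rnorm (u (n%:Z - (J v)%:Z)))).
    move=> n [_ [kn _]]; rewrite /S; case: ifP => _; last by rewrite rnorm0 rnorm_ge0.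
    rewrite (labE k)//; have /andP[k0 k1'] := lamV k k1.
    by rewrite rnorm_of_realZ// ler_piMl// rnorm_ge0.
  by apply: sum_le_sub hN => n [_ [_ ?]].
- move=> v _ k0 e k01 e0.
  (* Since [lam k >= k >= 1 / e], the factor [(lam k)^-1] gives the bound e for all l at once; the
     factor [c ^- l] gives the decay in l. *)
  pose k := maxn k0 (maxn (J v).+1 (Num.truncn e^-1).+1).
  have k1 : (1 <= k)%N by rewrite /k; lia.
  have vk : (J v < k)%N by rewrite /k; lia.
  exists k; first by rewrite /k; lia.
  have /andP[lk0 lk1] := lamV k k1.
  have cV n : 0 <= c ^- n by rewrite invr_ge0 ltW.
  split=> [l n l1 ln|d d0].
    apply: sum_le_ler (cross k l v n k1 l1 ln vk).
    apply: (@le_trans _ _ (lam k)^-1); first by rewrite ler_piMr.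
    rewrite -[leRHS]invrK lef_pV2 ?posrE ?invr_gt0//; last by apply: lt_le_trans (lam1 k1).
    apply: le_trans (lam_ge k1); apply: ltW; apply: lt_le_trans (truncnS_gt _) _.
    by rewrite ler_nat /k !leq_max leqnn !orbT.
  have [N hN] := exists_half_pow d0; exists N.+1 => // l n Nl ln.
  have l1 : (1 <= l)%N by apply: leq_trans Nl.
  apply: sum_le_ler (cross k l v n k1 l1 ln vk).
  apply: le_trans hN; apply: le_trans (half_pow_le R (ltnW Nl)).
  by apply: le_trans (ck_half l); rewrite ler_piMl.
- move=> v yv e e0; have [N hN] := exists_half_pow e0.
  exists (maxn N (J v).+1) => k n; rewrite geq_max => /andP[Nk vk] kn.
  have k1 : (1 <= k)%N by apply: leq_trans vk.
  have lk : 0 < lam k by apply: lt_le_trans (lam1 k1).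
  have /andP[lk0 lk1] := lamV k k1.
  have e1 : iter n T (S n v) - v = of_real F (lam k)^-1 *:
      (iter n (BT T) u (- (J v)%:Z) - target k (- (J v)%:Z)).
    rewrite (SE k)// iter_operatorZ scalerBr target_in// scalerA -of_realM mulVf ?gt_eqF//.
    by rewrite JP// BT_iterE of_real1 scale1r [- _ + _]addrC.
  rewrite e1 rnorm_of_realZ// rnormB.
  apply: le_trans hN; apply: le_trans (half_pow_le R Nk).
  apply: le_trans (ck_half k); apply: le_trans (ltW (visit_coord (- (J v)%:Z) kn)).
  by rewrite ler_piMl// rnorm_ge0.
Qed.

End Targets.

Lemma BT_frequently_hypercyclic_criterion : separable X ->
  frequently_hypercyclic R (BT T) -> lower_dense_hypercyclicity_criterion T.
Proof.
move=> sX /frequently_hypercyclicP[u hu].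
(* The targets need a first vector of positive norm; in the zero space the criterion is obtained
   directly from the vector 0. *)
case: (pselect (exists v : X, v != 0)) => [[v v0]|nv]; last first.
  apply: backward_summable_criterion; apply/denseP => x e e0.
  exists 0; first exact: backward_summable0.
  have -> : x = 0 by apply/eqP; apply/negP => /negP x0; apply: nv; exists x.
  by rewrite subrr rnorm0.
have dT : dense [set: X].
  by apply/denseP => x e e0; exists x => //; rewrite subrr rnorm0.
have [d [_ hd]] := separable_dense_seq sX dT.
pose y j := if j is j'.+1 then d j' else v.
have [c c1 Tc] := operator_rnorm_ge1 T.
have rv := rnorm_gt0 v0.
(* Adding 1 to c >= 1 reaches the required 2, and kappa satisfies [kappa * rnorm v >= 4]. *)
apply: (@visit_criterion u y (c + 1) (1 + 4 / rnorm v)).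
- lra.
- by move=> x; apply: le_trans (Tc x) _; rewrite ler_wpM2r ?rnorm_ge0//; lra.
- by rewrite lerDl divr_ge0// ltW.
- by rewrite /= mulrDl mul1r divfK ?gt_eqF// lerDr ltW.
- by move=> x e e0; have [j hj] := hd x e e0; exists j.+1.
- by move=> k; apply: hu; rewrite invr_gt0 exprn_gt0//; lra.
Qed.

End BTToCriterion.

(** * Periodic points and backward orbits *)

Section PeriodicPoints.
Context {R : realType} {F : scalars}.
Local Notation K := (scalar_field R F).
Context {X : normedModType K}.
Variable T : 'L(X).

Section FromCriterion.
Variables (X0 : set X) (S : X -> X).
Hypotheses (SX0 : forall x, X0 x -> X0 (S x)) (TS : forall x, X0 x -> T (S x) = x).

(** The past under [S] sits at positive indices and the future under [T] at negative ones, so that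
    [T] lowers the index by one, as [BT T] does with coordinates. *)
Definition two_sided_orbit (v : X) (m : int) : X :=
  match m with Posz n => iter n S v | Negz n => iter n.+1 T v end.

Lemma two_sided_orbit_step v n m : X0 v ->
  iter n T (two_sided_orbit v (m + n%:Z)) = two_sided_orbit v m.
Proof.
move=> Xv; elim: n m => [|n IH] m; first by rewrite addr0.
rewrite iterSr -[in RHS]IH; congr (iter n T _).
have -> : m + n.+1%:Z = m + n%:Z + 1 by rewrite -addrA -PoszD addn1.
case: (m + n%:Z) => [k|[|k]].
- rewrite -PoszD addn1 /= TS//; elim: k => //= k IHk; exact: SX0.
- by [].
- by rewrite (_ : Negz k.+1 + 1 = Negz k)//; lia.
Qed.

Lemma two_sided_orbit_sum v a b :
  sum_le setT (fun n => rnorm (iter n S v)) a ->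
  sum_le setT (fun n => rnorm (iter n T v)) b ->
  sum_le setT (fun m => rnorm (two_sided_orbit v m)) (a + b).
Proof.
move=> ha hb.
apply: (@sum_le_sub _ _ ([set m : int | 0 <= m] `|` [set m : int | m < 0])).
  by move=> m _ /=; case: (leP 0 m); [left|right].
apply: sum_leU => [m||]; first exact: rnorm_ge0.
  have H := @sum_le_inj R _ _ (fun m : int => absz m) [set m : int | 0 <= m] _ _ _ _ _ ha.
  apply: (sum_le_le _ (H _ _)) => //=; first by case.
  by move=> i j /=; lia.
have H := @sum_le_inj R _ _ (fun m : int => absz m) [set m : int | m < 0] _ _ _ _ _ hb.
apply: (sum_le_le _ (H _ _)) => //=; first by case.
by move=> i j /=; lia.
Qed.

(* Keep the orbit only at the multiples of [N], translated by [k]. *)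
Lemma periodic_approx v k (e : R) : X0 v ->
  absolutely_summable (fun n => iter n S v) ->
  absolutely_summable (fun n => iter n T v) -> 0 < e ->
  exists N0, forall N, (N0 <= N)%N -> (0 < N)%N -> exists2 z : ell1 X,
    iter N (BT T) z = z & rnorm (ell1_single k v - z) <= e.
Proof.
move=> Xv [a ha] [b hb] e0; have ho := two_sided_orbit_sum ha hb.
have [s hs] := sum_le_tail (fun m => rnorm_ge0 (two_sided_orbit v m)) ho e0.
(* Beyond this bound every nonzero multiple of N lies outside s, so the entries of z other than the
   one at k belong to a tail of sum at most e. *)
exists (\max_(m <- s) absz m).+1 => N N0N N0.
pose f (l : int) := if (N %| absz (l - k))%N then two_sided_orbit v (l - k) else 0.
have hk : sum_le setT (fun l : int => rnorm (two_sided_orbit v (l - k))) (a + b).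
  have H := @sum_le_inj R _ _ (fun l : int => l - k) setT _ _ _ _ _ ho.
  by apply: H => // i j _ _ /addIr.
have hf : sum_le setT (fun l => rnorm (f l)) (a + b).
  apply: (sum_le_le _ hk) => l _; rewrite /f.
  by case: ifP => // _; rewrite rnorm0 rnorm_ge0.
have [z zf _] := ell1_mk hf; exists z.
  apply: ell1_ext => l; rewrite BT_iterE zf /f addrAC.
  have -> : (N %| `|(l - k + N%:Z)%R|)%N = (N %| `|(l - k)%R|)%N.
    by rewrite -[N]/(absz N%:Z) -!dvdzE; apply: rpredDr; exact: dvdzz.
  by case: ifP => _; rewrite ?iter_operator0 ?two_sided_orbit_step.
apply/ell1_rnorm_leP.
have H := @sum_le_inj R _ _ (fun l : int => l - k) [set l : int | l - k \notin s] _ _ _ _ _ hs.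
apply: (@sum_le_supp _ _ _ [set l : int | l - k \notin s]) => [l _ /negP|].
  rewrite negbK => ls; rewrite ell1B zf /f ell1_singleE.
  have [->|lk] := eqVneq l k; first by rewrite subrr dvdn0 subrr rnorm0.
  rewrite ifF ?subr0 ?rnorm0//; apply/negP => /dvdn_leq.
  rewrite absz_gt0 subr_eq0 lk => /(_ isT); apply/negP; rewrite -ltnNge.
  by apply: leq_trans N0N; rewrite ltnS; exact: (@leq_bigmax_seq _ _ _ absz).
rewrite setTI; apply: (sum_le_le _ (H _ _)) => [l ls|i j _ _ /addIr//|l ls]; last first.
  by split=> //; apply/negP.
rewrite ell1B zf /f ell1_singleE.
have [->|lk] := eqVneq l k; first by rewrite subrr dvdn0 subrr rnorm0 rnorm_ge0.
by rewrite sub0r rnormN; case: ifP => // _; rewrite rnorm0 rnorm_ge0.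
Qed.

End FromCriterion.

Lemma frequent_criterion_periodic : frequent_hypercyclicity_criterion T ->
  dense (periodic_points (BT T)).
Proof.
move=> /frequent_criterionP[X0 [S [dX0 SX0 h]]].
apply/denseP => x e e0; have e20 : 0 < e / 2 by lra.
have [s [y [us yX hx]]] := ell1_dense_finite x dX0 e20.
(* Each summand has an approximant for every large N, so one common N serves all summands and the
   sum of the approximants is again fixed by the N-th iterate. *)
suff [N0 hN] : exists N0, forall N, (N0 <= N)%N -> (0 < N)%N -> exists2 z : ell1 X,
    iter N (BT T) z = z & rnorm (\sum_(k <- s) ell1_single k (y k) - z) <= e / 2.
  have [z pz xz] := hN N0.+1 (leqnSn _) isT; exists z; first by exists N0.+1.
  apply: le_lt_trans (rnorm_triangle (\sum_(k <- s) ell1_single k (y k)) _ _) _; lra.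
elim: s (e / 2) e20 {us hx} => [|k s IH] d d0.
  by exists 0%N => N _ _; exists 0; rewrite ?iter_operator0// big_nil subrr rnorm0 ltW.
have d20 : 0 < d / 2 by lra.
have [N1 h1] := IH _ d20; have [s1 s2 TS] := h _ (yX k).
have [|N2 h2] := @periodic_approx X0 S SX0 _ (y k) k _ (yX k) s2 s1 d20.
  by move=> v /h[].
exists (maxn N1 N2) => N; rewrite geq_max => /andP[N1N N2N] N0.
have [z1 p1 d1] := h1 N N1N N0; have [z2 p2 d2] := h2 N N2N N0.
exists (z2 + z1); first by rewrite iter_operatorD p1 p2.
rewrite big_cons opprD addrACA; apply: le_trans (ler_rnormD _ _) _; lra.
Qed.

Lemma iter_periodic (Y : Type) (f : Y -> Y) d z n :
  iter d f z = z -> iter n f z = iter (n %% d) f z.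
Proof.
move=> fz; rewrite {1}(divn_eq n d) addnC iterD; congr (iter _ f _).
by elim: (n %/ d)%N => // m IH; rewrite mulSn iterD IH.
Qed.

(** Only d vectors occur along a periodic orbit, and the entries read off from one of them at
    distinct positions [q n] sum to at most its norm. *)
Lemma periodic_summable (z : ell1 X) d (p : nat -> nat) (q : nat -> int) :
  (0 < d)%N -> iter d (BT T) z = z -> injective q ->
  absolutely_summable (fun n => iter (p n) (BT T) z (q n)).
Proof.
move=> d0 dz qi; pose a j := if (j < d)%N then rnorm (iter j (BT T) z) else 0.
exists (\sum_(j <- undup (iota 0 d)) a j).
have a0 j : 0 <= a j by rewrite /a; case: ifP => // _; exact: rnorm_ge0.
apply: (@sum_le_partition _ _ _ (fun n => p n %% d)%N setT a).
  move=> j; rewrite /a; case: ltnP => jd; last first.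
    apply: (sum_le_le (g := fun=> 0)) (@sum_le0 R nat _) => n [_ e].
    by move: jd; rewrite -e leqNgt ltn_pmod.
  have H := @sum_le_inj R _ _ q [set n | setT n /\ (p n %% d)%N = j] _ _ _ _ _ (ell1_sum_le (iter j (BT T) z)).
  apply: (sum_le_le _ (H _ _)) => // [n [_ e]|i i' _ _]; last exact: qi.
  by rewrite (iter_periodic _ dz) e.
apply: (@sum_le_supp _ _ _ [set j | j \in iota 0 d]) => [j _|].
  by rewrite /= mem_iota/= add0n => /negP/negbTE jd; rewrite /a jd.
by rewrite setTI; exact: sum_le_seq.
Qed.

Lemma absolutely_summableS (g : nat -> X) :
  absolutely_summable (fun n => g n.+1) -> absolutely_summable g.
Proof.
move=> [c hc]; exists (rnorm (g 0%N) + c).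
apply: sum_le_series => [n|[|n]]; first exact: rnorm_ge0.
  by rewrite big_nil addr_ge0 ?rnorm_ge0//; exact: sum_le_ge0 hc.
by rewrite big_nat_recl// lerD2l; exact: (sum_le_iota 0 n hc).
Qed.

Definition backward_orbit (x : X) (h : nat -> X) :=
  [/\ h 0%N = x, forall m, T (h m.+1) = h m & absolutely_summable h].

(** Periodicity gives [T^d z_(dm + d) = z_(dm)], a backward orbit of [T^d] only. The vectors
    [T^((d - 1) m) z_(dm)] form one of [T], and each is the coordinate m of a point of the orbit of
    z, whence summability. *)
Lemma periodic_backward_orbit (z : ell1 X) d : (0 < d)%N -> iter d (BT T) z = z ->
  absolutely_summable (fun n => iter n T (z 0)) /\
  exists h, backward_orbit (z 0) h.
Proof.
move=> d0 dz; split.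
  have [|c hc] := @periodic_summable z d id (fun n => - n%:Z) d0 dz.
    by move=> i j /oppr_inj[].
  exists c; apply: (sum_le_le _ hc) => n _; by rewrite BT_iterE addNr.
exists (fun m => iter (d.-1 * m)%N (BT T) z m%:Z); split.
- by rewrite muln0.
- move=> m; rewrite !BT_iterE.
  have -> : T (iter (d.-1 * m.+1) T (z (m.+1%:Z + (d.-1 * m.+1)%:Z))) =
    iter (d.-1 * m) T (iter d T (z (m%:Z + (d.-1 * m)%:Z + d%:Z))).
    rewrite -iterS -iterD; congr (iter _ T (z _)); first by nia.
    by rewrite -!PoszD; congr Posz; nia.
  by congr iter; rewrite -BT_iterE dz.
- by apply: (@periodic_summable z d) => // i j [].
Qed.

(* Backward orbits of different points may merge. The preimage chosen at [v]
   is the one given by the first backward orbit [h j] through [v], after the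
   last visit of [h j] to [v]; iterating it can only decrease [j]. *)
Lemma backward_orbits_criterion (y : nat -> X) (h : nat -> nat -> X) :
  (forall x (e : R), 0 < e -> exists j, rnorm (x - y j) < e) ->
  (forall j, absolutely_summable (fun n => iter n T (y j))) ->
  (forall j, backward_orbit (y j) (h j)) -> frequent_hypercyclicity_criterion T.
Proof.
move=> dy sy bh.
pose on v j := `[<exists m, h j m = v>].
have ex v : exists p : nat * nat, v <> 0 -> (exists j, on v j) ->
    [/\ h p.1 p.2 = v, forall j m, h j m = v -> (p.1 <= j)%N &
        forall m, h p.1 m = v -> (m <= p.2)%N].
  case: (pselect (v <> 0 /\ exists j, on v j)) => [[v0 ej]|nv]; last first.
    by exists (0%N, 0%N) => v0 ej; case: nv.
  have [j /asboolP jv jmin] := ex_minnP ej.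
  have [_ _ [c hc]] := bh j.
  (* A summable sequence takes a nonzero value finitely often: beyond N all norms are at most half
     that of v. So a last visit exists. *)
  have rv : 0 < rnorm v / 2 by rewrite divr_gt0// rnorm_gt0//; apply/eqP.
  have [N hN] := sum_le_tailn (fun m => rnorm_ge0 (h j m)) hc rv.
  have bound m : `[<h j m = v>] -> (m <= N)%N.
    move=> /asboolP mv; rewrite leqNgt; apply/negP => Nm.
    have := sum_le1 (i := m) (conj I (ltnW Nm)) hN; rewrite mv; lra.
  have em : exists m, `[<h j m = v>] by have [m ?] := jv; exists m; apply/asboolP.
  have [m /asboolP mv mmax] := ex_maxnP em bound.
  exists (j, m) => _ _; split=> //= [j' m' e|m' e]; last by apply: mmax; apply/asboolP.
  by apply: jmin; apply/asboolP; exists m'.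
have [p pP] := choice ex.
pose X0 := [set v | v = 0 \/ exists j, on v j].
(* A backward orbit may visit 0 infinitely often, so 0 has no last visit to start from and is fixed
   by [S]. *)
pose S (v : X) : X := if v == 0 then 0 else h (p v).1 (p v).2.+1.
have onh j m : on (h j m) j by apply/asboolP; exists m.
have SX v : X0 v -> X0 (S v).
  move=> Xv; rewrite /S; case: eqP => [|v0]; first by left.
  by right; exists (p v).1.
have S0 : S 0 = 0 by rewrite /S eqxx.
have SE v : v <> 0 -> S v = h (p v).1 (p v).2.+1 by rewrite /S => /eqP/negbTE->.
have iS0 n : iter n S 0 = 0 by elim: n => //= n ->.
have sum0 (g : nat -> X) : (forall n, g n = 0) -> absolutely_summable g.
  by move=> g0; exists 0; apply: (sum_le_le _ (@sum_le0 R nat _)) => n _; rewrite g0 rnorm0.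
have shiftS n v : absolutely_summable (fun k => iter k S (iter n S v)) ->
    absolutely_summable (fun k => iter k S v).
  elim: n => // n IH hn; apply: IH; apply: absolutely_summableS.
  have -> // : (fun k => iter k.+1 S (iter n S v)) = (fun k => iter k S (iter n.+1 S v)).
  by apply/funext => k; rewrite iterSr.
have sumT j m : absolutely_summable (fun n => iter n T (h j m)).
  have [h0 Th _] := bh j; elim: m => [|m IH]; first by rewrite h0.
  apply: absolutely_summableS.
  have -> // : (fun n => iter n.+1 T (h j m.+1)) = (fun n => iter n T (h j m)).
  by apply/funext => n; rewrite iterSr Th.
have sumS j : forall v, v <> 0 -> X0 v -> (p v).1 = j ->
    absolutely_summable (fun n => iter n S v).
  (* If the iterates reach 0 or a vector of smaller index, summability from there on suffices.
     Otherwise the index stays j, the positions on [h j] strictly increase, and the iterates form a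
     subsequence of [h j]. *)
  elim/ltn_ind: j => j IH v v0 Xv pj.
  have XS n : X0 (iter n S v) by elim: n => //= n; exact: SX.
  case: (pselect (exists n : nat, iter n S v = 0 \/ (iter n S v <> 0 /\ ((p (iter n S v)).1 < j)%N))).
    move=> [n [n0|[n0 nj]]]; apply: (shiftS n); first by rewrite n0; exact: sum0.
    exact: IH nj _ n0 (XS n) erefl.
  move=> hn.
  have nz n : iter n S v <> 0 by move=> e; apply: hn; exists n; left.
  have nj n : (j <= (p (iter n S v)).1)%N.
    by rewrite leqNgt; apply/negP => nj; apply: hn; exists n; right.
  have pn n : [/\ h (p (iter n S v)).1 (p (iter n S v)).2 = iter n S v,
      forall i m, h i m = iter n S v -> ((p (iter n S v)).1 <= i)%N &
      forall m, h (p (iter n S v)).1 m = iter n S v -> (m <= (p (iter n S v)).2)%N].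
    by apply: pP => //; case: (XS n) => // /(nz n).
  have Sn n : iter n.+1 S v = h (p (iter n S v)).1 (p (iter n S v)).2.+1.
    by rewrite iterS SE.
  have Jn n : (p (iter n S v)).1 = j.
    elim: n => // n IHn; apply/eqP; rewrite eqn_leq nj andbT -IHn.
    have [_ jmin _] := pn n.+1.
    exact: (jmin _ (p (iter n S v)).2.+1 (esym (Sn n))).
  have Mn n : ((p (iter n S v)).2 < (p (iter n.+1 S v)).2)%N.
    by have [_ _] := pn n.+1; apply; rewrite Jn [RHS]Sn Jn.
  have Minj : injective (fun n => (p (iter n S v)).2).
    move=> i i' /= e.
    by case: (ltngtP i i') => // /(homo_ltn ltn_trans Mn); rewrite e ltnn.
  have [_ _ [c hc]] := bh j; exists c.
  have H := @sum_le_inj R _ _ (fun n => (p (iter n S v)).2) setT _ _ _ _ _ hc.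
  apply: (sum_le_le _ (H _ _)) => // [n _|i i' _ _ /Minj//].
  by have [e _ _] := pn n; rewrite Jn in e; rewrite e.
apply/frequent_criterionP; exists X0, S; split=> //.
  apply/denseP => x e /(dy x)[j hj]; exists (y j) => //; right; exists j.
  by have [<- _ _] := bh j.
move=> v Xv; case: (pselect (v = 0)) => [->|v0].
  split; [|by apply: sum0|by rewrite S0 linear0].
  by apply: sum0 => n; rewrite iter_operator0.
have [//|ej] := Xv; split.
- by have [j /asboolP[m <-]] := ej; exact: sumT.
- exact: sumS v0 Xv erefl.
- have [hv _ _] := pP v v0 ej; have [_ Th _] := bh (p v).1.
  by rewrite SE// Th.
Qed.

Lemma periodic_frequent_criterion : separable X ->
  dense (periodic_points (BT T)) -> frequent_hypercyclicity_criterion T.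
Proof.
move=> sX /denseP dP.
pose D := [set x : X | exists (z : ell1 X) d, [/\ (0 < d)%N, iter d (BT T) z = z & z 0 = x]].
have dD : dense D.
  apply/denseP => x e e0; have [z [d d0 dz] xz] := dP (ell1_single 0 x) e e0.
  exists (z 0); first by exists z, d.
  apply: le_lt_trans xz; rewrite -[x in leLHS](ell1_single_in 0).
  by rewrite -ell1B; exact: ell1_coord_le.
have [y [Dy dy]] := separable_dense_seq sX dD.
have ex j : exists h, absolutely_summable (fun n => iter n T (y j)) /\ backward_orbit (y j) h.
  have [z [d [d0 dz <-]]] := Dy j.
  by have [h1 [h h2]] := periodic_backward_orbit d0 dz; exists h.
have [h hP] := choice ex.
by apply: (@backward_orbits_criterion y h) => // j; have [] := hP j.
Qed.

End PeriodicPoints.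

(** * The scalar field as a separable Banach space *)

Definition scalar_line (R : realType) (F : scalars) : Type := (scalar_field R F)^o.

HB.instance Definition _ (R : realType) (F : scalars) :=
  NormedModule.copy (scalar_line R F) (scalar_field R F)^o.

Section ScalarLine.
Context {R : realType}.

Lemma real_cauchy_lim (u : nat -> R) :
  (forall e, 0 < e -> exists N, forall n, (N <= n)%N -> `|u N - u n| <= e) ->
  exists x, forall e, 0 < e -> exists N, forall n, (N <= n)%N -> `|x - u n| <= e.
Proof. exact: (@rcauchy_rlim R RealScalars R^o u). Qed.

Lemma ler_norm_rnorm_complex (z : scalar_line R ComplexScalars) :
  [/\ `|complex.Re z| <= rnorm z, `|complex.Im z| <= rnorm z &
      rnorm z <= `|complex.Re z| + `|complex.Im z|].
Proof.
have -> : rnorm z = Num.sqrt (complex.Re z ^+ 2 + complex.Im z ^+ 2).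
  by rewrite /rnorm normc_def.
case: z => a b /=; split.
- by rewrite -sqrtr_sqr ler_wsqrtr// lerDl sqr_ge0.
- by rewrite -sqrtr_sqr ler_wsqrtr// lerDr sqr_ge0.
- rewrite -[leRHS]ger0_norm ?addr_ge0// -sqrtr_sqr ler_wsqrtr//.
  by rewrite sqrrD !real_normK ?num_real// lerD2r lerDl mulrn_wge0// mulr_ge0.
Qed.

Lemma scalar_line_complete F (u : nat -> scalar_line R F) :
  rcauchy u -> exists x, rlim u x.
Proof.
case: F u => u cu; first exact: real_cauchy_lim.
have [|a ha] := @real_cauchy_lim (fun n => complex.Re (u n)).
  move=> e /cu[N hN]; exists N => n /hN; have [+ _ _] := ler_norm_rnorm_complex (u N - u n).
  by rewrite raddfB => /le_trans; apply.
have [|b hb] := @real_cauchy_lim (fun n => complex.Im (u n)).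
  move=> e /cu[N hN]; exists N => n /hN; have [_ + _] := ler_norm_rnorm_complex (u N - u n).
  by rewrite raddfB => /le_trans; apply.
exists (Complex a b : scalar_line R ComplexScalars) => e e0.
have e20 : 0 < e / 2 by lra.
have [N hN] := ha _ e20; have [M hM] := hb _ e20; exists (maxn N M) => n.
rewrite geq_max => /andP[/hN h1 /hM h2].
have [_ _] := ler_norm_rnorm_complex ((Complex a b : scalar_line R ComplexScalars) - u n).
by rewrite !raddfB/= => /le_trans; apply; lra.
Qed.

Lemma rat_dense (x e : R) : 0 < e -> exists q : rat, `|x - ratr q| < e.
Proof.
move=> e0; have xe : x - e < x + e by lra.
have [q] := rat_in_itvoo xe; rewrite in_itv/= => /andP[h1 h2]; exists q.
by rewrite ltr_norml; apply/andP; split; lra.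
Qed.

Lemma scalar_line_separable F : separable (scalar_line R F).
Proof.
case: F.
  apply: (@separable_seq R RealScalars (scalar_line R RealScalars)
    (fun n => ratr (odflt 0 (choice.unpickle n)))) => x e /(rat_dense x)[q hq].
  by exists (choice.pickle q); rewrite choice.pickleK.
apply: (@separable_seq R ComplexScalars (scalar_line R ComplexScalars)
  (fun n => let p : rat * rat := odflt (0, 0) (choice.unpickle n) in
     Complex (ratr p.1) (ratr p.2))) => x e e0.
have e20 : 0 < e / 2 by lra.
have [q hq] := rat_dense (complex.Re x) e20.
have [r hr] := rat_dense (complex.Im x) e20.
exists (choice.pickle (q, r)); rewrite choice.pickleK /=.
have [_ _] := ler_norm_rnorm_complex (x - (Complex (ratr q) (ratr r) : scalar_line R ComplexScalars)).
by rewrite !raddfB/= => /le_lt_trans; apply; lra.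
Qed.

End ScalarLine.

HB.instance Definition _ (R : realType) (F : scalars) :=
  Uniform_isComplete.Build (scalar_line R F) (rlim_complete (@scalar_line_complete R F)).

Section ScalarLineNorm.
Context {R : realType} {F : scalars}.
Implicit Types a b : scalar_line R F.

Definition scalar_real (r : R) : scalar_line R F := of_real F r.

Lemma rnorm_scalar_real r : 0 <= r -> rnorm (scalar_real r) = r.
Proof.
by move=> r0; rewrite /rnorm ger0_norm ?of_realK// -of_real0 ler_of_real.
Qed.

Lemma rnorm_scale (X : normedModType (scalar_field R F)) (a : scalar_line R F) (x : X) :
  rnorm ((a : scalar_field R F) *: x) = rnorm a * rnorm x.
Proof. exact: rnormZ. Qed.

End ScalarLineNorm.

(** * A tree operator *)

Section BasisExtension.
Context {R : realType} {F : scalars}.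
Local Notation K := (scalar_field R F).
Local Notation L := (scalar_line R F).

Lemma sum_le_int (f : int -> R) c : sum_le setT f c ->
  sum_le setT (fun n : nat => f n%:Z + f (Negz n)) c.
Proof.
move=> h s us _; rewrite big_split/=.
rewrite -(big_map Posz xpredT) -(big_map Negz xpredT) -big_cat/=; apply: h => //.
rewrite cat_uniq !map_inj_uniq ?us//=; last 2 first.
- by move=> i j [].
- by move=> i j [].
by rewrite andbT; apply/hasPn => _ /mapP[n _ ->]; apply/mapP => -[].
Qed.

Section Extension.
Context {Z : completeNormedModType K}.
Variables (t : int -> Z) (C : R).
Hypotheses (C0 : 0 <= C) (tC : forall k, rnorm (t k) <= C).
Implicit Type x : ell1 L.

(** Pairing the indices [Posz n] and [Negz n] turns the series over [int] into a sequence of partial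
    sums over [nat]. *)
Definition basis_term x (n : nat) : Z :=
  (x n%:Z : K) *: t n%:Z + (x (Negz n) : K) *: t (Negz n).

Lemma basis_term_sum x :
  sum_le setT (fun n => rnorm (basis_term x n)) (C * rnorm x).
Proof.
apply: (sum_le_le _ (sum_le_int (sum_leZ C0 (ell1_sum_le x)))) => n _.
apply: le_trans (ler_rnormD _ _) _; rewrite !rnorm_scale ![rnorm (x _) * _]mulrC.
by rewrite lerD// ler_wpM2r ?rnorm_ge0.
Qed.

Definition basis_ext x : Z :=
  sval (cid (absolutely_summable_rlim (basis_term_sum x))).

Lemma basis_extP x :
  rlim (fun N => \sum_(0 <= n < N) basis_term x n) (basis_ext x).
Proof. exact: (svalP (cid (absolutely_summable_rlim (basis_term_sum x)))). Qed.

Lemma basis_ext_rnorm x : rnorm (basis_ext x) <= C * rnorm x.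
Proof. exact: rlim_sum_le (basis_extP x) (basis_term_sum x). Qed.

Lemma rlimZ (u : nat -> Z) (a : K) z :
  rlim u z -> rlim (fun n => a *: u n) (a *: z).
Proof.
move=> uz e e0; have a0 : 0 < rpart `|a| + 1.
  by rewrite ltr_wpDl// rpart_ge0.
have [N hN] := uz _ (divr_gt0 e0 a0); exists N => n /hN h.
rewrite -scalerBr rnormZ; apply: (@le_trans _ _ ((rpart `|a| + 1) * rnorm (z - u n))).
  by rewrite ler_wpM2r ?rnorm_ge0// lerDl.
by rewrite mulrC -ler_pdivlMr.
Qed.

Lemma basis_ext_linear : linear basis_ext.
Proof.
move=> a x y; apply: rlim_unique (basis_extP _) _.
have h := rlimD (rlimZ a (basis_extP x)) (basis_extP y).
move=> e /h[N hN]; exists N => n /hN; rewrite scaler_sumr -big_split/=.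
congr (rnorm (_ - _) <= _); apply: eq_bigr => i _.
rewrite /basis_term !ell1D !ell1Z scalerDr !scalerA addrACA.
by congr (_ + _); rewrite -scalerDl.
Qed.

HB.instance Definition _ := GRing.isLinear.Build K (ell1 L) Z _ basis_ext
  basis_ext_linear.

Lemma basis_ext_single k (a : L) : basis_ext (ell1_single k a) = (a : K) *: t k.
Proof.
pose n := match k with Posz n => n | Negz n => n end.
have tn : basis_term (ell1_single k a) n = (a : K) *: t k.
  rewrite /basis_term /n; case: k {n} => n.
    by rewrite ell1_single_in ell1_single_out// scale0r addr0.
  by rewrite [X in _ + X *: _]ell1_single_in ell1_single_out// scale0r add0r.
apply/eqP; rewrite -subr_eq0 -tn; apply/eqP/rnorm_eq0/eqP.
rewrite eq_le rnorm_ge0 andbT; apply: rlim_isolate (basis_extP _) _.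
apply: (sum_le_le _ (@sum_le0 R nat _)) => i /= ni.
rewrite /basis_term !ell1_single_out ?scale0r ?addr0 ?rnorm0//.
  by apply/eqP => e; apply: ni; rewrite /n -e.
by apply/eqP => e; apply: ni; rewrite /n -e.
Qed.

End Extension.

Section Operator.
Context {X : completeNormedModType K}.
Variables (t : int -> ell1 X) (C : R).
Hypotheses (C0 : 0 <= C) (tC : forall k, rnorm (t k) <= C).

Lemma basis_ext_coord (x : ell1 L) k c :
  sum_le setT (fun l => rnorm (x l) * rnorm (t l k)) c ->
  rnorm (basis_ext C0 tC x k) <= c.
Proof.
move=> h; apply: (@rlim_sum_le _ _ _ (fun n => basis_term t x n k)).
  move=> e /(basis_extP C0 tC x)[N hN]; exists N => n /hN.
  by apply: le_trans; rewrite -ell1_sum -ell1B; exact: ell1_coord_le.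
apply: (sum_le_le _ (sum_le_int h)) => n _; rewrite /basis_term ell1D !ell1Z.
by apply: le_trans (ler_rnormD _ _) _; rewrite !rnorm_scale.
Qed.

End Operator.

Lemma basis_operator (t : int -> ell1 L) (C : R) :
  0 <= C -> (forall k, rnorm (t k) <= C) ->
  exists T : 'L(ell1 L), (forall k a, T (ell1_single k a) = (a : K) *: t k) /\
    forall (x : ell1 L) k c, sum_le setT (fun l => rnorm (x l) * rnorm (t l k)) c ->
      rnorm (T x k) <= c.
Proof.
move=> C0 tC.
have bf : bounded_near (basis_ext C0 tC) (nbhs (0 : ell1 L)).
  by apply: (@bounded_near0_rnorm R F (ell1 L) (basis_ext C0 tC) C) => x; exact: basis_ext_rnorm.
exists (BoundedOperator bf); split=> [k a|x k c h].
  exact: (basis_ext_single C0 tC).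
exact: (basis_ext_coord C0 tC).
Qed.

End BasisExtension.

(** The maps [i] and [g] certify that [V] is infinite, hence equipotent to [int], the index set of
    [ell1]. *)
Lemma countable_bijective_int (V : countType) (i : nat -> V) (g : V -> nat) :
  cancel i g -> exists f : V -> int, bijective f.
Proof.
have card_nat (W : countType) (j : nat -> W) (h : W -> nat) : cancel j h ->
    exists f : W -> nat, bijective f.
  move=> jh; have /eq_card_nat : countable [set: W] by exact: countableP.
  move=> /(_ _)/card_set_bijP[|f]; last by rewrite setTT_bijective; exists f.
  apply/infiniteP; rewrite (_ : [set: nat] = h @` [set: W]); first exact: card_image_le.
  by apply/esym/seteqP; split=> // n _; exists (j n).
move=> /card_nat[f1 bf1]; have [|f2 [g2 f2K g2K]] := card_nat int Posz absz.
  by [].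
exists (g2 \o f1); apply: bij_comp => //; by exists f2.
Qed.

Lemma le_esum_sum_le {R : realType} (I : choiceType) (D : set I) (h : I -> R) w :
  (forall i, 0 <= h i) -> (forall c, sum_le D h c -> w <= c) ->
  (w%:E <= \esum_(i in D) (h i)%:E)%E.
Proof.
move=> h0 hw; have : (0 <= \esum_(i in D) (h i)%:E)%E.
  by apply: esum_ge0 => i _; rewrite lee_fin.
case e : (\esum_(i in D) (h i)%:E)%E => [r| |] // _; last exact: leey.
by rewrite lee_fin; apply/hw/sum_leP; rewrite e.
Qed.

Section Tree.
Context {R : realType} {F : scalars}.
Local Notation K := (scalar_field R F).
Local Notation L := (scalar_line R F).

(* [inl s] is the root indexed by [s]; [inr (s, a, b)] is the point at distance
   [a.+1] from the root [s] on a path of length [a + b + 1] below it, whose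
   other end is fed by the root [(a + b) :: s]. *)
Definition tree_node := (seq nat + seq nat * nat * nat)%type.

Definition tree_parent (v : tree_node) : option tree_node :=
  match v with
  | inl [::] => None
  | inl (m :: s) => Some (inr (s, m, 0%N))
  | inr (s, a, b) =>
      if a is a'.+1 then Some (inr (s, a', b.+1)) else Some (inl s)
  end.

(** The weight [2 ^- m.+1] cancels the m + 1 factors 2 of the path leading from [inl (m :: s)] to
    [inl s]: m + 2 steps send one basis vector exactly to the other. *)
Definition tree_weight (v : tree_node) : R :=
  match v with
  | inl [::] => 0
  | inl (m :: s) => 2 ^- m.+1
  | inr _ => 2
  end.

Lemma tree_weight_ge0 v : 0 <= tree_weight v.
Proof. by case: v => [[|m s]|[[s a] b]] //=; exact/ltW/half_pow_gt0. Qed.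

Lemma tree_weight_le2 v : tree_weight v <= 2.
Proof.
case: v => [[|m s]|[[s a] b]] //=.
by apply: le_trans (half_pow_le R (leq0n _)) _; rewrite expr0 invr1 ler1n.
Qed.

Variables (f : tree_node -> int) (g : int -> tree_node).
Hypotheses (fK : cancel f g) (gK : cancel g f).

Definition tree_image (k : int) : ell1 L :=
  if tree_parent (g k) is Some p
  then ell1_single (f p) (scalar_real (tree_weight (g k))) else 0.

Lemma tree_image_le k : rnorm (tree_image k) <= 2.
Proof.
rewrite /tree_image; case: tree_parent => [p|]; last by rewrite rnorm0.
apply: le_trans (ell1_single_le _ _) _.
by rewrite rnorm_scalar_real ?tree_weight_ge0// tree_weight_le2.
Qed.

Variable T : 'L(ell1 L).
Hypothesis Tsingle : forall k a, T (ell1_single k a) = (a : K) *: tree_image k.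
Hypothesis Tcoord : forall (x : ell1 L) k c,
  sum_le setT (fun l => rnorm (x l) * rnorm (tree_image l k)) c ->
  rnorm (T x k) <= c.

Definition tree_basis (v : tree_node) : ell1 L := ell1_single (f v) (scalar_real 1).

Lemma tree_basis_le v : rnorm (tree_basis v) <= 1.
Proof.
by apply: le_trans (ell1_single_le _ _) _; rewrite rnorm_scalar_real.
Qed.

Lemma ell1_single_scale (k : int) (a : L) :
  ell1_single k a = (a : K) *: ell1_single k (scalar_real 1 : L).
Proof.
apply: ell1_ext => l; rewrite ell1Z !ell1_singleE; case: eqP => _.
  by rewrite /scalar_real of_real1 [RHS]mulr1.
by rewrite scaler0.
Qed.

Lemma tree_basisE v p : tree_parent v = Some p ->
  T (tree_basis v) = of_real F (tree_weight v) *: tree_basis p.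
Proof.
move=> vp; rewrite Tsingle /tree_image fK vp /scalar_real of_real1 scale1r.
exact: ell1_single_scale.
Qed.

Lemma tree_basis_path s a b : T (tree_basis (inr (s, a.+1, b))) =
  of_real F 2 *: tree_basis (inr (s, a, b.+1)).
Proof. exact: (@tree_basisE (inr (s, a.+1, b)) (inr (s, a, b.+1))). Qed.

Lemma tree_basis_path0 s b : T (tree_basis (inr (s, 0%N, b))) =
  of_real F 2 *: tree_basis (inl s).
Proof. exact: (@tree_basisE (inr (s, 0%N, b)) (inl s)). Qed.

Lemma tree_basis_root m s : T (tree_basis (inl (m :: s))) =
  of_real F (2 ^- m.+1) *: tree_basis (inr (s, m, 0%N)).
Proof. exact: (@tree_basisE (inl (m :: s)) (inr (s, m, 0%N))). Qed.

Lemma tree_basis_root_nil : T (tree_basis (inl [::])) = 0.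
Proof. by rewrite Tsingle /tree_image fK scaler0. Qed.

Let TZ (a : K) y : T (a *: y) = a *: T y.
Proof. exact: (iter_operatorZ T 1). Qed.

Lemma iter_tree_path s a b j : (j <= a)%N ->
  iter j T (tree_basis (inr (s, a, b))) =
  of_real F (2 ^+ j) *: tree_basis (inr (s, (a - j)%N, (b + j)%N)).
Proof.
elim: j => [|j IH] ja; first by rewrite expr0 of_real1 scale1r subn0 addn0.
rewrite iterS IH; last exact: ltnW.
rewrite TZ; have -> : (a - j = (a - j.+1).+1)%N by lia.
by rewrite tree_basis_path scalerA -of_realM -exprSr -addnS.
Qed.

Lemma iter_tree_path_root s a b :
  iter a.+1 T (tree_basis (inr (s, a, b))) =
  of_real F (2 ^+ a.+1) *: tree_basis (inl s).
Proof.
rewrite iterS iter_tree_path// subnn TZ tree_basis_path0.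
by rewrite scalerA -of_realM -exprSr.
Qed.

Lemma iter_tree_root m s :
  iter m.+2 T (tree_basis (inl (m :: s))) = tree_basis (inl s).
Proof.
rewrite iterSr tree_basis_root iter_operatorZ iter_tree_path_root scalerA -of_realM.
by rewrite /= mulVf ?of_real1 ?scale1r// gt_eqF// exprn_gt0.
Qed.

Lemma summable_iterT q (y : ell1 L) :
  absolutely_summable (fun n => iter n T (iter q T y)) ->
  absolutely_summable (fun n => iter n T y).
Proof.
elim: q y => // q IH y h; apply: absolutely_summableS.
have -> : (fun n => iter n.+1 T y) = (fun n => iter n T (T y)).
  by apply/funext => n; rewrite iterSr.
apply: IH; have -> // : (fun n => iter n T (iter q T (T y))) = (fun n => iter n T (iter q.+1 T y)).
by apply/funext => n; rewrite -iterSr.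
Qed.

Lemma tree_root_summable s : absolutely_summable (fun n => iter n T (tree_basis (inl s))).
Proof.
elim: s => [|m s IH].
  apply: (@summable_iterT 1) => /=; rewrite tree_basis_root_nil; exists 0.
  by apply: (sum_le_le _ (@sum_le0 R nat _)) => n _; rewrite iter_operator0 rnorm0.
by apply: (@summable_iterT m.+2); rewrite iter_tree_root.
Qed.

Lemma rnorm_of_realZ_le (a : R) (x : ell1 L) : 0 <= a -> rnorm x <= 1 ->
  rnorm (of_real F a *: x) <= a.
Proof. by move=> a0 x1; rewrite rnorm_of_realZ// ler_piMr. Qed.

(** The preimage of order i is [2 ^- i] times the far end of the path of length i below s. Distinct
    orders use distinct paths, so these vectors do not form a backward orbit, but n steps bring each
    to norm at most [2 ^- (i - n)]. *)
Lemma tree_root_backward s : backward_summable T (tree_basis (inl s)).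
Proof.
split; first exact: tree_root_summable.
exists (fun i => if i is i'.+1 then of_real F (2 ^- i) *: tree_basis (inr (s, i', 0%N))
                 else tree_basis (inl s)).
exists (fun i => 2 ^- i).
have pw n i : (n <= i)%N -> 2 ^- i * 2 ^+ n = 2 ^- (i - n) :> R.
  by move=> ni; rewrite -{1}(subnK ni) exprD invfM -mulrA mulVf ?mulr1.
have top n : iter n T (if n is i'.+1 then of_real F (2 ^- n) *: tree_basis (inr (s, i', 0%N))
    else tree_basis (inl s)) = tree_basis (inl s).
  case: n => // n; rewrite iter_operatorZ iter_tree_path_root scalerA -of_realM.
  by rewrite pw// subnn expr0 invr1 of_real1 scale1r.
split=> //.
- exists (2 * 2 ^- 0); apply: (sum_le_le _ (sum_le_geometric 0)) => n _.
  by rewrite addn0.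
- move=> n i; rewrite leq_eqVlt => /predU1P[->|ni].
    by rewrite top subnn expr0 invr1 tree_basis_le.
  case: i ni => // i; rewrite ltnS => ni.
  rewrite iter_operatorZ iter_tree_path// scalerA -of_realM pw 1?ltnW//.
  by apply: rnorm_of_realZ_le; [apply: ltW; exact: half_pow_gt0|exact: tree_basis_le].
Qed.

Lemma backward_summableZ a y : backward_summable T y -> backward_summable T (a *: y).
Proof.
by move=> h; rewrite -[a *: y]addr0; apply: backward_summable_linear h (backward_summable0 T).
Qed.

(** An interior point of a path is a nonzero multiple of an iterate of the root feeding that
    path. *)
Lemma tree_basis_backward v : backward_summable T (tree_basis v).
Proof.
case: v => [s|[[s a] b]]; first exact: tree_root_backward.
have e : iter b.+1 T (tree_basis (inl ((a + b)%N :: s))) =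
    of_real F (2 ^- (a + b).+1 * 2 ^+ b) *: tree_basis (inr (s, a, b)).
  rewrite iterSr tree_basis_root iter_operatorZ iter_tree_path ?leq_addl//.
  by rewrite addnK scalerA -of_realM.
have c0 : (2 ^- (a + b).+1 * 2 ^+ b : R) != 0.
  by rewrite mulf_neq0// ?invr_eq0 expf_neq0.
have -> : tree_basis (inr (s, a, b)) = of_real F (2 ^- (a + b).+1 * 2 ^+ b)^-1 *:
    iter b.+1 T (tree_basis (inl ((a + b)%N :: s))).
  by rewrite e scalerA -of_realM mulVf// of_real1 scale1r.
exact/backward_summableZ/backward_summable_preimage/tree_root_backward.
Qed.

Lemma tree_lower_dense_criterion : lower_dense_hypercyclicity_criterion T.
Proof.
apply: backward_summable_criterion; apply/denseP => x e e0.
have dT : dense [set: L].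
  by apply/denseP => z d d0; exists z => //; rewrite subrr rnorm0.
have [s [y [_ _ h]]] := ell1_dense_finite x dT e0.
exists (\sum_(k <- s) ell1_single k (y k)) => //.
elim: s {h} => [|k s IH]; first by rewrite big_nil; exact: backward_summable0.
rewrite big_cons ell1_single_scale; apply: backward_summable_linear IH.
by rewrite -[k]gK; exact: tree_basis_backward.
Qed.

Lemma tree_coord (x : ell1 L) p c :
  sum_le [set v | tree_parent v = Some p]
    (fun v => tree_weight v * rnorm (x (f v))) c -> rnorm (T x (f p)) <= c.
Proof.
move=> h; apply: Tcoord.
apply: (@sum_le_supp _ _ _ [set l | tree_parent (g l) = Some p]) => [l _ /= lp|].
  rewrite /tree_image; case e: tree_parent lp => [q|] lp; last by rewrite rnorm0 mulr0.
  rewrite ell1_single_out ?rnorm0 ?mulr0//; apply/eqP => /(can_inj fK) pq.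
  by apply: lp; rewrite pq.
rewrite setTI.
have H := @sum_le_inj R _ _ g [set l | tree_parent (g l) = Some p] _ _ _ _ _ h.
apply: (sum_le_le _ (H _ _)) => // [l /= lp|i j _ _ /(can_inj gK)//].
rewrite /tree_image lp gK ell1_single_in rnorm_scalar_real ?tree_weight_ge0//.
by rewrite mulrC.
Qed.

(** * Backward orbits in the tree vanish at the initial root *)

Section History.
Variable x : nat -> ell1 L.
Hypothesis Tx : forall n, T (x n.+1) = x n.

Let W n s := rnorm (x n (f (inl s))).
Let P n s a b := rnorm (x n (f (inr (s, a, b)))).

Lemma tree_coord1 n p v : (forall v', tree_parent v' = Some p -> v' = v) ->
  rnorm (x n (f p)) <= tree_weight v * rnorm (x n.+1 (f v)).
Proof.
move=> pv; rewrite -Tx; apply: tree_coord => s us sp.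
have pvs i : i \in s -> i = v by move=> /sp /pv.
have [|s2] := leqP (size s) 1.
  case: s us sp pvs => [|v' []]// _ sp pvs _.
    by rewrite big_nil mulr_ge0 ?rnorm_ge0 ?tree_weight_ge0.
  by rewrite big_seq1 (pvs v')// mem_head.
case: s us sp s2 pvs => [|v1 [|v2 s]]// + _ _ pvs.
have e1 : v1 = v by apply: pvs; exact: mem_head.
have e2 : v2 = v by apply: pvs; rewrite !inE eqxx orbT.
by rewrite e1 e2 /= inE eqxx.
Qed.

Let path_le n s a b :
  P n s a b <= 2 ^+ b * 2 ^- (a + b).+1 * W (n + b).+1 ((a + b)%N :: s).
Proof.
elim: b n a => [|b IH] n a.
  rewrite expr0 mul1r !addn0; apply: (@tree_coord1 n _ (inl (a :: s))).
  by move=> [[|m s']|[[s' [|a']] b']]//= -[-> ->].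
apply: (@le_trans _ _ (2 * P n.+1 s a.+1 b)).
  apply: (@tree_coord1 n _ (inr (s, a.+1, b))).
  by move=> [[|m s']|[[s' [|a']] b']]//= -[-> -> ->].
by rewrite -!addSnnS exprS -!mulrA ler_wpM2l// mulrA.
Qed.

(** The weights on the branch from [b :: s] to s have product 1, so the mass at s at time n is at
    most the total mass at the roots [b :: s] at times n + b + 2. *)
Let root_le n s c :
  sum_le setT (fun b => W (n + b).+2 (b :: s)) c -> W n s <= c.
Proof.
move=> h; rewrite /W -Tx; apply: tree_coord.
pose br (v : tree_node) : nat := if v is inr (_, _, b) then b else 0%N.
have H := @sum_le_inj R _ _ br [set v | tree_parent v = Some (inl s)] _ _ _ _ _ h.
have par v : tree_parent v = Some (inl s) -> v = inr (s, 0%N, br v).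
  by case: v => [[|m s']|[[s' [|a']] b']]//= -[->].
apply: (sum_le_le _ (H _ _)) => // [v /par ->|i j /par -> /par -> /= ->]//.
have := path_le n.+1 s 0 (br v); rewrite !add0n addSn /=.
have -> : 2 ^+ br v * 2 ^- (br v).+1 = 2^-1 :> R.
  by rewrite exprS invfM mulrCA mulfV ?mulr1// gt_eqF// exprn_gt0.
rewrite -/(P n.+1 s 0 (br v)); lra.
Qed.

(** Pairs of a time and a root of level l. Moving up one level adds at least two to the time, so
    times at least l are the only ones met; there the history is small. *)
Let D l : set (nat * seq nat) := [set p | size p.2 = l /\ (l <= p.1)%N].

(** Applying [root_le] to all pairs of level l produces pairs [((n + b).+2, b :: s)] of level l + 1,
    each at most once, since b and s can be read off. So the sums over levels cannot decrease. *)
Let level_step l c :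
  sum_le (D l.+1) (fun p => W p.1 p.2) c -> sum_le (D l) (fun p => W p.1 p.2) c.
Proof.
have W0 n s : 0 <= W n s by exact: rnorm_ge0.
move=> h; apply/sum_leP.
apply: (@le_trans _ _ (\esum_(p in D l) \esum_(b in [set: nat])
    (W (p.1 + b).+2 (b :: p.2))%:E)%E).
  apply: le_esum => p _; apply: le_esum_sum_le => // c'; exact: root_le.
rewrite esum_esum; last by move=> p b _ _; rewrite lee_fin.
apply/(@sum_leP R _ _ (fun k : (nat * seq nat) * nat => W (k.1.1 + k.2).+2 (k.2 :: k.1.2))).
apply: (sum_le_inj (h := fun k : (nat * seq nat) * nat => ((k.1.1 + k.2).+2, k.2 :: k.1.2))) h.
  move=> [[n s] b] [[n' s'] b'] _ _ /= [e1 e2 ->].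
  by move: e1; rewrite e2 => /eqP; rewrite eqn_add2r => /eqP->.
by move=> [[n s] b] [[/= sl ln] _]; split=> /=; [rewrite sl|lia].
Qed.

(** At a fixed time distinct roots are distinct coordinates, so the sum over level N is at most the
    tail of the norms from time N on. It dominates the sum over level 0, which contains the initial
    root at time 0. *)
Lemma tree_history_root : absolutely_summable x -> x 0%N (f (inl [::])) = 0.
Proof.
move=> [c hc]; apply/rnorm_eq0/eqP; rewrite eq_le rnorm_ge0 andbT.
apply/ler_addgt0Pr => e e0; rewrite add0r.
have [N hN] := sum_le_tailn (fun n => rnorm_ge0 (x n)) hc e0.
have down l : sum_le (D l) (fun p => W p.1 p.2) e -> rnorm (x 0%N (f (inl [::]))) <= e.
  elim: l => [|l IH]; last by move=> /level_step.
  by move=> h; exact: (sum_le1 (i := (0%N, [::])) _ h).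
apply: (down N).
apply: (@sum_le_partition _ _ _ (fun p : nat * seq nat => p.1) _
  (fun n => if (N <= n)%N then rnorm (x n) else 0)).
  move=> j; case: ifPn => Nj; last first.
    apply: (sum_le_le (g := fun=> 0)) (@sum_le0 R _ _) => p [[_ Np] pj].
    by move: Nj; rewrite -pj Np.
  have H := @sum_le_inj R _ _ (fun p : nat * seq nat => f (inl p.2))
    [set p | D N p /\ p.1 = j] _ _ _ _ _ (ell1_sum_le (x j)).
  apply: (sum_le_le _ (H _ _)) => //; first by move=> [n s] /= [_ ->].
  by move=> [n s] [n' s'] [_ /= ->] [_ /= ->] /(can_inj fK)[->].
apply: (@sum_le_supp _ _ _ [set n | (N <= n)%N]) => [n _ /negP/negbTE->//|].
apply: (sum_le_le _ (sum_le_sub _ hN)) => [n [_ /= ->]//|n [_ Nn]]; split=> //.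
Qed.

End History.

(** A vector with a summable backward orbit is zero at the initial root, hence at distance at least
    1 from the basis vector there. *)
Lemma tree_not_frequent_criterion : ~ frequent_hypercyclicity_criterion T.
Proof.
move=> /frequent_criterionP[X0 [S [/denseP dX0 SX0 h]]].
have [x X0x] := dX0 (tree_basis (inl [::])) 1 ltr01.
have [_ sS _] := h x X0x.
have SX n : X0 (iter n S x) by elim: n => //= n; exact: SX0.
have Tx n : T (iter n.+1 S x) = iter n S x by have [_ _] := h _ (SX n).
have x0 := tree_history_root Tx sS.
apply/negP; rewrite -leNgt.
apply: le_trans (ell1_coord_le _ (f (inl [::]))).
by rewrite ell1B ell1_single_in [x _]x0 subr0 rnorm_scalar_real.
Qed.

End Tree.

Lemma tree_counterexample (R : realType) (F : scalars) :
  exists T : 'L(ell1 (scalar_line R F)),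
    lower_dense_hypercyclicity_criterion T /\ ~ frequent_hypercyclicity_criterion T.
Proof.
have [|f [g fK gK]] := @countable_bijective_int tree_node (fun n => inr ([::], n, 0%N))
  (fun v => if v is inr (_, a, _) then a else 0%N).
  by [].
have [T [Ts Tc]] := basis_operator (ler0n R 2) (@tree_image_le R F f g).
by exists T; split; [exact: tree_lower_dense_criterion Ts|exact: tree_not_frequent_criterion Tc].
Qed.

(** * A weighted shift on null sequences *)

Section C0.
Variables (R : realType) (F : scalars).
Local Notation K := (scalar_field R F).
Local Notation L := (scalar_line R F).

Definition null_sequence (x : nat -> L) : Prop :=
  forall e : R, 0 < e -> exists N, forall n, (N <= n)%N -> rnorm (x n) <= e.

Definition c0_pred : {pred nat -> L} := fun x => `[<null_sequence x>].

Record c0 := C0 { c0_val :> nat -> L; _ : c0_val \in c0_pred }.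

HB.instance Definition _ := [isSub for c0_val].
HB.instance Definition _ := [Choice of c0 by <:].

Lemma c0_submod_closed : submod_closed c0_pred.
Proof.
split=> [|a x y /asboolP x0 /asboolP y0].
  by apply/asboolP => e e0; exists 0%N => n _; rewrite rnorm0 ltW.
apply/asboolP => e e0; have a0 : 0 < rpart `|a| + 1.
  by rewrite ltr_wpDl// rpart_ge0.
have e20 : 0 < e / 2 by lra.
have [N hN] := x0 _ (divr_gt0 e20 a0); have [M hM] := y0 _ e20.
exists (maxn N M) => n; rewrite geq_max => /andP[/hN h1 /hM h2].
rewrite (splitr e); apply: le_trans (ler_rnormD _ _) _; rewrite lerD//.
rewrite rnormZ; apply: (@le_trans _ _ ((rpart `|a| + 1) * rnorm (x n))).
  by rewrite ler_wpM2r ?rnorm_ge0// lerDl.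
by rewrite mulrC -ler_pdivlMr.
Qed.

HB.instance Definition _ := GRing.isSubmodClosed.Build _ _ c0_pred
  c0_submod_closed.
HB.instance Definition _ := [SubChoice_isSubLmodule of c0 by <:].

Implicit Types x y : c0.

Lemma c0_null x : null_sequence x.
Proof. by case: x => x /= /asboolP. Qed.

Definition c0_sup x : R := sup (range (fun n => rnorm (x n))).

Lemma c0_sup_ge x n : rnorm (x n) <= c0_sup x.
Proof.
apply: ub_le_sup; last by exists n.
have [N hN] := c0_null x ltr01.
exists (1 + \sum_(0 <= i < N) rnorm (x i)) => _ [m _ <-].
have s0 : 0 <= \sum_(0 <= i < N) rnorm (x i) by rewrite sumr_ge0// => i _; exact: rnorm_ge0.
have [Nm|mN] := leqP N m; first by have := hN m Nm; lra.
rewrite (bigD1_seq m) ?mem_index_iota ?iota_uniq//= addrCA lerDl addr_ge0//.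
by rewrite sumr_ge0// => i _; exact: rnorm_ge0.
Qed.

Lemma c0_sup_le x c : (forall n, rnorm (x n) <= c) -> c0_sup x <= c.
Proof.
move=> h; apply: ge_sup; first by exists (rnorm (x 0%N)); exists 0%N.
by move=> _ [n _ <-].
Qed.

Definition c0_norm x : K := of_real F (c0_sup x).

Lemma c0_normD x y : c0_norm (x + y) <= c0_norm x + c0_norm y.
Proof.
rewrite /c0_norm -of_realD ler_of_real; apply: c0_sup_le => n.
by apply: le_trans (ler_rnormD _ _) _; rewrite lerD// c0_sup_ge.
Qed.

Lemma c0_normZ_le (a : K) x : c0_norm (a *: x) <= `|a| * c0_norm x.
Proof.
rewrite /c0_norm -(rpartK (normr_ge0 a)) -of_realM ler_of_real; apply: c0_sup_le => n.
by rewrite [_ n]/(a *: x n) rnormZ ler_wpM2l ?rpart_ge0// c0_sup_ge.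
Qed.

Lemma c0_norm_ge0 x : 0 <= c0_norm x.
Proof.
by rewrite -of_real0 ler_of_real; apply: le_trans (c0_sup_ge x 0%N); exact: rnorm_ge0.
Qed.

Lemma c0_normZ (a : K) x : c0_norm (a *: x) = `|a| * c0_norm x.
Proof.
apply/eqP; rewrite eq_le c0_normZ_le/=.
have [->|a0] := eqVneq a 0; first by rewrite normr0 mul0r c0_norm_ge0.
rewrite -{1}[x](scalerK a0) -ler_pdivlMl ?normr_gt0// -normfV.
exact: c0_normZ_le.
Qed.

Lemma c0_norm0_eq0 x : c0_norm x = 0 -> x = 0.
Proof.
rewrite -of_real0 => /(congr1 (@rpart R F)); rewrite !of_realK => x0.
apply/val_inj/funext => n /=; apply/rnorm_eq0/eqP.
by rewrite eq_le rnorm_ge0 andbT -x0 c0_sup_ge.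
Qed.

HB.instance Definition _ := Lmodule_isNormed.Build K c0
  c0_normD c0_normZ c0_norm0_eq0.

Lemma c0_rnorm_leP x c : rnorm x <= c <-> forall n, rnorm (x n) <= c.
Proof.
have -> : rnorm x = c0_sup x by rewrite /rnorm {1}/Num.norm/= /c0_norm of_realK.
split=> [h n|]; last exact: c0_sup_le.
by apply: le_trans h; exact: c0_sup_ge.
Qed.

Lemma c0_coord_le x n : rnorm (x n) <= rnorm x.
Proof. by have /c0_rnorm_leP := lexx (rnorm x). Qed.

Lemma c0B x y n : (x - y) n = x n - y n. Proof. by []. Qed.

Lemma c0_mk (f : nat -> L) : null_sequence f -> {x : c0 | c0_val x = f}.
Proof. by move=> /asboolP h; exists (C0 h). Qed.

Lemma c0_rcauchy_rlim (u : nat -> c0) : rcauchy u -> exists x, rlim u x.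
Proof.
move=> cu.
have ch k : exists v, rlim (fun n => u n k) v.
  apply: rcauchy_rlim => e /cu[N hN]; exists N => n /hN.
  by apply: le_trans; rewrite -c0B; exact: c0_coord_le.
have [x xP] := choice ch.
have close e N : (forall n, (N <= n)%N -> rnorm (u N - u n) <= e) ->
    forall k, rnorm (u N k - x k) <= e.
  move=> hN k; rewrite rnormB; apply: rlim_le (xP k) _.
  exists N => n /hN h; rewrite rnormB; apply: le_trans h.
  by rewrite -c0B; exact: c0_coord_le.
have [|z zx] := @c0_mk x.
  move=> e e0; have e20 : 0 < e / 2 by lra.
  have [N /close hN] := cu _ e20; have [M hM] := c0_null (u N) e20.
  exists M => n /hM h; rewrite -(subKr (u N n) (x n)).
  by apply: le_trans (ler_rnormB _ _) _; rewrite (splitr e) lerD.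
exists z => e e0; have e20 : 0 < e / 2 by lra.
have [N hN] := cu _ e20; exists N => n /hN hn.
apply: le_trans (rnorm_triangle (u N) _ _) _; rewrite (splitr e) lerD//.
rewrite rnormB; apply/c0_rnorm_leP => k; rewrite c0B zx.
exact: close hN k.
Qed.

HB.instance Definition _ := Uniform_isComplete.Build c0
  (rlim_complete c0_rcauchy_rlim).

End C0.

Section WeightedShift.
Context {R : realType} {F : scalars}.
Local Notation K := (scalar_field R F).
Local Notation L := (scalar_line R F).
Local Notation c0 := (c0 R F).
Implicit Types x y : c0.

(** The weights telescope: those at p, ..., p + n - 1 have product (p + n + 1) / (p + 1), largest at
    p = 0. *)
Definition shift_weight (p : nat) : R := p.+2%:R / p.+1%:R.

Lemma shift_weight_ge0 p : 0 <= shift_weight p.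
Proof. by rewrite divr_ge0. Qed.

Lemma shift_weight_le2 p : shift_weight p <= 2.
Proof. by rewrite ler_pdivrMr ?ltr0n// -natrM ler_nat; lia. Qed.

Definition weighted_shift_fun (x : nat -> L) (p : nat) : L :=
  of_real F (shift_weight p) *: x p.+1.

Lemma weighted_shift_null x : null_sequence (weighted_shift_fun x).
Proof.
move=> e e0; have e20 : 0 < e / 2 by lra.
have [N hN] := c0_null x e20; exists N => n Nn.
rewrite rnorm_of_realZ ?shift_weight_ge0//.
have := hN n.+1 (leqW Nn); have := shift_weight_le2 n; have := shift_weight_ge0 n.
have := rnorm_ge0 (x n.+1); nra.
Qed.

Definition weighted_shift x : c0 := sval (c0_mk (weighted_shift_null x)).

Lemma weighted_shiftE x p :
  weighted_shift x p = of_real F (shift_weight p) *: x p.+1.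
Proof. by rewrite /weighted_shift (svalP (c0_mk _)). Qed.

Lemma weighted_shift_linear : linear weighted_shift.
Proof.
move=> a x y; apply/val_inj/funext => p /=; rewrite weighted_shiftE.
rewrite [RHS]/(a *: weighted_shift x p + weighted_shift y p) !weighted_shiftE.
by rewrite scalerDr !scalerA mulrC.
Qed.

HB.instance Definition _ := GRing.isLinear.Build K c0 c0 _ weighted_shift
  weighted_shift_linear.

Lemma weighted_shift_bounded : bounded_near weighted_shift (nbhs (0 : c0)).
Proof.
apply: (@bounded_near0_rnorm R F c0 weighted_shift 2) => x.
apply/c0_rnorm_leP => p; rewrite [_ p]weighted_shiftE rnorm_of_realZ ?shift_weight_ge0//.
by apply: ler_pM; rewrite ?shift_weight_ge0 ?rnorm_ge0 ?shift_weight_le2 ?c0_coord_le.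
Qed.

Definition weighted_shift_op : 'L(c0) := BoundedOperator weighted_shift_bounded.

Lemma iter_weighted_shift n x p : iter n weighted_shift_op x p =
  of_real F ((p + n).+1%:R / p.+1%:R) *: x (p + n)%N.
Proof.
elim: n p => [|n IH] p; first by rewrite addn0 divff// of_real1 scale1r.
rewrite iterS [LHS]weighted_shiftE IH scalerA -of_realM addSnnS; congr (of_real F _ *: _).
by rewrite /shift_weight mulrC mulrA divfK.
Qed.

Lemma iter_weighted_shift_le n x :
  rnorm (iter n weighted_shift_op x) <= n.+1%:R * rnorm x.
Proof.
apply/c0_rnorm_leP => p; rewrite iter_weighted_shift rnorm_of_realZ ?divr_ge0//.
apply: ler_pM; rewrite ?divr_ge0 ?rnorm_ge0 ?c0_coord_le//.
by rewrite ler_pdivrMr ?ltr0n// -natrM ler_nat; nia.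
Qed.

Definition c0_delta : nat -> L := fun p => if p is 0%N then scalar_real 1 else 0.

Lemma c0_nontrivial : exists x, 1 <= rnorm x.
Proof.
have [|x xE] := @c0_mk R F c0_delta.
  by move=> e e0; exists 1%N => -[|n]// _; rewrite rnorm0 ltW.
exists x; apply: le_trans (c0_coord_le x 0%N).
by rewrite xE /= rnorm_scalar_real.
Qed.

(* [S_n y] has norm at least of the order of [1 / n] for [n] in [A k], which is
   not summable over a set of positive lower density. *)
Lemma weighted_shift_no_criterion :
  ~ lower_dense_hypercyclicity_criterion weighted_shift_op.
Proof.
move=> /lower_dense_criterionP[Y0 [S [A [/denseP dY0 lA _ tailA _ diagA]]]].
have [x x1] := c0_nontrivial.
have [y Yy xy] := dY0 x 2^-1 (ltac:(by rewrite invr_gt0)).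
have y1 : 2^-1 <= rnorm y.
  by have := ler_rnorm_dist x y; lra.
(* Since y has norm at least 1/2, an error of 1/4 leaves norm at least 1/4 for the image of [S n y],
   hence at least 1 / (4 (n + 1)) for [S n y] itself. *)
have [k0 hk] := diagA y Yy 4^-1 (ltac:(by rewrite invr_gt0)).
have [N hN] := tailA y Yy 1 ltr01.
pose k := k0.+1.
apply: (@lower_dense_harmonic R (A k) (\sum_(n <- undup (iota 0 N)) n.+1%:R^-1 + 4 * 1) (lA k _)) => //.
apply: (@sum_le_sub _ _ ([set` iota 0 N] `|` [set n | A k n /\ (N <= n)%N])).
  move=> n An /=; have [Nn|nN] := leqP N n; [by right|left].
  by rewrite mem_iota.
apply: sum_leU => //; first exact: sum_le_seq.
have h4 : (0 : R) <= 4 by [].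
apply: (sum_le_le _ (sum_leZ h4 (hN k isT))) => n [An _].
have := hk k n (leqnSn _) An.
have := iter_weighted_shift_le n (S n y).
have := ler_rnorm_dist y (iter n weighted_shift_op (S n y)); rewrite rnormB => h1 h2 h3.
have n0 : 0 < n.+1%:R :> R by rewrite ltr0n.
rewrite -div1r ler_pdivrMr//; lra.
Qed.

(** * Building a frequently hypercyclic vector from blocks *)

Section FrequentlyHypercyclic.
Variable d : nat -> L.
Hypothesis dd : forall (x : L) (e : R), 0 < e -> exists j, rnorm (x - d j) < e.

Lemma c0_finite_null (s : seq nat) : null_sequence (fun p => if (p < size s)%N then d (nth 0%N s p) else 0).
Proof.
move=> e e0; exists (size s) => n; rewrite leqNgt => /negbTE->.
by rewrite rnorm0 ltW.
Qed.

Definition c0_finite (s : seq nat) : c0 := sval (c0_mk (c0_finite_null s)).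

Lemma c0_finiteE s p : c0_finite s p = if (p < size s)%N then d (nth 0%N s p) else 0.
Proof. by rewrite /c0_finite (svalP (c0_mk _)). Qed.

Lemma c0_finite_dense x (e : R) : 0 < e -> exists s, rnorm (x - c0_finite s) <= e.
Proof.
move=> e0; have [N hN] := c0_null x e0.
have ch p : exists j, rnorm (x p - d j) < e by exact: dd.
have [j hj] := choice ch.
exists (mkseq j N); apply/c0_rnorm_leP => p; rewrite c0B c0_finiteE size_mkseq.
by case: ltnP => pN; [rewrite nth_mkseq// ltW|rewrite subr0 hN].
Qed.

(** The length bound k makes a block fit into the gap around its position. The rescaled entries are
    at most the square root of k, hence negligible after division by a distance of order k. *)
Definition admissible (s : seq nat) (k : nat) :=
  (size s <= k)%N /\
  forall p, (p < size s)%N -> (p.+1%:R * rnorm (d (nth 0%N s p))) ^+ 2 <= k%:R.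

(** The valuation makes every code of a finite list recur for infinitely many k; the empty list
    replaces one still too large for k. *)
Definition block (k : nat) : seq nat :=
  let s : seq nat := odflt [::] (choice.unpickle (logn 2 k.+1)) in
  if `[<admissible s k>] then s else [::].

Lemma block_admissible k : admissible (block k) k.
Proof. by rewrite /block; case: ifP => [/asboolP|_]. Qed.

Lemma admissible_eventually s : exists N, forall k, (N <= k)%N -> admissible s k.
Proof.
have [B hB] : exists B, forall p, (p < size s)%N ->
    (p.+1%:R * rnorm (d (nth 0%N s p))) ^+ 2 <= B%:R.
  apply: bounded_choice => [p j j' jj' h|p _].
    by apply: le_trans h _; rewrite ler_nat.
  by eexists; exact/ltW/truncnS_gt.
exists (maxn (size s) B) => k; rewrite geq_max => /andP[sk Bk]; split=> // p /hB h.
by apply: le_trans h _; rewrite ler_nat.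
Qed.

Lemma block_onto s N : exists2 k, (N <= k)%N & block k = s.
Proof.
have [M hM] := admissible_eventually s.
have [k Nk ks] := logn2_onto (choice.pickle s) (maxn N M).
exists k; first by apply: leq_trans Nk; rewrite leq_maxl.
rewrite /block ks choice.pickleK /= ifT//; apply/asboolP/hM.
by apply: leq_trans Nk; rewrite leq_maxr.
Qed.

(* [h] carries, from each position [sep_pos j] on, the block of index [ruler j]
   rescaled by the weights, and [u_t = h_t / (t + 1)]. *)
Lemma block_sequence : exists h : nat -> L,
  (forall j p, (p < size (block (ruler j)))%N ->
     h (sep_pos j + p)%N = of_real F p.+1%:R *: d (nth 0%N (block (ruler j)) p)) /\
  (forall t, h t <> 0 -> exists2 j,
     (sep_pos j <= t < sep_pos j + size (block (ruler j)))%N &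
     rnorm (h t) ^+ 2 <= (ruler j)%:R).
Proof.
pose P t j := (sep_pos j <= t < sep_pos j + size (block (ruler j)))%N.
have uniqP t i j : P t i -> P t j -> i = j.
  move=> /andP[i1 i2] /andP[j1 j2].
  have [bi _] := block_admissible (ruler i); have [bj _] := block_admissible (ruler j).
  by case: (ltngtP i j) => // /sep_pos_gap; lia.
have ch t : exists j, (exists j', P t j') -> P t j.
  by case: (pselect (exists j', P t j')) => [[j ?]|?]; [exists j|exists 0%N].
have [lab labP] := choice ch.
pose v j p : L := of_real F p.+1%:R *: d (nth 0%N (block (ruler j)) p).
exists (fun t => if P t (lab t) then v (lab t) (t - sep_pos (lab t))%N else 0); split.
  move=> j p ps; have Pj : P (sep_pos j + p)%N j by rewrite /P leq_addr ltn_add2l.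
  have Pl := labP _ (ex_intro _ j Pj).
  by rewrite Pl (uniqP _ _ _ Pl Pj) addKn.
move=> t; case: ifP => // Pt _; exists (lab t) => //.
have [_ h] := block_admissible (ruler (lab t)).
rewrite /v rnorm_of_realZ//; apply: h; move: Pt => /andP[]; lia.
Qed.

(** From [a ^+ 2 <= q + 1] the quotient is at most the inverse square root of q + 1. *)
Lemma sqr_le_small (a e : R) (l q : nat) : 0 <= a -> 0 < e -> a ^+ 2 <= l%:R ->
  (l <= q)%N -> e ^- 2 <= q.+1%:R -> a / q.+1%:R <= e.
Proof.
move=> a0 e0 al lq eq; have q0 : 0 < q.+1%:R :> R by rewrite ltr0n.
rewrite ler_pdivrMr//.
have eq0 : 0 <= e * q.+1%:R by rewrite mulr_ge0// ltW.
suff : a ^+ 2 <= (e * q.+1%:R) ^+ 2 by rewrite ler_pXn2r.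
apply: le_trans al _; apply: (@le_trans _ _ q.+1%:R).
  by rewrite ler_nat; exact: leqW.
rewrite exprMn [q.+1%:R ^+ 2]expr2 mulrA; apply: ler_peMl; first exact: ltW.
by rewrite mulrC -ler_pdivrMr ?exprn_gt0// div1r.
Qed.

Lemma weighted_shift_frequently_hypercyclic :
  frequently_hypercyclic R weighted_shift_op.
Proof.
have [h [hblock hsmall]] := block_sequence.
have enough (e : R) : exists N : nat, forall n, (N <= n)%N -> e ^- 2 <= n.+1%:R.
  exists (Num.truncn (e ^- 2)) => n Nn; apply/ltW.
  by apply: lt_le_trans (truncnS_gt _) _; rewrite ler_nat ltnS.
have [|u uE] := @c0_mk R F (fun t => of_real F t.+1%:R^-1 *: h t).
  move=> e e0; have [N hN] := enough e; exists N => t Nt.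
  rewrite rnorm_of_realZ// mulrC.
  have [ht|/eqP ht] := eqVneq (h t) 0; first by rewrite ht rnorm0 mul0r ltW.
  have [j /andP[jt _] hj] := hsmall t ht.
  (* Here [ruler j <= sep_pos j <= t], so [h t] is at most of the order of the square root of t. *)
  apply: (sqr_le_small (rnorm_ge0 _) e0 hj _ (hN t Nt)).
  by apply: leq_trans jt; rewrite /sep_pos leq_addl.
have orb n p : iter n weighted_shift_op u p = of_real F p.+1%:R^-1 *: h (p + n)%N.
  rewrite iter_weighted_shift uE scalerA -of_realM; congr (of_real F _ *: _).
  by rewrite mulrAC divff// mul1r.
apply/frequently_hypercyclicP; exists u => x e e0.
have e30 : 0 < e / 3 by lra.
have [s xs] := c0_finite_dense x e30.
have [N hN] := enough (e / 3).
have [k Nk ks] := block_onto s N.+1.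
have k1 : (1 <= k)%N by apply: leq_trans Nk.
apply: lower_dense_sub (sep_set_lower_dense R k1) => _ [j jk <-] /=.
suff : rnorm (c0_finite s - iter (sep_pos j) weighted_shift_op u) <= e / 3.
  by move=> hs; apply: le_lt_trans (rnorm_triangle (c0_finite s) _ _) _; lra.
apply/c0_rnorm_leP => p; rewrite c0B orb c0_finiteE addnC.
case: ltnP => ps.
  rewrite hblock ?jk ?ks// scalerA -of_realM mulVf// of_real1 scale1r subrr rnorm0.
  exact: ltW.
rewrite sub0r rnormN rnorm_of_realZ// mulrC.
have [ht|/eqP ht] := eqVneq (h (sep_pos j + p)%N) 0; first by rewrite ht rnorm0 mul0r ltW.
have [i /andP[i1 i2] hi] := hsmall _ ht.
have [bi _] := block_admissible (ruler i).
case: (ltngtP i j) => [/sep_pos_gap|ij|e'].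
- by move=> ij; exfalso; lia.
(* A later block i starts at distance at least [ruler i + k], so p exceeds both [ruler i] and N: its
   entries, of size at most the square root of [ruler i], are divided by p + 1. *)
- have := sep_pos_gap ij; rewrite jk => gap.
  apply: (sqr_le_small (rnorm_ge0 _) e30 hi); first lia.
  by apply: hN; lia.
- by move: i2; rewrite e' jk ks ltn_add2l ltnNge ps.
Qed.

Lemma c0_separable_of_dense : separable c0.
Proof.
apply: (@separable_seq _ _ _ (fun n => c0_finite (odflt [::] (choice.unpickle n)))) => x e e0.
have e20 : 0 < e / 2 by lra.
have [s hs] := c0_finite_dense x e20; exists (choice.pickle s).
by rewrite choice.pickleK /=; lra.
Qed.

End FrequentlyHypercyclic.

Lemma weighted_shift_counterexample :
  [/\ separable c0, frequently_hypercyclic R weighted_shift_op &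
      ~ lower_dense_hypercyclicity_criterion weighted_shift_op].
Proof.
have dT : dense [set: L].
  by apply/denseP => z e e0; exists z => //; rewrite subrr rnorm0.
have [d [_ dd]] := separable_dense_seq (scalar_line_separable F) dT.
split; [exact: c0_separable_of_dense dd| |exact: weighted_shift_no_criterion].
exact: weighted_shift_frequently_hypercyclic dd.
Qed.

End WeightedShift.

(** * Assembling the implications and the counterexamples *)

Lemma criteria_chain (R : realType) (F : scalars)
    (X : completeNormedModType (scalar_field R F)) (T : 'L(X)) : separable X ->
  [/\ holds T BT_chaotic <-> holds T T_FHC,
      holds T T_FHC -> holds T T_lower_dense_HC,
      holds T T_lower_dense_HC <-> holds T BT_frequently_hypercyclic &
      holds T BT_frequently_hypercyclic -> holds T T_frequently_hypercyclic].
Proof.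
move=> sX; split=> /=.
- split=> [[_]|cT]; first exact: periodic_frequent_criterion.
  split; last exact: frequent_criterion_periodic.
  apply: (@frequently_hypercyclic_hypercyclic R F).
  exact/lower_dense_criterion_BT_frequently_hypercyclic/frequent_criterion_lower_dense.
- exact: frequent_criterion_lower_dense.
- split; first exact: lower_dense_criterion_BT_frequently_hypercyclic.
  exact: BT_frequently_hypercyclic_criterion.
- move=> /(BT_frequently_hypercyclic_criterion sX).
  exact: criterion_frequently_hypercyclic.
Qed.

Lemma follows_chain :
  [/\ follows T_FHC T_lower_dense_HC,
      follows T_lower_dense_HC BT_frequently_hypercyclic,
      follows BT_frequently_hypercyclic T_lower_dense_HC &
      follows BT_frequently_hypercyclic T_frequently_hypercyclic].
Proof. by split; apply: rt_step; constructor. Qed.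


Theorem theorem4p8 (R : realType) (F : scalars) :
  (forall (X : completeNormedModType (scalar_field R F)) (T : 'L(X)),
     separable X ->
     [/\ holds T BT_chaotic <-> holds T T_FHC,
         holds T T_FHC -> holds T T_lower_dense_HC,
         holds T T_lower_dense_HC <-> holds T BT_frequently_hypercyclic &
         holds T BT_frequently_hypercyclic ->
         holds T T_frequently_hypercyclic]) /\
  (forall i j : assertion, ~ follows i j ->
     exists (X : completeNormedModType (scalar_field R F)) (T : 'L(X)),
       [/\ separable X, holds T i & ~ holds T j]).
Proof.
split=> [X T|i j nij]; first exact: criteria_chain.
have [Tt [t3 nt2]] := tree_counterexample R F.
have sepT : separable (ell1 (scalar_line R F)).
  exact/ell1_separable/scalar_line_separable.
have [[t12 _] _ [t34 _] t45] := criteria_chain Tt sepT.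
have [sepC c5 nc3] := @weighted_shift_counterexample R F.
have [[c12 _] c23 [_ c43] _] := criteria_chain (@weighted_shift_op R F) sepC.
have [f23 f34 f43 f45] := follows_chain.
have f12 : follows BT_chaotic T_FHC by apply: rt_step; constructor.
have f21 : follows T_FHC BT_chaotic by apply: rt_step; constructor.
have tr a b c : follows a b -> follows b c -> follows a c by exact: rt_trans.
have f35 := tr _ _ _ f34 f45; have f24 := tr _ _ _ f23 f34; have f25 := tr _ _ _ f23 f35.
have f13 := tr _ _ _ f12 f23; have f14 := tr _ _ _ f12 f24; have f15 := tr _ _ _ f12 f25.
have refl a : follows a a by exact: rt_refl.
have tree i' : holds Tt i' -> forall j', (holds Tt j' -> holds Tt T_FHC) ->
    exists (X : completeNormedModType (scalar_field R F)) (T : 'L(X)),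
      [/\ separable X, holds T i' & ~ holds T j'].
  by move=> hi j' hj; exists (ell1 (scalar_line R F)), Tt; split=> // /hj.
have shift j' : (holds (@weighted_shift_op R F) j' ->
      holds (@weighted_shift_op R F) T_lower_dense_HC) ->
    exists (X : completeNormedModType (scalar_field R F)) (T : 'L(X)),
      [/\ separable X, holds T T_frequently_hypercyclic & ~ holds T j'].
  by move=> hj; exists (c0 R F), (@weighted_shift_op R F); split=> // /hj.
(* The pairs left are (3) and (4) against (1) and (2), refuted by the tree, and (5) against the
   other four, refuted by the weighted shift. *)
case: i nij; case: j => nij; try by [exfalso; apply: nij].
- exact: (tree T_lower_dense_HC t3 BT_chaotic t12).
- exact: (tree T_lower_dense_HC t3 T_FHC id).
- exact: (tree BT_frequently_hypercyclic (t34 t3) BT_chaotic t12).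
- exact: (tree BT_frequently_hypercyclic (t34 t3) T_FHC id).
- by apply: (shift BT_chaotic) => /c12/c23.
- by apply: (shift T_FHC) => /c23.
- exact: (shift T_lower_dense_HC id).
- exact: (shift BT_frequently_hypercyclic c43).
Qed.
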